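(* There exists a constant $C>0$ such that the following holds for every $\nu>0$ and every zero-mean function $f_0\in H^2(\mathbb{T})$ satisfying $$\|f_0\|_{H^2(\mathbb{T})}\le\frac1C\min\{1,\ \nu^{-\frac14}\}.$$ There exists a unique solution $f\in C(\mathbb{R}_+;H^2(\mathbb{T}))\cap L^2(\mathbb{R}_+;H^{\frac72}(\mathbb{T}))$ of the Cauchy problem $$\partial_t f=-\nu\Lambda^3 f-\Lambda f+\partial_x\Big([\mathcal{H},f]\big(\nu\Lambda^3 f+\Lambda f\big)\Big),\qquad f|_{t=0}=f_0,$$ such that for any $t>0$ $$\|f(t)\|_{H^2(\mathbb{T})}^2+\int_0^t\Big[\nu\|\Lambda^{3/2}f(s)\|_{H^2(\mathbb{T})}^2+\|\Lambda^{1/2}f(s)\|_{H^2(\mathbb{T})}^2\Big]ds\le\|f_0\|_{H^2(\mathbb{T})}^2 .$$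
   Context: $\mathbb{T}=\mathbb{R}/2\pi\mathbb{Z}$. For a function $u$ on $\mathbb{T}$ the Fourier coefficients are $\hat u(n)=\frac{1}{\sqrt{2\pi}}\int_{\mathbb{T}}u(x)e^{-inx}\,dx$. The Hilbert transform $\mathcal{H}$ and the operators $\Lambda^r$ are the Fourier multipliers $\widehat{\mathcal{H}u}(n)=-i\,\mathrm{sgn}(n)\hat u(n)$ and $\widehat{\Lambda^r u}(n)=|n|^r\hat u(n)$. The commutator is $[\mathcal{H},f]g=\mathcal{H}(fg)-f\,\mathcal{H}g$. Expanded, the equation reads $$\partial_t f+\nu\Lambda^3 f+\Lambda f=\nu\big[\Lambda(f\Lambda^3 f)-\partial_x(f\partial_x^3 f)\big]+\big[\Lambda(f\Lambda f)+\partial_x(f\partial_x f)\big].$$ All functions are real-valued and have zero average (the equation conserves the average). For $s\ge0$ the Sobolev space $H^s(\mathbb{T})=\dot H^s(\mathbb{T})$ consists of the zero-average functions $u$ with $\|u\|_{H^s}^2=\sum_{k\in\mathbb{Z}}|k|^{2s}|\hat u(k)|^2<\infty$ (the norm may be replaced by the equivalent Littlewood–Paley one). $\mathbb{R}_+=[0,\infty)$. A solution is understood in the sense of distributions with the initial datum attained at $t=0$. *)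

(* Defs.v *)
From HB Require Import structures.
From mathcomp Require Import all_boot all_order all_algebra.
From mathcomp Require Import all_classical all_reals all_analysis.
From mathcomp Require Import complex.
Set Implicit Arguments.
Unset Strict Implicit.
Unset Printing Implicit Defensive.
Import Order.TTheory GRing.Theory Num.Theory numFieldNormedType.Exports.
Local Open Scope classical_set_scope.
Local Open Scope ring_scope.

(* A real function on T = R / 2 pi Z is a 2 pi-periodic function R -> R, and a
   function of time and space is f : R -> R -> R, with f t the profile at time
   t; only the times t >= 0 matter.  Elements of L2 and of the Sobolev spaces
   are represented by functions, identified when equal almost everywhere. *)

Section Torus.
Context {R : realType}.
Implicit Types (u v g : R -> R) (f phi : R -> R -> R) (r s t x nu : R).

Local Notation mu := (@lebesgue_measure R).

Definition circle : set R := `[0, pi *+ 2]%classic.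

Definition L2T u : Prop :=
  [/\ periodic u (pi *+ 2),
      measurable_fun [set: R] u &
      (\int[mu]_(x in circle) ((u x) ^+ 2)%:E < +oo)%E].

Definition fourier u (n : int) : R[i] :=
  (Num.sqrt (pi *+ 2))^-1%:C%C *
  ((\int[mu]_(x in circle) (u x * cos (n%:~R * x)))
   -i* (\int[mu]_(x in circle) (u x * sin (n%:~R * x))))%C.

(* The function v in L2(T) with v^(n) = m(n) u^(n) for all n.  It is unique up
   to a.e. equality; the value is a default one when no such v exists. *)
Definition fourier_mult (m : int -> R[i]) u : R -> R :=
  get [set v | L2T v /\ forall n, fourier v n = m n * fourier u n].

Definition hilbert : (R -> R) -> R -> R :=
  fourier_mult (fun n => - 'i%C * (sgz n)%:~R).

Definition Lambda r : (R -> R) -> R -> R :=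
  fourier_mult (fun n => ((`|n|%:~R : R) `^ r)%:C%C).

Definition hilbert_comm u g : R -> R :=
  fun x => hilbert (fun y => u y * g y) x - u x * hilbert g x.

Definition sobolev_norm s u : \bar R :=
  sqrte (\esum_(k in [set: int])
    ((`|k|%:~R : R) `^ (2 * s) * Normc.normc (fourier u k) ^+ 2)%:E)%E.

Definition sobolev s u : Prop :=
  [/\ L2T u, \int[mu]_(x in circle) u x = 0 & (sobolev_norm s u < +oo)%E].

Definition C_sobolev s f : Prop :=
  (forall t, 0 <= t -> sobolev s (f t)) /\
  (forall t0, 0 <= t0 ->
     sobolev_norm s (fun x => f t x - f t0 x)
       @[t --> within `[0, +oo[ (nbhs t0)] --> (0 : \bar R)).

(* H^s being a separable Hilbert space, measurability of t |-> f t is that of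
   its Fourier coefficients. *)
Definition L2_sobolev s f : Prop :=
  [/\ forall k, measurable_fun (`[0, +oo[ : set R) (fun t => complex.Re (fourier (f t) k)) /\
                measurable_fun (`[0, +oo[ : set R) (fun t => complex.Im (fourier (f t) k)),
      {ae mu, forall t, 0 <= t -> sobolev s (f t)} &
      (\int[mu]_(t in `[0%R, +oo[) sobolev_norm s (f t) ^+ 2 < +oo)%E].

(* D i j is the mixed partial derivative of order i in t and j in x. *)
Definition smooth2 phi : Prop :=
  exists D : nat -> nat -> R -> R -> R,
    D 0%N 0%N = phi /\
    forall i j,
      continuous (fun p : R * R => D i j p.1 p.2) /\
      forall t x, is_derive t 1 (fun t' => D i j t' x) (D i.+1 j t x) /\
                  is_derive x 1 (fun x' => D i j t x') (D i j.+1 t x).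

(* Test functions on the open set (0, +oo) x T. *)
Definition test_function phi : Prop :=
  [/\ smooth2 phi, forall t, periodic (phi t) (pi *+ 2) &
      exists a b : R, 0 < a /\ forall t x, phi t x != 0 -> a <= t <= b].

(* d_t f = - nu Lambda^3 f - Lambda f + d_x ([H, f] (nu Lambda^3 f + Lambda f))
   in D'((0, +oo) x T).  For f in C(R_+; H^2) and L^2(R_+; H^(7/2)), for almost
   every t all the multipliers below act on elements of their domains, and the
   integrals converge absolutely. *)
Definition distributional_solution nu f : Prop :=
  forall phi, test_function phi ->
    \int[mu]_(t in `[0, +oo[)
      \int[mu]_(x in circle)
        (let w := fun y => nu * Lambda 3 (f t) y + Lambda 1 (f t) y in
         f t x * derive1 (fun t' => phi t' x) t
         - w x * phi t x
         - hilbert_comm (f t) w x * derive1 (phi t) x) = 0.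

Definition cauchy_solution nu (f0 : R -> R) f : Prop :=
  [/\ C_sobolev 2 f, L2_sobolev (7 / 2) f, distributional_solution nu f &
      {ae mu, forall x, f 0 x = f0 x}].

End Torus.

(* Main.v *)
(* The symbol of [H, f] w at frequency n involves w only at frequencies m with
   sgn m <> sgn n, hence f only at n + |m|.  With lam_n = nu n^3 + n, the cosine and
   sine coefficients of a solution therefore satisfy
     p_n' = - lam_n p_n + (n / pi) sum_(j >= 1) lam_j (p_(n+j) p_j + q_(n+j) q_j),
     q_n' = - lam_n q_n + (n / pi) sum_(j >= 1) lam_j (q_(n+j) p_j - p_(n+j) q_j).
   Put ker n j = n lam_j / lam_n; then n^2 ker n j <= (n + j)^2 j.

   Existence.  Let al_n be the size of the initial coefficients of frequency n and
   Y the solution of Y_n = al_n + 2 sum_j ker n j Y_(n+j) Y_j.  Since lam_(n+j) >=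
   lam_n and lam_j >= 0, the Picard iterates stay below the profile
     al_n x^2 + (Y_n - al_n) (x - x^2),   x = exp (- lam_n t / 2),
   for all t >= 0.  By Young's inequality Y_n - al_n is small compared with al_n in
   l^2 with weight n^4 om_n, for every nondecreasing om.  Integrating the square of
   the profile in time, one finds that the energy inequality at time t gains
   om_n (al_n^2 - (Y_n - al_n)^2) / 3 with om_n = 1 - exp (- 3 lam_n t / 2), which is
   nonnegative after summation: this is why the constant in it is 1.

   Uniqueness.  Testing with chi(t) cos nx and chi(t) sin nx shows that the
   coefficients of any solution satisfy the same system.  As long as both solutions
   are small in H^2, Duhamel's formula halves every bound on sup n^2 |d_n| for their
   difference d, and smallness propagates by continuity in time. *)
Require Import Defs.
From HB Require Import structures.
From mathcomp Require Import all_boot all_order all_algebra.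
From mathcomp Require Import all_classical all_reals all_analysis.
From mathcomp Require Import complex ring lra measurable_realfun.
Set Implicit Arguments.
Unset Strict Implicit.
Unset Printing Implicit Defensive.
Import Order.TTheory GRing.Theory Num.Theory numFieldNormedType.Exports.
Local Open Scope classical_set_scope.
Local Open Scope ring_scope.

(** Formally the nonlinearity carries one derivative more than the dissipation, so it can be
    absorbed only by smallness, and this smallness has to be uniform in [nu]. Both points rest on
    the one-sided coupling: the partner of frequency j is n + j, which decays at least as fast as
    frequency n, and in the ratio [ker n j] the powers of [nu] balance. Decay is tracked at half the
    linear rate, x = exp (- lam_n t / 2), because a forcing that decays at the full rate would be
    resonant and cost a factor lam_n t. In the profile, x^2 is the free linear decay and x - x^2 the
    response to a forcing proportional to lam_n x. A free mode satisfies y^2 + 2 lam_n int y^2 =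
    y(0)^2, whereas the energy inequality asks for only half of this dissipation; the spare half
    pays for the nonlinear part. A competing solution comes with no decay profile, hence the
    comparison in sup n^2 |d_n|, where only the H^2 size of the two solutions enters. *)

Lemma aeS d (T : measurableType d) (R : realType) (mu : {measure set T -> \bar R}) (P Q : T -> Prop) :
  (forall x, P x -> Q x) -> {ae mu, forall x, P x} -> {ae mu, forall x, Q x}.
Proof. by move=> PQ; apply: filterS. Qed.

(** * Integration over the circle *)

Section CircleIntegral.
Context {R : realType}.
Implicit Types (u v g h : R -> R) (x y t : R).
Local Notation mu := (@lebesgue_measure R).
Local Notation intc u := (mu.-integrable (@circle R) (EFin \o u)).
Local Notation J u := (\int[mu]_(x in @circle R) u x).

Lemma measurable_circle : measurable (@circle R : set (measurableTypeR R)).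
Proof. exact: measurable_itv. Qed.

Lemma twopi_gt0 : 0 < pi *+ 2 :> R.
Proof. by rewrite pmulrn_lgt0// pi_gt0. Qed.

Lemma measure_circle : mu (@circle R) = (pi *+ 2)%:E.
Proof. by rewrite lebesgue_measure_itv/= lte_fin twopi_gt0 oppr0 adde0. Qed.

Lemma circle_finite : (mu (@circle R) < +oo)%E.
Proof. by rewrite measure_circle ltry. Qed.

Lemma bounded_intc u (M : R) : measurable_fun (@circle R) u ->
  (forall x, circle x -> `|u x| <= M) -> intc u.
Proof.
move=> mu_ bu; apply: measurable_bounded_integrable => //.
- exact: measurable_circle.
- exact: circle_finite.
- exists M; split; first exact: num_real.
  by move=> y My x cx; apply: le_trans (bu _ cx) (ltW My).
Qed.

Lemma intc_measurable u : intc u -> measurable_fun (@circle R) u.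
Proof. by move=> /integrableP[/measurable_EFinP]. Qed.

Lemma continuous_intc u : continuous u -> intc u.
Proof.
move=> cu; apply: continuous_compact_integrable; first exact: segment_compact.
exact: continuous_subspaceT.
Qed.

Lemma intcM u h (M : R) : intc u -> measurable_fun (@circle R) h ->
  (forall x, circle x -> `|h x| <= M) -> intc (fun x => u x * h x).
Proof.
move=> iu mh bh.
have iM : intc (fun x => M * u x).
  by have := integrableZl measurable_circle M iu.
apply: le_integrable iM => //; first exact: measurable_circle.
  by apply/measurable_EFinP; apply: measurable_funM => //; exact: intc_measurable.
move=> x cx /=; rewrite lee_fin !normrM mulrC ler_wpM2r//.
by rewrite (le_trans (bh _ cx))// ler_norm.
Qed.

Lemma intcD u v : intc u -> intc v -> intc (fun x => u x + v x).
Proof. by move=> iu iv; have := integrableD measurable_circle iu iv. Qed.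
Lemma intcB u v : intc u -> intc v -> intc (fun x => u x - v x).
Proof. by move=> iu iv; have := integrableB measurable_circle iu iv. Qed.
Lemma intcZ (a : R) u : intc u -> intc (fun x => a * u x).
Proof. by move=> iu; have := integrableZl measurable_circle a iu. Qed.
Lemma intc_norm u : intc u -> intc (fun x => `|u x|).
Proof. by move=> iu; have := integrable_norm iu. Qed.

Lemma intc_sum n (F : nat -> R -> R) : (forall k, (k < n)%N -> intc (F k)) ->
  intc (fun x => \sum_(k < n) F k x).
Proof.
elim: n => [|n IH] iF.
  under eq_fun do rewrite big_ord0.
  by apply: (@bounded_intc _ 0) => // x _; rewrite normr0.
under eq_fun do rewrite big_ord_recr/=.
by apply: intcD; [apply: IH => k kn; apply: iF; rewrite ltnS ltnW|exact: iF].
Qed.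

Lemma EFin_J u : intc u -> (\int[mu]_(x in @circle R) (u x)%:E)%E = (J u)%:E.
Proof. by move=> iu; rewrite /Rintegral fineK//; have := integrable_fin_num measurable_circle iu. Qed.

Lemma JD u v : intc u -> intc v -> J (fun x => u x + v x) = J u + J v.
Proof. by move=> iu iv; rewrite RintegralD//; exact: measurable_circle. Qed.
Lemma JB u v : intc u -> intc v -> J (fun x => u x - v x) = J u - J v.
Proof. by move=> iu iv; rewrite RintegralB//; exact: measurable_circle. Qed.
Lemma JZ (a : R) u : intc u -> J (fun x => a * u x) = a * J u.
Proof. by move=> iu; rewrite RintegralZl//; exact: measurable_circle. Qed.
Lemma JN u : intc u -> J (fun x => - u x) = - J u.
Proof.
move=> iu; rewrite -mulN1r -JZ//; apply: eq_Rintegral => x _.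
by rewrite mulN1r.
Qed.
Lemma J0 : J (fun _ => 0) = 0.
Proof. by rewrite Rintegral_cst ?mul0r//; exact: measurable_circle. Qed.

Lemma Jcst (a : R) : J (fun _ => a) = a * (pi *+ 2).
Proof.
transitivity (a * fine (mu (@circle R))); first exact: Rintegral_cst measurable_circle a.
by rewrite measure_circle.
Qed.

Lemma J_sum n (F : nat -> R -> R) : (forall k, (k < n)%N -> intc (F k)) ->
  J (fun x => \sum_(k < n) F k x) = \sum_(k < n) J (F k).
Proof.
elim: n => [|n IH] iF.
  by rewrite big_ord0; under eq_Rintegral do rewrite big_ord0; exact: J0.
rewrite big_ord_recr/= -IH; last by move=> k kn; apply: iF; rewrite ltnS ltnW.
rewrite -JD//; last exact: iF.
  by apply: eq_Rintegral => x _; rewrite big_ord_recr.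
by apply: intc_sum => k kn; apply: iF; rewrite ltnS ltnW.
Qed.

Lemma le_J u v : intc u -> intc v -> (forall x, circle x -> u x <= v x) -> J u <= J v.
Proof. by move=> iu iv uv; apply: le_Rintegral => //; exact: measurable_circle. Qed.

Lemma norm_J u : intc u -> `|J u| <= J (fun x => `|u x|).
Proof. by move=> iu; apply: le_normr_Rintegral => //; exact: measurable_circle. Qed.

Lemma J_ge0 u : (forall x, circle x -> 0 <= u x) -> 0 <= J u.
Proof. by move=> u0; apply: Rintegral_ge0 => x; exact: u0. Qed.

Lemma aeI (P Q : R -> Prop) : {ae mu, forall x, P x} -> {ae mu, forall x, Q x} ->
  {ae mu, forall x, P x /\ Q x}.
Proof.
move=> hP hQ; apply: negligibleS (negligibleU hP hQ) => x /= /not_andP[]; by [left|right].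
Qed.

Lemma ae_forall (P : nat -> R -> Prop) : (forall n, {ae mu, forall x, P n x}) ->
  {ae mu, forall x, forall n, P n x}.
Proof.
move=> hP; apply: negligibleS (negligible_bigcup hP) => x /= /existsNP[n Pn].
by exists n.
Qed.

Lemma ae_neq (a : R) : {ae mu, forall x, x != a}.
Proof.
exists [set a]; split; [exact: measurable_set1|exact: lebesgue_measure_set1|].
by move=> x /= /negP; rewrite negbK => /eqP ->.
Qed.

Lemma ae_eq_J u v : measurable_fun (@circle R) u -> measurable_fun (@circle R) v ->
  {ae mu, forall x, circle x -> u x = v x} -> J u = J v.
Proof.
move=> mu_ mv uv; congr fine; apply: ae_eq_integral => //=.
- exact: measurable_circle.
- exact/measurable_EFinP.
- exact/measurable_EFinP.
- by apply: aeS uv => x + cx => /(_ cx) ->.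
Qed.

Lemma continuous_cosl (a b : R) : continuous (fun x => cos (a * x + b)).
Proof.
move=> x; apply: (@continuous_comp _ _ _ (fun x => a * x + b) cos); last exact: continuous_cos.
by apply: cvgD; [apply: cvgM; [exact: cvg_cst|exact: cvg_id]|exact: cvg_cst].
Qed.

Lemma measurable_cosl (D : set R) (a b : R) : measurable_fun D (fun x => cos (a * x + b)).
Proof. by apply: measurable_funTS; apply: continuous_measurable_fun; exact: continuous_cosl. Qed.

Lemma intc_cosl u (a b : R) : intc u -> intc (fun x => u x * cos (a * x + b)).
Proof.
by move=> iu; apply: (@intcM _ _ 1) => // [|x _]; [exact: measurable_cosl|exact: cos_max].
Qed.

Lemma cosl_cos (a x : R) : cos (a * x) = cos (a * x + 0).
Proof. by rewrite addr0. Qed.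
Lemma sinl_cos (a x : R) : sin (a * x) = cos (a * x + (- (pi / 2))).
Proof. by rewrite cosBpihalf. Qed.

Lemma intc_cos u (a : R) : intc u -> intc (fun x => u x * cos (a * x)).
Proof. by move=> iu; under eq_fun do rewrite cosl_cos; exact: intc_cosl. Qed.
Lemma intc_sin u (a : R) : intc u -> intc (fun x => u x * sin (a * x)).
Proof. by move=> iu; under eq_fun do rewrite sinl_cos; exact: intc_cosl. Qed.

(** * Completeness of the trigonometric system for integrable functions *)

Section Completeness.
Variable u : R -> R.
Hypothesis iu : intc u.
Hypothesis cu0 : forall n : nat, J (fun x => u x * cos (n%:R * x)) = 0.
Hypothesis su0 : forall n : nat, J (fun x => u x * sin (n%:R * x)) = 0.

Let cosl0 (m : int) (b : R) : J (fun x => u x * cos (m%:~R * x + b)) = 0.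
Proof.
have H (n : nat) c : J (fun x => u x * cos (n%:R * x + c)) = 0.
  transitivity (J (fun x => cos c * (u x * cos (n%:R * x)) - sin c * (u x * sin (n%:R * x)))).
    by apply: eq_Rintegral => x _; rewrite cosD; ring.
  by rewrite JB ?JZ ?cu0 ?su0 ?mulr0 ?subr0//; try apply: intcZ; by [exact: intc_cos|exact: intc_sin].
case: m => n; first exact: H.
rewrite -[RHS](H n.+1 (- b)); apply: eq_Rintegral => x _.
by rewrite NegzE mulrNz -cosN; congr (_ * cos _); rewrite -pmulrn; ring.
Qed.

(** By product-to-sum, one factor [cos (x - c)] moves the frequency up or down by 1 and shifts the
    phase. All integer frequencies and all phases are quantified so that the induction on [k] can
    absorb both effects. *)
Let cosX0 (c : R) (k : nat) : forall (m : int) (b : R),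
  J (fun x => u x * cos (x - c) ^+ k * cos (m%:~R * x + b)) = 0.
Proof.
elim: k => [|k IH] m b.
  by rewrite -[RHS](cosl0 m b); apply: eq_Rintegral => x _; rewrite expr0 mulr1.
have iuk : intc (fun x => u x * cos (x - c) ^+ k).
  apply: (@intcM _ _ 1) => //.
    apply: measurable_funX; have := @measurable_cosl circle 1 (- c).
    by under eq_fun do rewrite mul1r.
  by move=> x _; rewrite normrX exprn_ile1// cos_max.
transitivity (J (fun x => 2^-1 * (u x * cos (x - c) ^+ k * cos ((m + 1)%:~R * x + (b - c)))
   + 2^-1 * (u x * cos (x - c) ^+ k * cos ((m - 1)%:~R * x + (b + c))))).
  apply: eq_Rintegral => x _.
  have -> : (m + 1)%:~R * x + (b - c) = (m%:~R * x + b) + (x - c) by rewrite intrD; ring.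
  have -> : (m - 1)%:~R * x + (b + c) = (m%:~R * x + b) - (x - c) by rewrite intrB; ring.
  by rewrite exprS; move: (x - c) (m%:~R * x + b) => y z; rewrite cosD cosB; field.
by rewrite JD ?JZ ?IH ?mulr0 ?addr0//; try apply: intcZ; exact: intc_cosl.
Qed.

Let poly0 (c : R) (p : {poly R}) : J (fun x => u x * p.[cos (x - c)]) = 0.
Proof.
have iuk (a : R) k : intc (fun x => u x * (a * cos (x - c) ^+ k)).
  apply: (@intcM _ _ `|a|) => //.
    apply: measurable_funM => //.
    apply: measurable_funX; have := @measurable_cosl circle 1 (- c).
    by under eq_fun do rewrite mul1r.
  by move=> x _; rewrite normrM normrX ler_piMr// exprn_ile1// cos_max.
transitivity (J (fun x => \sum_(k < size p) u x * (p`_k * cos (x - c) ^+ k))).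
  by apply: eq_Rintegral => x _; rewrite horner_coef mulr_sumr.
rewrite (@J_sum _ (fun k x => u x * (p`_k * cos (x - c) ^+ k)))// big1// => k _.
transitivity (J (fun x => p`_k * (u x * cos (x - c) ^+ k * cos (0%:~R * x + 0)))).
  by apply: eq_Rintegral => x _; rewrite mul0r addr0 cos0; ring.
rewrite JZ ?cosX0 ?mulr0//; apply: intc_cosl.
by have := iuk 1 k; under eq_fun do rewrite mul1r.
Qed.


Let bernoulli_le (x : R) n : 0 <= x <= 1 -> 1 - n%:R * x <= (1 - x) ^+ n.
Proof.
move=> /andP[x0 x1]; elim: n => [|n IH]; first by rewrite mul0r subr0 expr0.
rewrite exprS; have h : 0 <= n%:R :> R by [].
apply: (@le_trans _ _ ((1 - x) * (1 - n%:R * x))); last by rewrite ler_wpM2l// subr_ge0.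
by rewrite -natr1; nra.
Qed.

(** Since (1 - x)^n (1 + x)^n <= 1, an upper bound on the first factor follows from Bernoulli's
    lower bound on the second. *)
Let bernoulli_inv (x : R) n : 0 < x <= 1 -> (0 < n)%N -> (1 - x) ^+ n <= (n%:R * x)^-1.
Proof.
move=> /andP[x0 x1] n0.
have h1 : 1 + n%:R * x <= (1 + x) ^+ n.
  elim: n {n0} => [|n IH]; first by rewrite mul0r addr0 expr0.
  rewrite exprS; have h : 0 <= n%:R :> R by [].
  apply: (@le_trans _ _ ((1 + x) * (1 + n%:R * x))); last by rewrite ler_wpM2l// addr_ge0// ltW.
  by rewrite -natr1; nra.
have h2 : (1 - x) ^+ n * (1 + x) ^+ n <= 1.
  by rewrite -exprMn exprn_ile1//; nra.
have nx0 : 0 < n%:R * x by rewrite mulr_gt0// ltr0n.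
rewrite -(ler_pM2r nx0) mulVf ?gt_eqF//; apply: le_trans h2.
apply: ler_wpM2l; first by rewrite exprn_ge0// subr_ge0.
by apply: le_trans h1; rewrite lerDr.
Qed.

(** The exponent 2^n turns the correction in Bernoulli's inequality into 2^n s^n = (2 s)^n, which
    makes 1/2 the threshold here and in [step_gt]. *)
Let step_lt (s : R) : 0 <= s < 2^-1 -> (1 - s ^+ n) ^+ (2 ^ n) @[n --> \oo] --> (1 : R).
Proof.
move=> /andP[s0 s1]; have hs : `|2 * s| < 1 by rewrite ger0_norm; lra.
have c2 : (fun n => 1 - (2 * s) ^+ n : R) @ \oo --> (1 : R).
  by rewrite -[X in _ --> X]subr0; apply: cvgB; [exact: cvg_cst|exact: cvg_expr].
apply: (squeeze_cvgr _ c2 (cvg_cst (1 : R))); apply: nearW => n.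
have sn : 0 <= s ^+ n <= 1 by rewrite exprn_ge0// exprn_ile1//; lra.
apply/andP; split; last by rewrite exprn_ile1//; lra.
by apply: le_trans (bernoulli_le _ sn); rewrite exprMn natrX.
Qed.

Let step_gt (s : R) : 2^-1 < s <= 1 -> (1 - s ^+ n) ^+ (2 ^ n) @[n --> \oo] --> (0 : R).
Proof.
move=> /andP[s0 s1]; have hs : `|(2 * s)^-1| < 1.
  by rewrite ger0_norm ?invf_lt1 ?invr_ge0; lra.
have c2 : ((2 * s)^-1) ^+ n @[n --> \oo] --> (0 : R) by exact: cvg_expr.
apply: squeeze_cvgr (cvg_cst 0) c2; apply: nearW => n.
have sn : 0 < s ^+ n <= 1 by rewrite exprn_gt0 ?exprn_ile1//; lra.
apply/andP; split; first by rewrite exprn_ge0//; lra.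
by rewrite exprVn exprMn; apply: le_trans (bernoulli_inv sn _) _; rewrite ?expn_gt0// natrX.
Qed.

(* Bernoulli's inequality makes (1 - s^n)^(2^n) tend to 1 for s < 1/2 and to 0
   for s > 1/2, so these polynomials in cos (x - b/2) converge to the indicator
   of the arc (0, b). *)
Let arc_poly (b : R) (n : nat) : {poly R} :=
  (1 - ((2^-1 + cos (b / 2) / 4)%:P - 4^-1 *: 'X) ^+ n) ^+ (2 ^ n).

(** The division by 4 keeps the values in [0, 1], and the value at both ends x = 0 and x = b of the
    arc is the threshold 1/2. *)
Let arc_s (b x : R) := 2^-1 - (cos (x - b / 2) - cos (b / 2)) / 4.

Let arc_polyE b n x : (arc_poly b n).[cos (x - b / 2)] = (1 - arc_s b x ^+ n) ^+ (2 ^ n).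
Proof.
by rewrite /arc_poly !hornerE; congr ((1 - _ ^+ _) ^+ _); rewrite /arc_s; lra.
Qed.

Let arc_s_bound b x : 0 <= arc_s b x <= 1.
Proof.
have := cos_max (x - b / 2); have := cos_max (b / 2).
by rewrite !ler_norml /arc_s => /andP[? ?] /andP[? ?]; lra.
Qed.

(** On (0, 2 pi) the factor sin (x / 2) is positive, so the sign of sin ((b - x) / 2) decides on
    which side of 1/2 the value lies. *)
Let arc_sE b x : arc_s b x = 2^-1 - sin (x / 2) * sin ((b - x) / 2) / 2.
Proof.
rewrite /arc_s; have -> : b / 2 = (x / 2) + ((b - x) / 2) by field.
have -> : x - (x / 2 + (b - x) / 2) = x / 2 - (b - x) / 2 by field.
by rewrite cosB cosD; field.
Qed.

Let int_arc0 (b : R) : 0 < b < pi *+ 2 -> (\int[mu]_(x in `[0%R, b]) (u x)%:E)%E = 0%E.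
Proof.
move=> /andP[b0 b2]; pose h n x := (1 - arc_s b x ^+ n) ^+ (2 ^ n).
have hb n x : `|h n x| <= 1.
  have /andP[? ?] := arc_s_bound b x.
  have sn : 0 <= arc_s b x ^+ n <= 1 by rewrite exprn_ge0 ?exprn_ile1.
  by rewrite normrX exprn_ile1// ger0_norm; lra.
have mh n : measurable_fun (@circle R) (h n).
  have := @measurable_cosl circle 1 (- (b / 2)); under eq_fun do rewrite mul1r; move=> mc.
  by do 2![apply: measurable_funX; apply: measurable_funB => //]; apply: measurable_funM => //;
     apply: measurable_funB.
have iuh n : intc (fun x => u x * h n x) by apply: (@intcM _ _ 1).
have z n : (\int[mu]_(x in @circle R) (u x * h n x)%:E)%E = 0%E.
  rewrite EFin_J//; congr EFin; rewrite -[RHS](poly0 (b / 2) (arc_poly b n)).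
  by apply: eq_Rintegral => x _; rewrite arc_polyE.
have sub : `[0, b]%classic `<=` @circle R.
  by apply: subset_itvl; rewrite bnd_simp ltW.
rewrite -[LHS](_ : (\int[mu]_(x in @circle R) (u x * \1_(`[0, b]%classic) x)%:E = _)%E); last first.
  rewrite -[in RHS](setIidr sub) integral_mkcondr; apply: eq_integral => x _.
  by rewrite indicE patchE; case: ifP => _; rewrite ?mulr1 ?mulr0.
have [|||||_ _] := @dominated_convergence _ _ _ mu _ measurable_circle
  (fun n x => (u x * h n x)%:E) (fun x => (u x * \1_(`[0, b]%classic) x)%:E)
  (fun x => (`|u x|)%:E).
- by move=> n; apply/measurable_EFinP; exact: intc_measurable.
- apply/measurable_EFinP; apply: measurable_funM; first exact: intc_measurable.
  exact: measurable_indic.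
(* At 0, b and 2 pi the value of [arc_s] is exactly 1/2, where the powers tend to neither 0 nor 1;
   these three points are discarded. *)
- apply: aeS (aeI (ae_neq 0) (aeI (ae_neq b) (ae_neq (pi *+ 2)))) => x [x0 [xb x2]].
  rewrite /circle/= in_itv/= => /andP[x0' x2'].
  have {x0 x0'} x0 : 0 < x by rewrite lt_neqAle eq_sym x0.
  have {x2 x2'} x2 : x < pi *+ 2 by rewrite lt_neqAle x2.
  have sx : 0 < sin (x / 2).
    by apply: sin_gt0_pi; rewrite divr_gt0//= ltr_pdivrMr// mulr_natr.
  apply: cvg_EFin; first exact: nearW.
  apply: cvgM; first exact: cvg_cst.
  have [bx|xb'] := ltP b x.
    rewrite indicE memNset/=; last by rewrite in_itv/= ltW//= leNgt bx.
    apply: step_gt; rewrite (andP (arc_s_bound b x)).2 andbT arc_sE.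
    have : 0 < sin ((x - b) / 2).
      apply: sin_gt0_pi; rewrite divr_gt0//= ?subr_gt0// ltr_pdivrMr// mulr_natr; lra.
    have -> : (b - x) / 2 = - ((x - b) / 2) by field.
    by rewrite sinN => ?; nra.
  have {}xb : x < b by rewrite lt_neqAle xb.
  rewrite indicE mem_set/=; last by rewrite in_itv/= !ltW.
  apply: step_lt; rewrite (andP (arc_s_bound b x)).1/= arc_sE.
  have : 0 < sin ((b - x) / 2).
    apply: sin_gt0_pi; rewrite divr_gt0//= ?subr_gt0// ltr_pdivrMr// mulr_natr; lra.
  by move=> ?; nra.
- exact: intc_norm.
- apply: aeW => x n cx; rewrite /= lee_fin normrM ler_piMr//; exact: hb.
move=> cv; have {}cv : (cst 0%E : nat -> \bar R) @ \oo -->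
    (\int[mu]_(x in @circle R) (u x * \1_(`[0, b]%classic) x)%:E)%E.
  by move: cv; under eq_fun do rewrite z.
by apply/esym; apply: cvg_unique cv => //; exact: cvg_cst.
Qed.

(** The integrals of [u] over all arcs from 0 vanish, so its primitive is zero and Lebesgue
    differentiation gives [u] = 0 almost everywhere. *)
Lemma circle_trig_moments0 : {ae mu, forall x, circle x -> u x = 0}.
Proof.
pose f := u \_ (@circle R).
have If : mu.-integrable setT (EFin \o f).
  rewrite /f -restrict_EFin; apply: (integrable_mkcond _ measurable_circle).1; exact: iu.
have I2pi : (\int[mu]_(x in @circle R) (u x)%:E)%E = 0%E.
  rewrite EFin_J//; congr EFin; rewrite -[RHS](cu0 0); apply: eq_Rintegral => x _.
  by rewrite mul0r cos0 mulr1.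
have F0 y : \int[mu]_(t in `[0%R, y]) f t = 0.
  rewrite /Rintegral; suff -> : (\int[mu]_(x in `[0%R, y]) (f x)%:E)%E = 0%E by [].
  have [y0|y0] := ltP y 0.
    by rewrite set_itv_ge ?integral_set0// bnd_simp -ltNge.
  have e (A : set R) : (\int[mu]_(x in A) (f x)%:E = \int[mu]_(x in A `&` @circle R) (u x)%:E)%E.
    by rewrite integral_mkcondr; apply: eq_integral => x _; rewrite /f !patchE; case: ifP.
  rewrite e; have [y2|y2] := ltP y (pi *+ 2).
    rewrite setIidl; last by apply: subset_itvl; rewrite bnd_simp ltW.
    move: y0; rewrite le_eqVlt => /predU1P[<-|y0]; last by rewrite int_arc0// y0.
    by rewrite set_itv1 integral_set1.
  by rewrite setIidr ?I2pi//; apply: subset_itvl; rewrite bnd_simp.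
have := @FTC1 R f (BLeft 0).
have h1 y : mu.-integrable [set` Interval (BLeft 0) (BRight y)] (EFin \o f).
  by apply: integrableS If.
move=> /(_ h1); have lf : locally_integrable [set: R] f.
  by apply: open_integrable_locally => //; exact: openT.
move=> /(_ lf) H; apply: aeS (aeI H (ae_neq 0)) => x [{}H x0] cx.
have x0' : 0 < x.
  by move: cx; rewrite /circle/= in_itv/= lt_neqAle eq_sym x0 => /andP[->].
have [|_] := H; first by rewrite lte_fin.
rewrite (_ : (fun _ => _) = cst 0); last by apply/funext => y; exact: F0.
by rewrite derive1_cst /f patchE mem_set.
Qed.

End Completeness.

(** * Translations and periodic functions *)

Lemma lebesgue_measure_shift (c : R) (A : set R) : measurable A ->
  mu ((fun x => x + c) @^-1` A) = mu A.
Proof.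
move=> mA.
have ms : @measurable_fun _ _ (measurableTypeR R) (measurableTypeR R) setT (fun x => x + c).
  by apply: continuous_measurable_fun => x; apply: cvgD; [exact: cvg_id|exact: cvg_cst].
transitivity (pushforward mu (fun x : R => (x + c : measurableTypeR R)) A) => //.
apply/esym/(@lebesgue_measure_unique _ (pushforward mu (fun x : R => (x + c : measurableTypeR R)))) => //= _ [[a b]] _ <-.
rewrite /pushforward (_ : _ @^-1` _ = `](a - c), (b - c)]%classic); last first.
  by apply/seteqP; split => x /=; rewrite !in_itv/= ltrBlDr lerBrDr.
by rewrite !lebesgue_measure_itv/= !lte_fin ltrD2r; case: ifP => // _; rewrite -!EFinB; congr EFin; lra.
Qed.

Lemma ae_shift (c : R) (P : R -> Prop) : {ae mu, forall x, P x} -> {ae mu, forall x, P (x + c)}.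
Proof.
move=> [N [mN N0 PN]]; exists ((fun x => x + c) @^-1` N); split.
- have ms : @measurable_fun _ _ (measurableTypeR R) (measurableTypeR R) setT (fun x => x + c).
    by apply: continuous_measurable_fun => x; apply: cvgD; [exact: cvg_id|exact: cvg_cst].
  by rewrite -[X in measurable X]setTI; apply: ms.
- by rewrite lebesgue_measure_shift.
- by move=> x /= Px; apply: PN.
Qed.

Lemma periodic_int u (T : R) : periodic u T -> forall (m : int) x, u (x + m%:~R * T) = u x.
Proof.
move=> pu [n|n] x; first by rewrite -pmulrn mulr_natl periodicn.
by rewrite NegzE mulrNz -pmulrn mulNr mulr_natl -[LHS](periodicn pu n.+1) subrK.
Qed.

Lemma circle_repr x : exists m : int, circle (x + m%:~R * (pi *+ 2)).
Proof.
exists (- Num.floor (x / (pi *+ 2))); rewrite /circle/= in_itv/= mulrNz mulNr.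
have p0 := twopi_gt0; have := Num.Theory.floor_itv (x / (pi *+ 2)).
rewrite ler_pdivlMr// ltr_pdivrMr// intrD => /andP[h1 h2].
by apply/andP; split; nra.
Qed.

(** Countably many translates of the circle cover the line, and each translate of the exceptional
    set is null. *)
Lemma ae_periodic u v : periodic u (pi *+ 2) -> periodic v (pi *+ 2) ->
  {ae mu, forall x, circle x -> u x = v x} -> {ae mu, forall x, u x = v x}.
Proof.
move=> pu pv uv.
have H (m : int) : {ae mu, forall x, circle (x + m%:~R * (pi *+ 2)) -> u x = v x}.
  by apply: aeS (ae_shift (m%:~R * (pi *+ 2)) uv) => x; rewrite !periodic_int.
(* Both signs are packed under one natural index so that [ae_forall] reaches every integer
   translate. *)
have H2 (n : nat) : {ae mu, forall x, (circle (x + n%:~R * (pi *+ 2)) -> u x = v x) /\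
    (circle (x + (Negz n)%:~R * (pi *+ 2)) -> u x = v x)} by exact: aeI.
apply: aeS (ae_forall H2) => x Hx; have [[n|n] cx] := circle_repr x.
  exact: (Hx n).1.
exact: (Hx n).2.
Qed.

End CircleIntegral.

(** * Real Fourier coefficients and orthogonality *)

Section TrigCoef.
Context {R : realType}.
Implicit Types (u v g h : R -> R) (x y t : R).
Local Notation mu := (@lebesgue_measure R).
Local Notation intc u := (mu.-integrable (@circle R) (EFin \o u)).
Local Notation J u := (\int[mu]_(x in @circle R) u x).

(** No normalising factor, so that the coefficient identities stay free of square roots; the factor
    reappears in [kap] for series and in [fourier_nat] for the complex coefficients. *)
Definition cc u (n : nat) : R := J (fun x => u x * cos (n%:R * x)).
Definition ss u (n : nat) : R := J (fun x => u x * sin (n%:R * x)).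

Lemma ss0 u : ss u 0 = 0.
Proof. by rewrite /ss -[RHS]J0; apply: eq_Rintegral => x _; rewrite mul0r sin0 mulr0. Qed.

Lemma cc0 u : cc u 0 = J u.
Proof. by rewrite /cc; apply: eq_Rintegral => x _; rewrite mul0r cos0 mulr1. Qed.

Lemma ccD u v n : intc u -> intc v -> cc (fun x => u x + v x) n = cc u n + cc v n.
Proof.
move=> iu iv; rewrite /cc -JD; [|exact: intc_cos|exact: intc_cos].
by apply: eq_Rintegral => x _; rewrite mulrDl.
Qed.
Lemma ssD u v n : intc u -> intc v -> ss (fun x => u x + v x) n = ss u n + ss v n.
Proof.
move=> iu iv; rewrite /ss -JD; [|exact: intc_sin|exact: intc_sin].
by apply: eq_Rintegral => x _; rewrite mulrDl.
Qed.
Lemma ccZ (a : R) u n : intc u -> cc (fun x => a * u x) n = a * cc u n.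
Proof.
move=> iu; rewrite /cc -JZ; last exact: intc_cos.
by apply: eq_Rintegral => x _; rewrite mulrA.
Qed.
Lemma ssZ (a : R) u n : intc u -> ss (fun x => a * u x) n = a * ss u n.
Proof.
move=> iu; rewrite /ss -JZ; last exact: intc_sin.
by apply: eq_Rintegral => x _; rewrite mulrA.
Qed.
Lemma ccB u v n : intc u -> intc v -> cc (fun x => u x - v x) n = cc u n - cc v n.
Proof.
move=> iu iv; rewrite /cc -JB; [|exact: intc_cos|exact: intc_cos].
by apply: eq_Rintegral => x _; rewrite mulrBl.
Qed.
Lemma ssB u v n : intc u -> intc v -> ss (fun x => u x - v x) n = ss u n - ss v n.
Proof.
move=> iu iv; rewrite /ss -JB; [|exact: intc_sin|exact: intc_sin].
by apply: eq_Rintegral => x _; rewrite mulrBl.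
Qed.

Lemma norm_cc u n : intc u -> `|cc u n| <= J (fun x => `|u x|).
Proof.
move=> iu; apply: le_trans (norm_J (intc_cos _ iu)) _.
apply: le_J => [||x _]; [exact/intc_norm/intc_cos|exact: intc_norm|].
by rewrite normrM ler_piMr// cos_max.
Qed.
Lemma norm_ss u n : intc u -> `|ss u n| <= J (fun x => `|u x|).
Proof.
move=> iu; apply: le_trans (norm_J (intc_sin _ iu)) _.
apply: le_J => [||x _]; [exact/intc_norm/intc_sin|exact: intc_norm|].
by rewrite normrM ler_piMr// sin_max.
Qed.

Lemma coef_ae_eq u v : intc u -> intc v -> {ae mu, forall x, circle x -> u x = v x} ->
  cc u =1 cc v /\ ss u =1 ss v.
Proof.
move=> iu iv uv; split=> n; apply: ae_eq_J; try (by apply: intc_measurable; exact: intc_cos);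
  try (by apply: intc_measurable; exact: intc_sin);
  by apply: aeS uv => x + cx => /(_ cx) ->.
Qed.

Lemma coef_inj u v : intc u -> intc v -> cc u =1 cc v -> ss u =1 ss v ->
  {ae mu, forall x, circle x -> u x = v x}.
Proof.
move=> iu iv cuv suv.
have := @circle_trig_moments0 R _ (intcB iu iv).
have h1 n : J (fun x => (u x - v x) * cos (n%:R * x)) = 0.
  by rewrite -/(cc (fun x => u x - v x) n) ccB// cuv subrr.
have h2 n : J (fun x => (u x - v x) * sin (n%:R * x)) = 0.
  by rewrite -/(ss (fun x => u x - v x) n) ssB// suv subrr.
move=> /(_ h1 h2); apply: aeS => x + cx => /(_ cx) /eqP; by rewrite subr_eq0 => /eqP.
Qed.

(* The normalisation of the Fourier series: u = \sum_k kap k (cc u k cos kx + ss u k sin kx). *)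
Definition kap (k : nat) : R := if k is 0%N then (pi *+ 2)^-1 else pi^-1.

Lemma kap_gt0 k : 0 < kap k.
Proof. by case: k => [|k] /=; rewrite invr_gt0 ?twopi_gt0// pi_gt0. Qed.

Lemma Jcosl (k : nat) (b : R) : (0 < k)%N -> J (fun x => cos (k%:R * x + b)) = 0.
Proof.
move=> k0; have kn0 : k%:R != 0 :> R by rewrite pnatr_eq0 -lt0n.
pose F x := sin (k%:R * x + b) / k%:R.
have dF x : is_derive x 1 F (cos (k%:R * x + b)).
  rewrite /F; have := @is_derive_sin R (k%:R * x + b) => H.
  by apply: is_derive_eq; rewrite /GRing.scale/= !mulr0 ?mulr1 ?addr0 ?add0r; field.
have dF1 x : derivable F x 1 by have [] := dF x.
rewrite /Rintegral (@continuous_FTC2 _ _ F).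
- rewrite -EFinB/= /F mulr0 add0r.
  have -> : k%:R * (pi *+ 2) + b = b + (pi *+ 2) *+ k by rewrite mulr_natl addrC.
  by rewrite (periodicn (@sinD2pi R)) subrr.
- exact: twopi_gt0.
- exact/continuous_subspaceT/continuous_cosl.
- split; first by move=> x _; exact: dF1.
  + apply/cvg_at_right_filter; exact/differentiable_continuous/derivable1_diffP.
  + apply/cvg_at_left_filter; exact/differentiable_continuous/derivable1_diffP.
- by move=> x _; rewrite derive1E; have [_ ->] := dF x.
Qed.

Lemma Jcosl0 (b : R) : J (fun x => cos (0%:R * x + b)) = cos b * (pi *+ 2).
Proof. by rewrite -Jcst; apply: eq_Rintegral => x _; rewrite mul0r add0r. Qed.

Lemma intc_cosf (a b : R) : intc (fun x => cos (a * x + b)).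
Proof. exact/continuous_intc/continuous_cosl. Qed.

Let Jprod (k n : nat) (b c : R) :
  J (fun x => cos (k%:R * x + b) * cos (n%:R * x + c)) =
  2^-1 * J (fun x => cos ((k + n)%:R * x + (b + c))) +
  2^-1 * (if (n <= k)%N then J (fun x => cos ((k - n)%:R * x + (b - c)))
          else J (fun x => cos ((n - k)%:R * x + (c - b)))).
Proof.
have E : J (fun x => cos (k%:R * x + b) * cos (n%:R * x + c)) =
  2^-1 * J (fun x => cos ((k + n)%:R * x + (b + c))) +
  2^-1 * J (fun x => cos ((k%:R - n%:R) * x + (b - c))).
  rewrite -!JZ ?intc_cosf// -JD; last 2 first.
  - exact/intcZ/intc_cosf.
  - exact/intcZ/intc_cosf.
  apply: eq_Rintegral => x _.
  have -> : (k + n)%:R * x + (b + c) = (k%:R * x + b) + (n%:R * x + c) by rewrite natrD; ring.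
  have -> : (k%:R - n%:R) * x + (b - c) = (k%:R * x + b) - (n%:R * x + c) by ring.
  by move: (_ + b) (_ + c) => y z; rewrite cosD cosB; field.
rewrite E; congr (_ + _ * _); case: leqP => nk; apply: eq_Rintegral => x _.
  by rewrite natrB.
by rewrite natrB 1?ltnW// -cosN; congr cos; ring.
Qed.

Let cE (k : nat) x : cos (k%:R * x) = cos (k%:R * x + 0). Proof. by rewrite addr0. Qed.
Let sE (k : nat) x : sin (k%:R * x) = cos (k%:R * x + - (pi / 2)). Proof. by rewrite cosBpihalf. Qed.

(** With the sine written as a cosine of phase -pi/2, one computation covers all orthogonality
    relations. For k = n = 0 the sum and the difference of the frequencies both vanish, otherwise at
    most one of them does: this is the reason for the two values of [kap]. *)
Let Jgen (k n : nat) (b c : R) : kap k * J (fun x => cos (k%:R * x + b) * cos (n%:R * x + c)) =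
  if k == n then (if k is 0%N then cos b * cos c else cos (b - c)) else 0.
Proof.
have p0 : pi != 0 :> R by rewrite gt_eqF// pi_gt0.
rewrite Jprod; case: eqVneq => [<-|kn].
  rewrite leqnn subnn Jcosl0; case: k => [|k] /=.
    rewrite Jcosl0 (cosD b c) (cosB b c) -[pi *+ 2]mulr_natl invfM.
    have H (X Y P : R) : P != 0 -> 2^-1 / P * (2^-1 * ((X - Y) * (2 * P)) + 2^-1 * ((X + Y) * (2 * P))) = X.
      by move=> P0; field.
    exact: H.
  rewrite Jcosl// -[pi *+ 2]mulr_natl mulr0 add0r.
  have H (X P : R) : P != 0 -> P^-1 * (2^-1 * (X * (2 * P))) = X by move=> P0; field.
  exact: H.
rewrite Jcosl; last by rewrite addn_gt0; case: k n kn => [|k] [|n].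
case: leqP => nk; rewrite Jcosl ?mulr0 ?addr0 ?mulr0// subn_gt0//.
by rewrite ltn_neqAle eq_sym kn.
Qed.

Lemma Jcoscos (k n : nat) :
  kap k * J (fun x => cos (k%:R * x) * cos (n%:R * x)) = (k == n)%:R.
Proof. by under eq_Rintegral do rewrite (cE k) (cE n); rewrite Jgen; case: eqVneq => // _; case: k => [|k] /=; rewrite ?subr0 cos0 ?mulr1. Qed.

Lemma Jsinsin (k n : nat) :
  kap k * J (fun x => sin (k%:R * x) * sin (n%:R * x)) = ((k == n) && (0 < k)%N)%:R.
Proof. by under eq_Rintegral do rewrite (sE k) (sE n); rewrite Jgen; case: eqVneq => // _; case: k => [|k] /=; rewrite ?subrr ?cosN ?cos_pihalf ?cos0 ?mulr0. Qed.

Lemma Jcossin (k n : nat) : J (fun x => cos (k%:R * x) * sin (n%:R * x)) = 0.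
Proof.
apply: (mulfI (lt0r_neq0 (kap_gt0 k))); rewrite mulr0.
by under eq_Rintegral do rewrite (cE k) (sE n); rewrite Jgen; case: eqVneq => // _; case: k => [|k]; rewrite ?sub0r ?opprK ?cosN ?cos_pihalf ?mulr0 ?mul0r.
Qed.

Definition tsum (p q : nat -> R) (N : nat) x : R :=
  \sum_(k < N) kap k * (p k * cos (k%:R * x) + q k * sin (k%:R * x)).

Lemma continuous_tsum p q N : continuous (tsum p q N).
Proof.
move=> x; rewrite /tsum; elim: N => [|N IH].
  by under eq_fun do rewrite big_ord0; exact: cvg_cst.
rewrite (_ : (fun _ => _) = (fun x => \sum_(k < N) kap k * (p k * cos (k%:R * x) + q k * sin (k%:R * x))
   + kap N * (p N * cos (N%:R * x) + q N * sin (N%:R * x)))); last first.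
  by apply/funext => y; rewrite big_ord_recr.
apply: cvgD; first exact: IH.
apply: cvgM; first exact: cvg_cst.
apply: cvgD; (apply: cvgM; first exact: cvg_cst).
  have := @continuous_cosl R N%:R 0 x; rewrite /continuous_at addr0.
  by under eq_fun do rewrite addr0.
have := @continuous_cosl R N%:R (- (pi / 2)) x; rewrite /continuous_at -sE.
by under eq_fun do rewrite -sE.
Qed.

Lemma intc_tsum p q N : intc (tsum p q N).
Proof. exact/continuous_intc/continuous_tsum. Qed.

Lemma periodic_tsum p q N : periodic (tsum p q N) (pi *+ 2).
Proof.
move=> x; apply: eq_bigr => k _.
have -> : k%:R * (x + pi *+ 2) = k%:R * x + (pi *+ 2) *+ k.
  by rewrite mulrDr [in RHS]mulr_natl -mulr_natl; ring.
by rewrite (periodicn (@cosD2pi R)) (periodicn (@sinD2pi R)).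
Qed.

Lemma J_tsum u p q N : intc u -> J (fun x => u x * tsum p q N x) =
  \sum_(k < N) kap k * (p k * cc u k + q k * ss u k).
Proof.
move=> iu.
pose F k x := kap k * p k * (u x * cos (k%:R * x)) + kap k * q k * (u x * sin (k%:R * x)).
transitivity (J (fun x => \sum_(k < N) F k x)).
  by apply: eq_Rintegral => x _; rewrite mulr_sumr; apply: eq_bigr => k _; rewrite /F; ring.
have iF1 k : intc (fun x => kap k * p k * (u x * cos (k%:R * x))) by exact/intcZ/intc_cos.
have iF2 k : intc (fun x => kap k * q k * (u x * sin (k%:R * x))) by exact/intcZ/intc_sin.
rewrite (@J_sum _ N F); last by move=> k _; exact: intcD.
apply: eq_bigr => k _; rewrite /F JD// !JZ; [|exact: intc_sin|exact: intc_cos].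
by rewrite -/(cc u k) -/(ss u k); ring.
Qed.

Lemma cc_tsum p q N n : cc (tsum p q N) n = if (n < N)%N then p n else 0.
Proof.
have := @J_tsum (fun x => cos (n%:R * x)) p q N.
have i : intc (fun x => cos (n%:R * x)).
  by have := intc_cosf n%:R 0; under eq_fun do rewrite addr0.
move=> /(_ i) E; rewrite /cc; under eq_Rintegral do rewrite mulrC.
rewrite E; under eq_bigr => k _.
  have -> : kap k * (p k * cc (fun x => cos (n%:R * x)) k + q k * ss (fun x => cos (n%:R * x)) k)
     = p k * (k == n :> nat)%:R.
    rewrite /ss Jcossin mulr0 addr0 -Jcoscos mulrCA; congr (_ * (_ * _)).
    by apply: eq_Rintegral => x _; rewrite mulrC.
  over.
case: ltnP => nN.
  rewrite (bigD1 (Ordinal nN))//= eqxx mulr1 big1 ?addr0// => k kn.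
  by rewrite (_ : (_ == _) = false) ?mulr0//; apply/negbTE.
by rewrite big1// => k _; rewrite (_ : (_ == _) = false) ?mulr0// ltn_eqF// (leq_trans _ nN).
Qed.

(** The sine of frequency 0 is zero, so [q 0] leaves no trace in [tsum] and can be recovered only if
    it is 0. *)
Lemma ss_tsum p q N n : q 0%N = 0 -> ss (tsum p q N) n = if (n < N)%N then q n else 0.
Proof.
move=> q0; have := @J_tsum (fun x => sin (n%:R * x)) p q N.
have i : intc (fun x => sin (n%:R * x)).
  by have := intc_cosf n%:R (- (pi / 2)); under eq_fun do rewrite -sE.
move=> /(_ i) E; rewrite /ss; under eq_Rintegral do rewrite mulrC.
rewrite E; under eq_bigr => k _.
  have -> : kap k * (p k * cc (fun x => sin (n%:R * x)) k + q k * ss (fun x => sin (n%:R * x)) k)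
     = q k * (k == n :> nat)%:R.
    have -> : cc (fun x => sin (n%:R * x)) k = 0.
      by rewrite /cc -(Jcossin k n); apply: eq_Rintegral => x _; rewrite mulrC.
    have := Jsinsin k n; rewrite mulr0 add0r mulrCA.
    have -> : ss (fun x => sin (n%:R * x)) k = J (fun x => sin (k%:R * x) * sin (n%:R * x)).
      by apply: eq_Rintegral => x _; rewrite mulrC.
    move=> ->; case: (posnP k) => [->|k0]; first by rewrite q0 !mul0r.
    by rewrite andbT.
  over.
case: ltnP => nN.
  rewrite (bigD1 (Ordinal nN))//= eqxx mulr1 big1 ?addr0// => k kn.
  by rewrite (_ : (_ == _) = false) ?mulr0//; apply/negbTE.
by rewrite big1// => k _; rewrite (_ : (_ == _) = false) ?mulr0// ltn_eqF// (leq_trans _ nN).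
Qed.

Lemma J_tsum_sqr p q N : q 0%N = 0 ->
  J (fun x => tsum p q N x ^+ 2) = \sum_(k < N) kap k * (p k ^+ 2 + q k ^+ 2).
Proof.
move=> q0; have := @J_tsum (tsum p q N) p q N (intc_tsum p q N) => E.
transitivity (J (fun x => tsum p q N x * tsum p q N x)).
  by apply: eq_Rintegral => x _; rewrite expr2.
by rewrite E; apply: eq_bigr => k _; rewrite cc_tsum ss_tsum// ltn_ord !expr2.
Qed.

End TrigCoef.

(** * Square-integrable functions: Bessel and Riesz-Fischer *)

Section L2Theory.
Context {R : realType}.
Implicit Types (u v g h : R -> R) (x y t : R).
Local Notation mu := (@lebesgue_measure R).
Local Notation intc u := (mu.-integrable (@circle R) (EFin \o u)).
Local Notation J u := (\int[mu]_(x in @circle R) u x).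

Lemma L2T_meas u : L2T u -> measurable_fun [set: R] u.
Proof. by case. Qed.

Lemma L2T_sqr u : L2T u -> intc (fun x => u x ^+ 2).
Proof.
case=> _ mu_ lu; apply/integrableP; split.
  apply/measurable_EFinP; apply: measurable_funX; exact: measurable_funS mu_.
by under eq_integral => x _ do rewrite /= ger0_norm ?sqr_ge0//.
Qed.

Lemma intcMM u v : measurable_fun (@circle R) u -> measurable_fun (@circle R) v ->
  intc (fun x => u x ^+ 2) -> intc (fun x => v x ^+ 2) -> intc (fun x => u x * v x).
Proof.
move=> mu_ mv iu iv; apply: le_integrable (intcD iu iv); first exact: measurable_circle.
  by apply/measurable_EFinP; exact: measurable_funM.
move=> x _ /=; rewrite lee_fin [leRHS]ger0_norm ?addr_ge0 ?sqr_ge0// normrM.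
rewrite -[u x ^+ 2]real_normK ?num_real// -[v x ^+ 2]real_normK ?num_real//.
have : 0 <= `|u x| by []. have : 0 <= `|v x| by [].
by move: `|u x| `|v x| => a b; nra.
Qed.

Lemma L2T_M u v : L2T u -> L2T v -> intc (fun x => u x * v x).
Proof.
move=> lu lv; apply: intcMM; try exact: L2T_sqr.
  by apply: measurable_funS (L2T_meas lu).
by apply: measurable_funS (L2T_meas lv).
Qed.

Lemma L2T_cst (a : R) : L2T (fun=> a).
Proof.
split; [by []|exact: measurable_cst|].
rewrite (_ : (fun _ => _) = cst (a ^+ 2)%:E)//.
rewrite integral_cst; last exact: measurable_circle.
by apply: lte_mul_pinfty; rewrite ?lee_fin ?sqr_ge0//; exact: circle_finite.
Qed.

Lemma L2T_int u : L2T u -> intc u.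
Proof.
by move=> lu; have := L2T_M lu (L2T_cst 1); under eq_fun do rewrite mulr1.
Qed.

Lemma mk_L2T u : periodic u (pi *+ 2) -> measurable_fun [set: R] u ->
  intc (fun x => u x ^+ 2) -> L2T u.
Proof.
move=> pu mu_ /integrableP[_ iu]; split => //.
by move: iu; under eq_integral => x _ do rewrite /= ger0_norm ?sqr_ge0//.
Qed.

Lemma L2T_lin (a b : R) u v : L2T u -> L2T v -> L2T (fun x => a * u x + b * v x).
Proof.
move=> lu lv; have [pu mu_ _] := lu; have [pv mv _] := lv; apply: mk_L2T.
- by move=> x; rewrite pu pv.
- by apply: measurable_funD; apply: measurable_funM => //.
- have := intcD (intcZ (a ^+ 2) (L2T_sqr lu)) (intcD (intcZ (2 * a * b) (L2T_M lu lv))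
   (intcZ (b ^+ 2) (L2T_sqr lv))).
  by congr (intc _); apply/funext => x; ring.
Qed.

Lemma L2T_B u v : L2T u -> L2T v -> L2T (fun x => u x - v x).
Proof.
move=> lu lv; have := L2T_lin 1 (-1) lu lv.
by congr L2T; apply/funext => x; ring.
Qed.

Lemma continuous_L2T u : periodic u (pi *+ 2) -> continuous u -> L2T u.
Proof.
move=> pu cu; apply: mk_L2T => //; first exact: continuous_measurable_fun.
by apply: continuous_intc => x; apply: (@continuous_comp _ _ _ u (fun y => y ^+ 2)); [exact: cu|exact: exprn_continuous].
Qed.

(** The pointwise bound |u| <= e/2 + u^2/(2 e) integrates to e (pi + 1/2) over a circle of length 2
    pi. *)
Lemma J_norm_sqr u (e : R) : measurable_fun (@circle R) u -> intc (fun x => u x ^+ 2) -> 0 < e ->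
  J (fun x => u x ^+ 2) <= e ^+ 2 -> intc u /\ J (fun x => `|u x|) <= e * (pi + 1).
Proof.
move=> mu_ iu e0 He.
have iu1 : intc u.
  have m1 : measurable_fun (@circle R) (fun=> 1 : R) by exact: measurable_cst.
  have := intcMM mu_ m1 iu (L2T_sqr (L2T_cst 1)).
  by under eq_fun do rewrite mulr1.
split=> //; apply: (@le_trans _ _ (J (fun x => 2^-1 * e + (2^-1 * e^-1) * u x ^+ 2))).
  apply: le_J => [||x _]; first exact: intc_norm.
    by apply: intcD; [exact: L2T_int (L2T_cst _)|exact: intcZ].
  rewrite -[u x ^+ 2]real_normK ?num_real//; move: `|u x| => a.
  rewrite -subr_ge0 (_ : _ - _ = 2^-1 * e^-1 * (e - a) ^+ 2); last by field; rewrite gt_eqF.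
  by rewrite mulr_ge0 ?sqr_ge0// mulr_ge0// invr_ge0 ltW.
rewrite JD; [|exact: L2T_int (L2T_cst _)|exact: intcZ].
rewrite Jcst JZ//; have h : 2^-1 * e^-1 * J (fun x => u x ^+ 2) <= 2^-1 * e.
  rewrite [leRHS](_ : _ = 2^-1 * e^-1 * e ^+ 2); last by field; rewrite gt_eqF.
  by rewrite ler_wpM2l// mulr_ge0// invr_ge0 ltW.
apply: le_trans (lerD (lexx _) h) _; rewrite -[pi *+ 2]mulr_natl.
have H (P : R) : 2^-1 * e * (2 * P) + 2^-1 * e <= e * (P + 1) by lra.
exact: H.
Qed.

Lemma bessel u N : L2T u ->
  \sum_(k < N) kap k * (cc u k ^+ 2 + ss u k ^+ 2) <= J (fun x => u x ^+ 2) :> R.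
Proof.
move=> lu; have iu := L2T_int lu.
set S := tsum (cc u) (ss u) N.
have cS : continuous S by exact: continuous_tsum.
have lS : L2T S by apply: continuous_L2T => //; exact: periodic_tsum.
have E1 : J (fun x => u x * S x) = \sum_(k < N) kap k * (cc u k ^+ 2 + ss u k ^+ 2).
  by rewrite J_tsum//; apply: eq_bigr => k _; rewrite !expr2.
have E2 : J (fun x => S x ^+ 2) = \sum_(k < N) kap k * (cc u k ^+ 2 + ss u k ^+ 2).
  by rewrite J_tsum_sqr// ss0.
have : 0 <= J (fun x => (u x - S x) ^+ 2) by apply: J_ge0 => x _; exact: sqr_ge0.
have -> : J (fun x => (u x - S x) ^+ 2) = J (fun x => u x ^+ 2 - 2 * (u x * S x) + S x ^+ 2).
  by apply: eq_Rintegral => x _; ring.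
have i1 := L2T_sqr lu; have i2 := L2T_sqr lS; have i3 := intcZ 2 (L2T_M lu lS).
by rewrite JD//; [rewrite JB// JZ ?E1 ?E2//; [lra|exact: L2T_M]|exact: intcB].
Qed.

(** Uniform Cauchy estimates, in frequency or in time, are repeatedly obtained by applying this to a
    fixed majorant series. *)
Lemma tail_small (e : nat -> R) (B eps : R) : (forall k, 0 <= e k) ->
  (forall N, \sum_(k < N) e k <= B) -> 0 < eps ->
  exists N, forall M m, (N <= M)%N -> (M <= m)%N ->
    \sum_(k < m) e k - \sum_(k < M) e k <= eps.
Proof.
move=> e0 eB eps0; pose s N := \sum_(k < N) e k.
have nds : {homo s : n m / (n <= m)%N >-> n <= m}.
  apply: homo_leq => [x//|y x z|n]; first exact: le_trans.
  by rewrite /s big_ord_recr/= lerDl.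
have cs : cvgn s.
  apply: nondecreasing_is_cvgn => //; exists B => _ [n _ <-]; exact: eB.
have /cvgrPdist_lt/(_ _ eps0)[N _ HN] := cs.
exists N => M m NM Mm; have := HN M NM; rewrite /= => h1.
have h2 := nondecreasing_cvgn_le nds cs m.
rewrite -/(s m) -/(s M) ltW//; apply: le_lt_trans h1.
by apply: le_trans (ler_norm _); rewrite lerB.
Qed.

Section RieszFischer.
Variables (p q : nat -> R) (B : R).
Hypothesis q0 : q 0%N = 0.
Hypothesis pqB : forall N, \sum_(k < N) kap k * (p k ^+ 2 + q k ^+ 2) <= B.

Let e k : R := kap k * (p k ^+ 2 + q k ^+ 2).
Let e_ge0 k : 0 <= e k.
Proof. by rewrite mulr_ge0 ?addr_ge0 ?sqr_ge0// ltW// kap_gt0. Qed.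

Let S := tsum p q.
Let cS N : continuous (S N). Proof. exact: continuous_tsum. Qed.

Let JSB M N : (M <= N)%N -> J (fun x => (S N x - S M x) ^+ 2) = \sum_(k < N) e k - \sum_(k < M) e k.
Proof.
move=> MN; pose p' k := if (k < M)%N then 0 else p k; pose q' k := if (k < M)%N then 0 else q k.
have E x : S N x - S M x = tsum p' q' N x.
  rewrite /S /tsum [X in _ - X](big_ord_widen N (fun k => kap k * (p k * cos (k%:R * x) + q k * sin (k%:R * x))))//.
  rewrite [X in _ - X]big_mkcond/= -sumrB; apply: eq_bigr => k _.
  by rewrite /p' /q'; case: ltnP => _; ring.
under eq_Rintegral do rewrite E.
rewrite J_tsum_sqr; last by rewrite /q'; case: ltnP.
rewrite [X in _ - X](big_ord_widen N e)// [X in _ - X]big_mkcond/= -sumrB; apply: eq_bigr => k _.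
by rewrite /p' /q' /e; case: ltnP => _; ring.
Qed.

Let phi0 : exists f : nat -> nat, forall k M m, (f k <= M)%N -> (M <= m)%N ->
    \sum_(i < m) e i - \sum_(i < M) e i <= (2^-1 ^+ k) ^+ 2.
Proof.
have H k : exists N, forall M m, (N <= M)%N -> (M <= m)%N ->
    \sum_(i < m) e i - \sum_(i < M) e i <= (2^-1 ^+ k) ^+ 2.
  by apply: tail_small pqB _ => //; rewrite !exprn_gt0.
by have /choice[f fP] := H; exists f => k; exact: fP.
Qed.

Let phi1 : exists f : nat -> nat, [/\ {homo f : m n / (m <= n)%N}, forall k, (k <= f k)%N &
  forall k M m, (f k <= M)%N -> (M <= m)%N ->
    J (fun x => (S m x - S M x) ^+ 2) <= (2^-1 ^+ k) ^+ 2].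
Proof.
(* Adding [k] and summing the indices makes the choice nondecreasing and at least [k], while it
   still dominates [f k]. *)
have [f fP] := phi0; exists (fun k => k + \sum_(i < k.+1) f i)%N; split.
- apply: homo_leq => [//|? ? ?|n]; first exact: leq_trans.
  by rewrite [X in (_ <= _ + X)%N]big_ord_recr/= leq_add// leq_addr.
- by move=> k; exact: leq_addr.
move=> k M m h1 h2; rewrite JSB//; apply: fP => //.
by apply: leq_trans h1; rewrite big_ord_recr/= addnA leq_addl.
Qed.

Lemma riesz_fischer : exists v, [/\ L2T v, cc v =1 p & ss v =1 q].
Proof.
have [phi [hphi kphi Hphi]] := phi1.
pose T k := S (phi k).
have cT k : continuous (T k) by exact: cS.
have mT k : measurable_fun [set: R] (T k) by exact: continuous_measurable_fun.
have lTT m k : L2T (fun x => T m x - T k x).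
  apply: continuous_L2T; first by move=> x; rewrite /T /S !periodic_tsum.
  by move=> x; apply: cvgB; exact: cT.
have JT k m : (k <= m)%N -> J (fun x => (T m x - T k x) ^+ 2) <= (2^-1 ^+ k) ^+ 2.
  by move=> km; apply: Hphi => //; exact: hphi.
pose D k x := `|T k.+1 x - T k x|.
have iD k : intc (D k) by apply/intc_norm/L2T_int.
have JD k : J (D k) <= 2^-1 ^+ k * (pi + 1).
  apply: (J_norm_sqr _ _ _ (JT _ _ (leqnSn k))).2; last by rewrite exprn_gt0.
    by apply: intc_measurable; exact: L2T_int.
  exact: L2T_sqr.
have D0 k x : (0 <= (D k x)%:E)%E by rewrite lee_fin /D.
(* The sum of the increments along the subsequence. Its integral is bounded by a geometric series,
   so it is finite almost everywhere and the subsequence converges there. *)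
pose G x := (\sum_(k <oo) (D k x)%:E)%E.
have mD k : measurable_fun (@circle R) (fun x => (D k x)%:E).
  by apply/measurable_EFinP; exact: intc_measurable.
have IG : (\int[mu]_(x in @circle R) G x < +oo)%E.
  rewrite (@integral_nneseries _ _ _ mu _ measurable_circle _ mD (fun n x _ => D0 n x)).
  apply: (@le_lt_trans _ _ (\sum_(k <oo) (2^-1 ^+ k * (pi + 1))%:E)%E).
    apply: lee_nneseries => [k _ _|k _]; first by apply: integral_ge0 => x _; exact: D0.
    by rewrite EFin_J// lee_fin.
  apply: (@le_lt_trans _ _ (2 * (pi + 1))%:E); last exact: ltry.
  have pos n : 0 <= 2^-1 ^+ n * (pi + 1) :> R.
    by apply: mulr_ge0; [exact: exprn_ge0|apply: addr_ge0 => //; exact: pi_ge0].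
  apply: lime_le.
    by apply: is_cvg_nneseries => n _ _; rewrite lee_fin; exact: pos.
  apply: nearW => n; rewrite sumEFin lee_fin.
  have := @geometric_le_lim R n (pi + 1) 2^-1; rewrite /series/=.
  have -> : (pi + 1) * (1 - 2^-1)^-1 = 2 * (pi + 1) :> R by move: (pi : R) => P; field.
  have -> : \sum_(0 <= k < n) (pi + 1) * 2^-1 ^+ k = \sum_(0 <= i < n) 2^-1 ^+ i * (pi + 1) :> R.
    by apply: eq_bigr => i _; rewrite mulrC.
  have P0 := @pi_ge0 R; apply.
  - exact: addr_ge0.
  - by rewrite invr_gt0.
  - by rewrite ger0_norm// invf_lt1// ltr1n.
have mG : measurable_fun (@circle R) G.
  by apply: ge0_emeasurable_sum => // k x _ _; rewrite lee_fin.
have aeG : {ae mu, forall x, circle x -> (G x < +oo)%E}.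
  have iG : mu.-integrable (@circle R) G.
    apply/integrableP; split => //.
    under eq_integral => x _ do rewrite gee0_abs ?nneseries_ge0//.
    exact: IG.
  by apply: aeS (integrable_ae measurable_circle iG) => x + cx => /(_ cx); rewrite fin_numE ltey => /andP[].
have cvT x : (G x < +oo)%E -> cvgn (fun k => T k x).
  move=> Gx; have cD : cvgn (series (fun k => D k x)).
    apply: nondecreasing_is_cvgn.
      by apply/nondecreasing_seqP => n; rewrite /series/= big_nat_recr//= lerDl normr_ge0.
    exists (fine (G x)) => _ [n _ <-].
    have fG : G x \is a fin_num by rewrite ge0_fin_numE// nneseries_ge0.
    rewrite -lee_fin fineK//; apply: le_trans (nneseries_lim_ge n _); last by [].
    by rewrite /series/= sumEFin.
  have cE : cvgn (series (fun k => T k.+1 x - T k x)) by apply: normed_cvg.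
  rewrite (_ : (fun k => T k x) = (fun k => T 0%N x + series (fun k => T k.+1 x - T k x) k)).
    by apply: is_cvgD => //; exact: is_cvg_cst.
  by apply/funext => n; rewrite /series/= telescope_sumr// addrC subrK.
(* An upper limit makes [v] measurable and periodic everywhere, including the points where the
   subsequence diverges. *)
pose v x := fine (limn_esup (fun k => (T k x)%:E)).
have mv : measurable_fun [set: R] v.
  apply: measurableT_comp => //; apply: measurable_fun_limn_esup => k.
  exact/measurable_EFinP.
have vE x : cvgn (fun k => T k x) -> T k x @[k --> \oo] --> v x.
  move=> cx; have cE : (T k x)%:E @[k --> \oo] --> (limn (fun k => T k x))%:E.
    by apply: cvg_EFin; [exact: nearW|exact: cx].
  by rewrite /v (cvg_limn_einf_sup cE).2.
have aev : {ae mu, forall x, circle x -> T k x @[k --> \oo] --> v x}.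
  by apply: aeS aeG => x + cx => /(_ cx) /cvT /vE.
have pv : periodic v (pi *+ 2).
  move=> x; rewrite /v; congr (fine (limn_esup _)); apply/funext => k.
  by rewrite /T /S periodic_tsum.
have mvT k : measurable_fun (@circle R) (fun x => (v x - T k x) ^+ 2).
  by apply: measurable_funX; apply: measurable_funB; [exact: measurable_funS mv|exact: measurable_funS (mT k)].
(* Fatou's lemma carries the bound on [T m - T k] over to the limit in [m]. *)
have IvT k : (\int[mu]_(x in @circle R) ((v x - T k x) ^+ 2)%:E <= ((2^-1 ^+ k) ^+ 2)%:E)%E.
  have -> : (\int[mu]_(x in @circle R) ((v x - T k x) ^+ 2)%:E =
     \int[mu]_(x in @circle R) limn_einf (fun m => ((T m x - T k x) ^+ 2)%:E))%E.
    apply: ge0_ae_eq_integral.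
    - exact: measurable_circle.
    - by apply/measurable_EFinP; exact: mvT.
    - rewrite /limn_einf; apply: measurableT_comp => //.
      apply: measurable_fun_limn_esup => m; apply: measurableT_comp => //.
      apply/measurable_EFinP/measurable_funX/measurable_funB; exact: measurable_funS (mT _).
    - by move=> x _; rewrite lee_fin sqr_ge0.
    - move=> x _; rewrite limn_einf_lim; apply: lime_ge; first exact: is_cvg_einfs.
      apply: nearW => n; apply: le_ereal_inf_tmp => _ [m _ <-] /=.
      by rewrite lee_fin sqr_ge0.
    - apply: aeS aev => x + cx => /(_ cx) cv; apply/esym.
      apply: (cvg_limn_einf_sup _).1; apply: cvg_EFin; first exact: nearW.
      apply: (@cvg_comp _ _ _ (fun m => T m x - T k x) (fun y => y ^+ 2)); last exact: exprn_continuous.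
      by apply: cvgB; [exact: cv|exact: cvg_cst].
  apply: le_trans (fatou mu measurable_circle _ _) _.
  - move=> m; apply/measurable_EFinP/measurable_funX/measurable_funB; exact: measurable_funS (mT _).
  - by move=> m x _; rewrite lee_fin sqr_ge0.
  rewrite limn_einf_lim; apply: lime_le; first exact: is_cvg_einfs.
  exists k => // m /= km; apply: ge_ereal_inf; exists (\int[mu]_(x in @circle R) ((T m x - T k x) ^+ 2)%:E)%E.
    by exists m => //=.
  by rewrite EFin_J ?lee_fin ?JT//; exact: L2T_sqr.
have ivT k : intc (fun x => (v x - T k x) ^+ 2).
  apply/integrableP; split; first by apply/measurable_EFinP; exact: mvT.
  under eq_integral => x _ do rewrite /= ger0_norm ?sqr_ge0//.
  by apply: le_lt_trans (IvT k) (ltry _).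
have JvT k : J (fun x => (v x - T k x) ^+ 2) <= (2^-1 ^+ k) ^+ 2.
  by rewrite -lee_fin -EFin_J.
have lT k : L2T (T k) by apply: continuous_L2T => //; exact: periodic_tsum.
have lvT k : L2T (fun x => v x - T k x).
  apply: mk_L2T => //; first by move=> x; rewrite pv /T /S periodic_tsum.
  by apply: measurable_funB.
have lv : L2T v.
  have := L2T_lin 1 1 (lvT 0%N) (lT 0%N); congr L2T; apply/funext => x.
  by rewrite !mul1r subrK.
have HN k : intc (fun x => v x - T k x) /\ J (fun x => `|v x - T k x|) <= 2^-1 ^+ k * (pi + 1).
  apply: J_norm_sqr.
  - by apply: intc_measurable; exact: L2T_int.
  - exact: ivT.
  - by rewrite exprn_gt0// invr_gt0.
  - exact: JvT.
have lim0 (a : R) : (forall k, `|a| <= 2^-1 ^+ k * (pi + 1)) -> a = 0.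
  move=> Ha; apply/eqP; rewrite -normr_le0.
  have c : 2^-1 ^+ k * (pi + 1) @[k --> \oo] --> (0 * (pi + 1) : R).
    apply: cvgM; last exact: cvg_cst.
    by apply: cvg_expr; rewrite ger0_norm// invf_lt1 ?ltr1n.
  rewrite mul0r in c; rewrite -(cvg_lim _ c)//; apply: limr_ge; first by apply/cvg_ex; exists 0.
  by apply: nearW => k; exact: Ha.
have pow_le k n : 2^-1 ^+ (k + n) * (pi + 1) <= 2^-1 ^+ k * (pi + 1) :> R.
  have P1 : 0 <= pi + 1 :> R by apply: addr_ge0 => //; exact: pi_ge0.
  apply: ler_wpM2r => //; rewrite exprD ler_piMr//; apply: exprn_ile1 => //.
  by rewrite invf_le1// ler1n.
(* At this index the partial sum already contains frequency [n], so its coefficients there are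
   exactly [p n] and [q n]. *)
have nphi n k : (n < phi (k + n.+1))%N by apply: leq_trans (kphi _); exact: leq_addl.
exists v; split => // n; apply/eqP; rewrite -subr_eq0; apply/eqP/lim0 => k.
  have [i1 h1] := HN (k + n.+1)%N; apply: le_trans (pow_le k n.+1); apply: le_trans h1.
  apply: le_trans (norm_cc n i1); rewrite ccB ?L2T_int//.
  by rewrite /T /S cc_tsum nphi.
have [i1 h1] := HN (k + n.+1)%N; apply: le_trans (pow_le k n.+1); apply: le_trans h1.
apply: le_trans (norm_ss n i1); rewrite ssB ?L2T_int//.
by rewrite /T /S ss_tsum// nphi.
Qed.

End RieszFischer.
End L2Theory.

(** * Absolutely convergent Fourier series, Parseval's identity and products *)

Section ProductCoef.
Context {R : realType}.
Implicit Types (u v g h : R -> R) (x y t : R).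
Local Notation mu := (@lebesgue_measure R).
Local Notation intc u := (mu.-integrable (@circle R) (EFin \o u)).
Local Notation J u := (\int[mu]_(x in @circle R) u x).

Lemma ae_intc u v : intc u -> measurable_fun (@circle R) v ->
  {ae mu, forall x, circle x -> u x = v x} -> intc v.
Proof.
move=> iu mv uv; have /integrableP[mu_ lu] := iu; apply/integrableP; split.
  exact/measurable_EFinP.
rewrite (_ : (\int[mu]_(x in _) _)%E = (\int[mu]_(x in @circle R) `|(EFin \o u) x|)%E)//.
apply: ge0_ae_eq_integral => //; first exact: measurable_circle.
- by apply: measurableT_comp => //; exact/measurable_EFinP.
- exact: measurableT_comp.
- by apply: aeS uv => x + cx => /(_ cx) /= ->.
Qed.

Definition abs_summable (p q : nat -> R) := exists B, forall N, \sum_(k < N) (`|p k| + `|q k|) <= B.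

Lemma kapE k : (0 < k)%N -> kap k = pi^-1 :> R.
Proof. by case: k. Qed.

Lemma kap_le1 k : kap k <= 1 :> R.
Proof.
have p2 := @pi_ge2 R; case: k => [|k] /=; rewrite invf_le1.
- by rewrite -mulr_natl; move: (pi : R) p2 => P; lra.
- exact: twopi_gt0.
- by move: (pi : R) p2 => P; lra.
- exact: pi_gt0.
Qed.

Lemma tsum_tail (p q : nat -> R) M N x : (M <= N)%N ->
  `|tsum p q N x - tsum p q M x| <= \sum_(k < N) (`|p k| + `|q k|) - \sum_(k < M) (`|p k| + `|q k|).
Proof.
move=> MN; pose e k := `|p k| + `|q k|.
pose F k := kap k * (p k * cos (k%:R * x) + q k * sin (k%:R * x)).
rewrite /tsum -/(F _) (_ : \sum_(k < M) F k = \sum_(k < N) if (k < M)%N then F k else 0); last first.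
  by rewrite (big_ord_widen N F)// big_mkcond.
rewrite (_ : \sum_(k < M) (`|p k| + `|q k|) = \sum_(k < N) if (k < M)%N then e k else 0); last first.
  by rewrite (big_ord_widen N e)// big_mkcond.
rewrite -!sumrB; apply: le_trans (ler_norm_sum _ _ _) _; apply: ler_sum => k _.
case: ltnP => _; first by rewrite !subrr normr0.
rewrite !subr0 normrM ger0_norm ?(ltW (kap_gt0 _))//.
apply: (@le_trans _ _ (1 * `|p k * cos (k%:R * x) + q k * sin (k%:R * x)|)).
  by rewrite ler_wpM2r// kap_le1.
rewrite mul1r; apply: le_trans (ler_normD _ _) _; rewrite !normrM.
by rewrite lerD// ler_piMr// ?cos_max ?sin_max.
Qed.

Definition unif_lim (F : nat -> R -> R) (U : R -> R) :=
  forall eps, 0 < eps -> exists N0, forall N, (N0 <= N)%N -> forall x, `|F N x - U x| <= eps.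

Lemma unif_lim_continuous (F : nat -> R -> R) (U : R -> R) x :
  (forall N, {for x, continuous (F N)}) -> unif_lim F U -> {for x, continuous U}.
Proof.
move=> cF FU; apply/cvgrPdist_le => /= eps e0.
have e3 : 0 < eps / 3 by rewrite divr_gt0.
have [N HN] := FU _ e3.
have /cvgrPdist_le /(_ _ e3) := cF N.
apply: filterS => y /= Hy.
have := HN N (leqnn _) x; have := HN N (leqnn _) y.
rewrite !ler_norml in Hy *; move=> /andP[? ?] /andP[? ?]; move: Hy => /andP[? ?].
by apply/andP; split; lra.
Qed.

Lemma abs_series (p q : nat -> R) : q 0%N = 0 -> abs_summable p q ->
  exists U, [/\ continuous U, periodic U (pi *+ 2), unif_lim (tsum p q) U, cc U =1 p & ss U =1 q].
Proof.
move=> q0 [B HB]; pose e k := `|p k| + `|q k|.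
have e0 k : 0 <= e k by rewrite addr_ge0.
have tail eps : 0 < eps -> exists N0, forall M N, (N0 <= M)%N -> (M <= N)%N -> forall x,
    `|tsum p q N x - tsum p q M x| <= eps.
  move=> eps0; have [N0 H] := tail_small e0 HB eps0.
  by exists N0 => M N h1 h2 x; apply: le_trans (tsum_tail p q x h2) _; exact: H.
have cv x : cvgn (fun N => tsum p q N x).
  rewrite (_ : (fun N => _) = series (fun k => kap k * (p k * cos (k%:R * x) + q k * sin (k%:R * x)))); last first.
    by apply/funext => N; rewrite /series/= big_mkord.
  apply: normed_cvg; apply: (@series_le_cvg _ _ e); [by move=> k; exact: normr_ge0|exact: e0|move=> k /=|].
    rewrite normrM ger0_norm ?(ltW (kap_gt0 _))//.
    apply: (@le_trans _ _ (1 * `|p k * cos (k%:R * x) + q k * sin (k%:R * x)|)).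
      by rewrite ler_wpM2r// kap_le1.
    rewrite mul1r; apply: le_trans (ler_normD _ _) _; rewrite !normrM.
    by rewrite lerD// ler_piMr// ?cos_max ?sin_max.
  apply: nondecreasing_is_cvgn.
    by apply/nondecreasing_seqP => n; rewrite /series/= big_nat_recr//= lerDl.
  by exists B => _ [n _ <-]; rewrite /series/= big_mkord; exact: HB.
pose U x := limn (fun N => tsum p q N x).
have FU : unif_lim (tsum p q) U.
  move=> eps eps0; have [N0 H] := tail _ eps0; exists N0 => M hM x.
  have c : `|tsum p q M x - tsum p q N x| @[N --> \oo] --> `|tsum p q M x - U x|.
    by apply: cvg_norm; apply: cvgB; [exact: cvg_cst|exact: cv].
  rewrite -(cvg_lim _ c)//; apply: limr_le; first by apply/cvg_ex; eexists; exact: c.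
  by exists M => // N /= hN; rewrite distrC; exact: H.
have cU : continuous U.
  by move=> x; apply: unif_lim_continuous FU => N; exact: continuous_tsum.
have pU : periodic U (pi *+ 2).
  by move=> x; rewrite /U; congr (limn _); apply/funext => N; rewrite periodic_tsum.
have iU := continuous_intc cU.
have small (a : R) : (forall eps, 0 < eps -> `|a| <= eps * (pi *+ 2)) -> a = 0.
  move=> H; apply/eqP; rewrite -normr_le0; apply/ler_addgt0Pl => d d0; rewrite addr0.
  have := H (d / (pi *+ 2)); rewrite divfK ?gt_eqF ?twopi_gt0//; apply.
  by rewrite divr_gt0// twopi_gt0.
have HH eps : 0 < eps -> exists N0, forall N, (N0 <= N)%N ->
    J (fun x => `|tsum p q N x - U x|) <= eps * (pi *+ 2).
  move=> eps0; have [N0 H] := FU _ eps0; exists N0 => N hN.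
  rewrite -Jcst; apply: le_J => [||x _]; last exact: H.
    by apply: intc_norm; apply: intcB => //; exact: intc_tsum.
  exact: L2T_int (L2T_cst _).
exists U; split => // n; apply/eqP; rewrite eq_sym -subr_eq0; apply/eqP/small => eps eps0.
  have [N0 /(_ (maxn N0 n.+1) (leq_maxl _ _))] := HH _ eps0; apply: le_trans.
  have it := intc_tsum p q (maxn N0 n.+1).
  by apply: le_trans (norm_cc n (intcB it iU)); rewrite ccB// cc_tsum leq_max ltnSn orbT.
have [N0 /(_ (maxn N0 n.+1) (leq_maxl _ _))] := HH _ eps0; apply: le_trans.
have it := intc_tsum p q (maxn N0 n.+1).
by apply: le_trans (norm_ss n (intcB it iU)); rewrite ssB// ss_tsum// leq_max ltnSn orbT.
Qed.

Lemma abs_fourier u : L2T u -> abs_summable (cc u) (ss u) ->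
  exists U, [/\ continuous U, periodic U (pi *+ 2), unif_lim (tsum (cc u) (ss u)) U &
    {ae mu, forall x, circle x -> u x = U x}].
Proof.
move=> lu su; have [U [cU pU FU cE sE]] := abs_series (ss0 u) su.
exists U; split => //; apply: coef_inj => //; first exact: L2T_int.
exact: continuous_intc.
Qed.

Lemma circle_bounded (U : R -> R) : continuous U -> exists M, forall x, circle x -> `|U x| <= M.
Proof.
move=> cU; have := @continuous_compact _ _ U (@circle R).
have cU' : {within @circle R, continuous U} by exact: continuous_subspaceT.
have kc : compact (@circle R) by exact: segment_compact.
move=> /(_ cU' kc) /compact_bounded [M [_ HM]]; exists (M + 1) => x cx.
by apply: (HM (M + 1)); [rewrite ltrDl|exists x].
Qed.

(** Absolute summability makes [u] almost everywhere equal to a continuous function, which is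
    bounded on the circle. *)
Lemma L2T_prod u v : L2T u -> abs_summable (cc u) (ss u) -> L2T v -> L2T (fun x => u x * v x).
Proof.
move=> lu su lv; have [U [cU pU FU uU]] := abs_fourier lu su.
have [pu mu_ _] := lu; have [pv mv _] := lv.
have [M HM] := circle_bounded cU.
apply: mk_L2T.
- by move=> x; rewrite pu pv.
- exact: measurable_funM.
apply: (@ae_intc (fun x => v x ^+ 2 * U x ^+ 2)).
- apply: (@intcM _ _ _ (M ^+ 2)); first exact: L2T_sqr.
    by apply: measurable_funX; apply: measurable_funTS; exact: continuous_measurable_fun.
  move=> x cx; rewrite normrX ler_pXn2r ?nnegrE//; first exact: HM.
  by apply: le_trans (HM _ cx).
- by apply: measurable_funX; apply: measurable_funTS; exact: measurable_funM.
- by apply: aeS uU => x + cx => /(_ cx) ->; rewrite exprMn mulrC.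
Qed.

(** The partial sums of [u] converge uniformly and [v] is integrable, so the limit passes under the
    integral. *)
Lemma parseval u v : L2T u -> abs_summable (cc u) (ss u) -> L2T v ->
  \sum_(k < N) kap k * (cc u k * cc v k + ss u k * ss v k) @[N --> \oo] --> J (fun x => u x * v x).
Proof.
move=> lu su lv; have [U [cU pU FU uU]] := abs_fourier lu su.
have iv := L2T_int lv; have [M HM] := circle_bounded cU.
have iUv : intc (fun x => v x * U x).
  by apply: (@intcM _ _ _ M) => //; apply: measurable_funTS; exact: continuous_measurable_fun.
have E : J (fun x => u x * v x) = J (fun x => v x * U x).
  apply: ae_eq_J.
  - by apply: measurable_funM; apply: measurable_funTS; apply: L2T_meas.
  - by apply: measurable_funM; apply: measurable_funTS; [apply: L2T_meas|exact: continuous_measurable_fun].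
  - by apply: aeS uU => x + cx => /(_ cx) ->; rewrite mulrC.
rewrite E; apply/cvgrPdist_le => /= eps eps0.
pose K := J (fun x => `|v x|) + 1.
have K0 : 0 < K by rewrite ltr_wpDl// J_ge0.
have [N0 H] := FU _ (divr_gt0 eps0 K0); exists N0 => // N /= hN.
rewrite -(J_tsum _ _ _ iv).
have bt : exists M, forall x, circle x -> `|tsum (cc u) (ss u) N x| <= M by apply: circle_bounded; exact: continuous_tsum.
have [M' HM'] := bt.
have it : intc (fun x => v x * tsum (cc u) (ss u) N x).
  by apply: (@intcM _ _ _ M') => //; apply: measurable_funTS; apply: continuous_measurable_fun; exact: continuous_tsum.
rewrite -JB//; apply: le_trans (norm_J (intcB iUv it)) _.
apply: (@le_trans _ _ (J (fun x => eps / K * `|v x|))).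
  apply: le_J => [||x cx]; [exact/intc_norm/intcB|exact/intcZ/intc_norm|].
  by rewrite -mulrBr normrM mulrC ler_wpM2r// distrC H.
rewrite JZ; last exact: intc_norm.
rewrite mulrAC ler_pdivrMr//; apply: ler_wpM2l; first exact: ltW.
by rewrite /K lerDl.
Qed.

Lemma Jcoscos_prod u (k n : nat) : intc u -> (n <= k)%N ->
  J (fun x => u x * cos (n%:R * x) * cos (k%:R * x)) = 2^-1 * (cc u (k + n) + cc u (k - n)).
Proof.
move=> iu nk; rewrite /cc -JD; [|exact: intc_cos..].
rewrite -JZ; last by apply: intcD; exact: intc_cos.
apply: eq_Rintegral => x _; rewrite natrB// natrD mulrDl mulrBl.
by move: (k%:R * x) (n%:R * x) => a b; rewrite cosD cosB; field.
Qed.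
Lemma Jcossin_prod u (k n : nat) : intc u -> (n <= k)%N ->
  J (fun x => u x * cos (n%:R * x) * sin (k%:R * x)) = 2^-1 * (ss u (k + n) + ss u (k - n)).
Proof.
move=> iu nk; rewrite /ss -JD; [|exact: intc_sin..].
rewrite -JZ; last by apply: intcD; exact: intc_sin.
apply: eq_Rintegral => x _; rewrite natrB// natrD mulrDl mulrBl.
by move: (k%:R * x) (n%:R * x) => a b; rewrite sinD sinB; field.
Qed.
Lemma Jsincos_prod u (k n : nat) : intc u -> (n <= k)%N ->
  J (fun x => u x * sin (n%:R * x) * cos (k%:R * x)) = 2^-1 * (ss u (k + n) - ss u (k - n)).
Proof.
move=> iu nk; rewrite /ss -JB; [|exact: intc_sin..].
rewrite -JZ; last by apply: intcB; exact: intc_sin.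
apply: eq_Rintegral => x _; rewrite natrB// natrD mulrDl mulrBl.
by move: (k%:R * x) (n%:R * x) => a b; rewrite sinD sinB; field.
Qed.
Lemma Jsinsin_prod u (k n : nat) : intc u -> (n <= k)%N ->
  J (fun x => u x * sin (n%:R * x) * sin (k%:R * x)) = 2^-1 * (cc u (k - n) - cc u (k + n)).
Proof.
move=> iu nk; rewrite /cc -JB; [|exact: intc_cos..].
rewrite -JZ; last by apply: intcB; exact: intc_cos.
apply: eq_Rintegral => x _; rewrite (natrB _ nk) natrD (mulrBl x) (mulrDl _ _ x).
by move: (k%:R * x) (n%:R * x) => a b; rewrite (cosB a b) (cosD a b); field.
Qed.

End ProductCoef.

(** * Fourier coefficients of the commutator *)

Section Commutator.
Context {R : realType}.
Local Notation mu := (@lebesgue_measure R).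
Local Notation intc u := (mu.-integrable (@circle R) (EFin \o u)).
Local Notation J u := (\int[mu]_(x in @circle R) u x).

Definition is_hilbert (u v : R -> R) := [/\ L2T v, cc v 0 = 0,
  forall n, (0 < n)%N -> cc v n = - ss u n & forall n, (0 < n)%N -> ss v n = cc u n].

Variables (f w hw hfw : R -> R).
Hypothesis lf : L2T f.
Hypothesis sf : abs_summable (cc f) (ss f).
Hypothesis lw : L2T w.
Hypothesis w0 : cc w 0 = 0.
Hypothesis Hw : is_hilbert w hw.
Hypothesis Hfw : is_hilbert (fun x => f x * w x) hfw.

Let iw := L2T_int lw.
Let lhw : L2T hw. Proof. by case: Hw. Qed.
Let ihw := L2T_int lhw.

Let chw n : cc hw n = - ss w n.
Proof. by case: Hw => _ c0 cE _; case: n => [|n]; [rewrite ss0 c0 oppr0|rewrite cE]. Qed.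
Let shw n : ss hw n = cc w n.
Proof. by case: Hw => _ c0 _ sE; case: n => [|n]; [rewrite ss0 w0|rewrite sE]. Qed.

Let l_cos (u : R -> R) (n : nat) : L2T u -> L2T (fun x : R => u x * cos (n%:R * x)).
Proof.
move=> lu; have [pu mu_ _] := lu.
have mc : measurable_fun [set: R] (fun x : R => cos (n%:R * x)).
  by have := @measurable_cosl R setT n%:R 0; under eq_fun do rewrite addr0.
apply: mk_L2T; [|exact: measurable_funM|].
  move=> x; rewrite pu mulrDr; congr (_ * _).
  by have -> : n%:R * (pi *+ 2) = (pi *+ 2) *+ n :> R; [rewrite mulr_natl|rewrite (periodicn (@cosD2pi R))].
under eq_fun do rewrite exprMn; apply: (@intcM _ _ _ 1); first exact: L2T_sqr.
  by apply: measurable_funTS; exact: measurable_funX.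
by move=> x _; rewrite normrX exprn_ile1// cos_max.
Qed.
Let l_sin (u : R -> R) (n : nat) : L2T u -> L2T (fun x : R => u x * sin (n%:R * x)).
Proof.
move=> lu; have [pu mu_ _] := lu.
have mc : measurable_fun [set: R] (fun x : R => sin (n%:R * x)).
  by have := @measurable_cosl R setT n%:R (- (pi / 2)); under eq_fun do rewrite cosBpihalf.
apply: mk_L2T; [|exact: measurable_funM|].
  move=> x; rewrite pu mulrDr; congr (_ * _).
  by have -> : n%:R * (pi *+ 2) = (pi *+ 2) *+ n :> R; [rewrite mulr_natl|rewrite (periodicn (@sinD2pi R))].
under eq_fun do rewrite exprMn; apply: (@intcM _ _ _ 1); first exact: L2T_sqr.
  by apply: measurable_funTS; exact: measurable_funX.
by move=> x _; rewrite normrX exprn_ile1// sin_max.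
Qed.

Let swap (a b c : R -> R) : J (fun x => a x * b x * c x) = J (fun x => a x * c x * b x).
Proof. by apply: eq_Rintegral => x _; rewrite mulrAC. Qed.

Let cvg_shift (n : nat) (F G : nat -> R) (l : R) :
  (forall k, (k < n)%N -> F k = 0) -> (forall j, F (n + j)%N = G j) ->
  \sum_(k < N) F k @[N --> \oo] --> l -> \sum_(j < N) G j @[N --> \oo] --> l.
Proof.
move=> F0 FG; rewrite -(cvg_shiftn n) => H; suff E N : \sum_(k < N + n) F k = \sum_(j < N) G j.
  by move: H; rewrite /=; under eq_fun do rewrite E.
elim: N => [|N IH].
  by rewrite big_ord0 add0n big1// => i _; apply: F0.
by rewrite addSn !big_ord_recr/= IH addnC FG.
Qed.

Let Nc x := hfw x - f x * hw x.

(** The trigonometric factor is moved onto w and onto Hw, and Parseval pairs the results with f.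
    Product-to-sum then expresses both pairings through the coefficients of w at the sum and the
    difference of the two frequencies. *)
Lemma ss_comm n : (0 < n)%N ->
  \sum_(j < N) pi^-1 * (cc f (n + j) * cc w j + ss f (n + j) * ss w j) @[N --> \oo] --> ss Nc n.
Proof.
move=> n0; case: Hfw => lhfw _ _ sE.
have -> : ss Nc n = J (fun x => f x * (w x * cos (n%:R * x))) - J (fun x => f x * (hw x * sin (n%:R * x))).
  have E := @ssB R hfw (fun x => f x * hw x) n (L2T_int lhfw) (L2T_int (L2T_prod lf sf lhw)).
  rewrite [LHS]E sE//; congr (_ - _); by apply: eq_Rintegral => x _; rewrite mulrA.
have P1 := parseval lf sf (l_cos n lw); have P2 := parseval lf sf (l_sin n lhw).
move: P1 P2; set u1 := (fun x => w x * _); set u2 := (fun x => hw x * _).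
pose F k := kap k * (cc f k * cc u1 k + ss f k * ss u1 k) - kap k * (cc f k * cc u2 k + ss f k * ss u2 k).
move=> P1 P2; apply: (@cvg_shift n F (fun j => pi^-1 * (cc f (n + j) * cc w j + ss f (n + j) * ss w j))).
(* Below frequency n the terms of H(fw) and of f Hw are identical and cancel. *)
- move=> k kn; rewrite /F.
  have -> : cc u1 k = 2^-1 * (cc w (n + k) + cc w (n - k)).
    by rewrite /cc /u1 (swap w) Jcoscos_prod// ltnW.
  have -> : ss u1 k = 2^-1 * (ss w (n + k) - ss w (n - k)).
    by rewrite /ss /u1 (swap w) Jsincos_prod// ltnW.
  have -> : cc u2 k = 2^-1 * (cc w (n + k) + cc w (n - k)).
    by rewrite /cc /u2 (swap hw) Jcossin_prod ?shw// ltnW.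
  have -> : ss u2 k = 2^-1 * (ss w (n + k) - ss w (n - k)).
    by rewrite /ss /u2 (swap hw) Jsinsin_prod ?chw ?opprK 1?ltnW// addrC.
  by rewrite subrr.
(* At frequency n + j the terms of frequency 2 n + j cancel, and those of the difference frequency j
   add up, which removes the factor 1/2. *)
- move=> j; rewrite /F.
  have nk : (n <= n + j)%N by exact: leq_addr.
  have -> : cc u1 (n + j) = 2^-1 * (cc w (n + j + n) + cc w j).
    by rewrite [LHS]Jcoscos_prod// addKn.
  have -> : ss u1 (n + j) = 2^-1 * (ss w (n + j + n) + ss w j).
    by rewrite [LHS]Jcossin_prod// addKn.
  have -> : cc u2 (n + j) = 2^-1 * (cc w (n + j + n) - cc w j).
    by rewrite [LHS]Jsincos_prod// addKn !shw.
  have -> : ss u2 (n + j) = 2^-1 * (ss w (n + j + n) - ss w j).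
    by rewrite [LHS]Jsinsin_prod// addKn !chw opprK addrC.
  rewrite kapE; last exact: leq_trans n0 nk.
  by move: (pi^-1) => K; field.
- by rewrite /F; under eq_fun do rewrite sumrB; exact: cvgB.
Qed.

Lemma cc_comm n : (0 < n)%N ->
  \sum_(j < N) pi^-1 * (cc f (n + j) * ss w j - ss f (n + j) * cc w j) @[N --> \oo] --> cc Nc n.
Proof.
move=> n0; case: Hfw => lhfw _ cE _.
have -> : cc Nc n = - J (fun x => f x * (w x * sin (n%:R * x))) - J (fun x => f x * (hw x * cos (n%:R * x))).
  have E := @ccB R hfw (fun x => f x * hw x) n (L2T_int lhfw) (L2T_int (L2T_prod lf sf lhw)).
  rewrite [LHS]E cE//; congr (- _ - _); by apply: eq_Rintegral => x _; rewrite mulrA.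
have P1 := parseval lf sf (l_sin n lw); have P2 := parseval lf sf (l_cos n lhw).
move: P1 P2; set u1 := (fun x => w x * _); set u2 := (fun x => hw x * _).
pose F k := - (kap k * (cc f k * cc u1 k + ss f k * ss u1 k)) - kap k * (cc f k * cc u2 k + ss f k * ss u2 k).
move=> P1 P2; apply: (@cvg_shift n F (fun j => pi^-1 * (cc f (n + j) * ss w j - ss f (n + j) * cc w j))).
- move=> k kn; rewrite /F.
  have -> : cc u1 k = 2^-1 * (ss w (n + k) + ss w (n - k)).
    by rewrite /cc /u1 (swap w) Jcossin_prod// ltnW.
  have -> : ss u1 k = 2^-1 * (cc w (n - k) - cc w (n + k)).
    by rewrite /ss /u1 (swap w) Jsinsin_prod// ltnW.
  have -> : cc u2 k = - (2^-1 * (ss w (n + k) + ss w (n - k))).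
    by rewrite /cc /u2 (swap hw) Jcoscos_prod ?chw 1?ltnW//; ring.
  have -> : ss u2 k = - (2^-1 * (cc w (n - k) - cc w (n + k))).
    by rewrite /ss /u2 (swap hw) Jsincos_prod ?shw 1?ltnW//; ring.
  by ring.
- move=> j; rewrite /F.
  have nk : (n <= n + j)%N by exact: leq_addr.
  have -> : cc u1 (n + j) = 2^-1 * (ss w (n + j + n) - ss w j).
    by rewrite [LHS]Jsincos_prod// addKn.
  have -> : ss u1 (n + j) = 2^-1 * (cc w j - cc w (n + j + n)).
    by rewrite [LHS]Jsinsin_prod// addKn.
  have -> : cc u2 (n + j) = - (2^-1 * (ss w (n + j + n) + ss w j)).
    by rewrite [LHS]Jcoscos_prod// addKn !chw; ring.
  have -> : ss u2 (n + j) = 2^-1 * (cc w (n + j + n) + cc w j).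
    by rewrite [LHS]Jcossin_prod// addKn !shw.
  rewrite kapE; last exact: leq_trans n0 nk.
  by move: (pi^-1) => K; field.
- by rewrite /F; under eq_fun do rewrite sumrB sumrN; apply: cvgB => //; exact: cvgN.
Qed.

End Commutator.

(** * Complex coefficients, Sobolev norms and Fourier multipliers *)

Section FourierLink.
Context {R : realType}.
Implicit Types (u v g : R -> R).
Local Notation mu := (@lebesgue_measure R).
Local Notation intc u := (mu.-integrable (@circle R) (EFin \o u)).
Local Notation J u := (\int[mu]_(x in @circle R) u x).
Local Notation ka := ((Num.sqrt (pi *+ 2))^-1 : R).

Lemma ka_gt0 : 0 < ka.
Proof. by rewrite invr_gt0 sqrtr_gt0 twopi_gt0. Qed.

Lemma fourier_nat u (n : nat) : fourier u n = Complex (ka * cc u n) (- (ka * ss u n)).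
Proof.
rewrite /fourier; apply/eqP; rewrite eq_complex /=; apply/andP; split; apply/eqP.
  by rewrite mul0r subr0.
by rewrite mul0r addr0 mulrN.
Qed.

Lemma fourier_neg u (n : nat) : intc u -> fourier u (Negz n) = Complex (ka * cc u n.+1) (ka * ss u n.+1).
Proof.
move=> iu; have E1 : J (fun x => u x * cos ((Negz n)%:~R * x)) = cc u n.+1.
  by apply: eq_Rintegral => x _; rewrite NegzE mulrNz mulNr cosN -pmulrn.
have E2 : J (fun x => u x * sin ((Negz n)%:~R * x)) = - ss u n.+1.
  rewrite /ss -JN; last exact: intc_sin.
  by apply: eq_Rintegral => x _; rewrite NegzE mulrNz mulNr sinN -pmulrn mulrN.
rewrite /fourier E1 E2; apply/eqP; rewrite eq_complex /=; apply/andP; split; apply/eqP.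
  by rewrite mul0r subr0.
by rewrite mul0r addr0 opprK.
Qed.

Definition sq u n : R := cc u n ^+ 2 + ss u n ^+ 2.

Lemma sq_ge0 u n : 0 <= sq u n.
Proof. by rewrite addr_ge0 ?sqr_ge0. Qed.

Lemma ka_sqr : ka ^+ 2 = (pi *+ 2)^-1.
Proof. by rewrite exprVn sqr_sqrtr// ltW// twopi_gt0. Qed.

Lemma normc_fourier_nat u (n : nat) : Normc.normc (fourier u n) ^+ 2 = (pi *+ 2)^-1 * sq u n.
Proof.
rewrite fourier_nat /= sqr_sqrtr ?addr_ge0 ?sqr_ge0// sqrrN !exprMn ka_sqr /sq mulrDr//.
Qed.
Lemma normc_fourier_neg u (n : nat) : intc u -> Normc.normc (fourier u (Negz n)) ^+ 2 = (pi *+ 2)^-1 * sq u n.+1.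
Proof.
move=> iu; rewrite fourier_neg //= sqr_sqrtr ?addr_ge0 ?sqr_ge0// !exprMn ka_sqr /sq mulrDr//.
Qed.

(** The frequencies n and -n contribute equally, which turns 1 / (2 pi) into 1 / pi. For nonzero s
    the weight at frequency 0 vanishes, whereas it would be 1 for s = 0. *)
Lemma sobolev_norm_sqr s u : intc u -> s != 0 ->
  (sobolev_norm s u ^+ 2 = \sum_(n <oo) (pi^-1 * (n%:R `^ (2 * s)) * sq u n)%:E)%E.
Proof.
move=> iu s0; rewrite /sobolev_norm; set a := fun k : int => (_%:E)%E.
have a0 k : (0 <= a k)%E by rewrite lee_fin mulr_ge0 ?powR_ge0 ?sqr_ge0.
have aP (n : nat) : a n = (n%:R `^ (2 * s) * ((pi *+ 2)^-1 * sq u n))%:E by rewrite /a normc_fourier_nat.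
have aN (n : nat) : a (Negz n) = (n.+1%:R `^ (2 * s) * ((pi *+ 2)^-1 * sq u n.+1))%:E.
  by rewrite /a normc_fourier_neg.
rewrite sqr_sqrte; last by apply: esum_ge0 => k _; exact: a0.
rewrite (@esumID _ _ (range Posz) setT a)// setTI.
have -> : [set: int] `&` ~` range Posz = range Negz.
  rewrite setTI; apply/seteqP; split=> [[n|n]|_ [n _ <-]] /=.
  - by move=> []; exists n.
  - by move=> _; exists n.
  - by case.
rewrite !esum_image; [|by move=> x y _ _ []|by move=> x y _ _ []].
rewrite -!nneseries_esumT//.
have b0 n : (0 <= (pi^-1 * (n%:R `^ (2 * s)) * sq u n)%:E)%E.
  by rewrite lee_fin !mulr_ge0 ?powR_ge0 ?sq_ge0 ?invr_ge0 ?pi_ge0.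
rewrite nneseries_recl// aP mulr0n powR0 ?mulf_neq0// mul0r add0e.
rewrite [RHS]nneseries_recl// mulr0n powR0 ?mulf_neq0// mulr0 mul0r add0e.
rewrite -(@nneseries_addn _ a 1)// -(@nneseries_addn _ (fun k => (pi^-1 * (k%:R `^ (2 * s)) * sq u k)%:E) 1)//.
rewrite -nneseriesD//; apply: eq_eseriesr => n _; rewrite addn1.
rewrite aN aP -EFinD; congr EFin; rewrite -[pi *+ 2]mulr_natl invfM.
by move: (pi^-1) (_ `^ _) (sq _ _) => P a1 b1; field.
Qed.

Lemma fourier_realmultP (m : nat -> R) u v : intc u -> intc v ->
  (forall n : int, fourier v n = ((m `|n|%N)%:C * fourier u n)%C) <->
  (forall n, cc v n = m n * cc u n) /\ (forall n, ss v n = m n * ss u n).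
Proof.
move=> iu iv; have k0 := lt0r_neq0 ka_gt0; split=> [H|[Hc Hs] [n|n]].
  split=> n; have := H n; rewrite !fourier_nat => -[h1 h2].
    by apply: (mulfI k0); rewrite h1; move: (_^-1) => K; ring.
  by apply: (mulfI k0); apply: oppr_inj; rewrite h2; move: (_^-1) => K; ring.
- rewrite !fourier_nat Hc Hs; apply/eqP; rewrite eq_complex /=; apply/andP; split; apply/eqP; move: (_^-1) => K; ring.
- rewrite !fourier_neg// Hc Hs; apply/eqP; rewrite eq_complex /=; apply/andP; split; apply/eqP; move: (_^-1) => K; ring.
Qed.

Lemma fourier_hilbertP u v : intc u -> L2T v ->
  (forall n : int, fourier v n = (- 'i%C * (sgz n)%:~R) * fourier u n) <-> is_hilbert u v.
Proof.
move=> iu lv; have iv := L2T_int lv; have k0 := lt0r_neq0 ka_gt0; split=> [H|[_ c0 Hc Hs] [[|n]|n]].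
  split=> //.
  - have := H 0; rewrite sgz0 mulr0 mul0r fourier_nat => -[/eqP].
    by rewrite mulf_eq0 (negbTE k0)/= => /eqP.
  - case=> // n _; have := H n.+1; rewrite !fourier_nat => -[h1 _].
    by apply: (mulfI k0); rewrite h1; move: (_^-1) => K; ring.
  - case=> // n _; have := H n.+1; rewrite !fourier_nat => -[_ h2].
    by apply: (mulfI k0); apply: oppr_inj; rewrite h2; move: (_^-1) => K; ring.
- by rewrite sgz0 mulr0 mul0r fourier_nat c0 ss0 !mulr0 oppr0.
- rewrite !fourier_nat Hc// Hs//; apply/eqP; rewrite eq_complex /=; apply/andP; split; apply/eqP; move: (_^-1) => K; ring.
- rewrite !fourier_neg// Hc// Hs//; apply/eqP; rewrite eq_complex /=; apply/andP; split; apply/eqP; move: (_^-1) => K; ring.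
Qed.

(** The operator is defined by a choice that could return its default value. Riesz-Fischer supplies
    a witness, so the chosen function does have the prescribed coefficients; [Lambda_spec] follows
    the same pattern. *)
Lemma hilbert_spec u : L2T u -> is_hilbert u (hilbert u).
Proof.
move=> lu; pose p n := if n is 0%N then 0 else - ss u n; pose q n := if n is 0%N then 0 else cc u n.
have [|N|v [lv cv sv]] := @riesz_fischer R p q (J (fun x => u x ^+ 2)); first by [].
  apply: le_trans (bessel N lu); apply: ler_sum => -[[|k] ?] _ /=.
    rewrite expr0n/= addr0 mulr0; apply: mulr_ge0; first exact: ltW (kap_gt0 0).
    by rewrite addr_ge0 ?sqr_ge0.
  by rewrite sqrrN addrC.
have Hv : is_hilbert u v by split; [exact: lv|rewrite cv|case=> // n _; rewrite cv|case=> // n _; rewrite sv].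
have := @getPex _ [set v | L2T v /\ forall n : int, fourier v n = (- 'i%C * (sgz n)%:~R) * fourier u n].
case; first by exists v; split=> //; apply/fourier_hilbertP => //; exact: L2T_int.
by rewrite -/(hilbert u) => lh /fourier_hilbertP; apply => //; exact: L2T_int.
Qed.

Lemma Lambda_spec r u : L2T u ->
  (exists B, forall N, \sum_(k < N) (k%:R `^ r) ^+ 2 * sq u k <= B) ->
  [/\ L2T (Lambda r u), forall n, cc (Lambda r u) n = n%:R `^ r * cc u n &
      forall n, ss (Lambda r u) n = n%:R `^ r * ss u n].
Proof.
move=> lu [B HB]; pose p n := n%:R `^ r * cc u n; pose q n := n%:R `^ r * ss u n.
have [|N|v [lv cv sv]] := @riesz_fischer R p q B; first by rewrite /q ss0 mulr0.
  apply: le_trans (HB N); apply: ler_sum => k _.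
  rewrite !exprMn -mulrDr -/(sq u k) ler_piMl ?kap_le1//.
  by rewrite mulr_ge0 ?sqr_ge0 ?sq_ge0.
have := @getPex _ [set v | L2T v /\ forall n : int, fourier v n = ((`|n|%:~R : R) `^ r)%:C%C * fourier u n].
case; first by exists v; split=> //; apply: (@fourier_realmultP (fun n => n%:R `^ r) u v _ _).2; rewrite ?L2T_int.
by rewrite -/(Lambda r u) => lh /(@fourier_realmultP (fun n => n%:R `^ r) u _ (L2T_int lu) (L2T_int lh)).1 [? ?].
Qed.

End FourierLink.

(** * Integration by parts on the circle *)

Section Parts.
Context {R : realType}.
Local Notation mu := (@lebesgue_measure R).
Local Notation J u := (\int[mu]_(x in @circle R) u x).
Variables (g g' : R -> R).
Hypothesis dg : forall x : R, is_derive x (1 : R) g (g' x).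
Hypothesis cg' : continuous g'.
Hypothesis pg : periodic g (pi *+ 2).

Lemma is_derive_continuous (h h' : R -> R) : (forall x : R, is_derive x (1 : R) h (h' x)) -> continuous h.
Proof.
by move=> dh x; apply: differentiable_continuous; apply/derivable1_diffP; have [] := dh x.
Qed.

Lemma derive_oo_LR (h h' : R -> R) a b : (forall x : R, is_derive x (1 : R) h (h' x)) -> derivable_oo_LRcontinuous h a b.
Proof.
move=> dh; have ch := is_derive_continuous dh; split.
- by move=> x _; have [] := dh x.
- by apply: cvg_at_right_filter; exact: ch.
- by apply: cvg_at_left_filter; exact: ch.
Qed.

Lemma J_by_parts (h h' : R -> R) : (forall x : R, is_derive x (1 : R) h (h' x)) -> continuous h' ->
  periodic h (pi *+ 2) -> J (fun x => g' x * h x) = - J (fun x => g x * h' x).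
Proof.
move=> dh ch' ph.
rewrite [X in _ = - X](@Rintegration_by_parts R g h g' h' 0 (pi *+ 2)) ?twopi_gt0//.
- have -> : g (pi *+ 2) = g 0 by rewrite -[RHS]pg add0r.
  have -> : h (pi *+ 2) = h 0 by rewrite -[RHS]ph add0r.
  by rewrite subrr sub0r opprK.
- exact: continuous_subspaceT.
- exact: derive_oo_LR dg.
- by move=> x _; rewrite derive1E; have [_ ->] := dg x.
- exact: continuous_subspaceT.
- exact: derive_oo_LR dh.
- by move=> x _; rewrite derive1E; have [_ ->] := dh x.
Qed.

Lemma is_derive_cosl (a x : R) : is_derive x 1 (fun x => cos (a * x)) (- (a * sin (a * x))).
Proof.
have := @is_derive_cos R (a * x) => H.
by apply: is_derive_eq; rewrite /GRing.scale/= ?mulr1 ?mulr0 ?addr0; ring.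
Qed.
Lemma is_derive_sinl (a x : R) : is_derive x 1 (fun x => sin (a * x)) (a * cos (a * x)).
Proof.
have := @is_derive_sin R (a * x) => H.
by apply: is_derive_eq; rewrite /GRing.scale/= ?mulr1 ?mulr0 ?addr0; ring.
Qed.

Lemma cc_deriv n : cc g' n = n%:R * ss g n.
Proof.
rewrite /cc (J_by_parts (is_derive_cosl n%:R)).
- have ig : mu.-integrable (@circle R) (EFin \o g) by exact/continuous_intc/(is_derive_continuous dg).
  have -> : J (fun x => g x * - (n%:R * sin (n%:R * x))) = J (fun x => - n%:R * (g x * sin (n%:R * x))).
    by apply: eq_Rintegral => x _; ring.
  by rewrite JZ ?mulNr ?opprK//; exact: intc_sin.
- move=> x; apply: cvgN; apply: cvgM; first exact: cvg_cst.
  exact: (is_derive_continuous (is_derive_sinl n%:R)).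
- move=> x; rewrite mulrDr.
  by have -> : n%:R * (pi *+ 2) = (pi *+ 2) *+ n :> R; [rewrite mulr_natl|rewrite (periodicn (@cosD2pi R))].
Qed.

Lemma ss_deriv n : ss g' n = - (n%:R * cc g n).
Proof.
rewrite /ss (J_by_parts (is_derive_sinl n%:R)).
- have ig : mu.-integrable (@circle R) (EFin \o g) by exact/continuous_intc/(is_derive_continuous dg).
  have -> : J (fun x => g x * (n%:R * cos (n%:R * x))) = J (fun x => n%:R * (g x * cos (n%:R * x))).
    by apply: eq_Rintegral => x _; ring.
  by rewrite JZ//; exact: intc_cos.
- move=> x; apply: cvgM; first exact: cvg_cst.
  exact: (is_derive_continuous (is_derive_cosl n%:R)).
- move=> x; rewrite mulrDr.
  by have -> : n%:R * (pi *+ 2) = (pi *+ 2) *+ n :> R; [rewrite mulr_natl|rewrite (periodicn (@sinD2pi R))].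
Qed.

End Parts.

(** * Finite sums and the discrete Cauchy-Schwarz inequality *)

Section FiniteSums.
Context {R : realFieldType}.
Implicit Types (a b c x y : nat -> R).

(** Inductive step of Cauchy-Schwarz, stated with squares to stay within an ordered field: the cross
    term 2 S c is the geometric mean of A b and a B, up to the factor 2. *)
Lemma cs_step (S A B c a b : R) : 0 <= A -> 0 <= B -> 0 <= a -> 0 <= b ->
  S ^+ 2 <= A * B -> c ^+ 2 <= a * b -> (S + c) ^+ 2 <= (A + a) * (B + b).
Proof.
move=> A0 B0 a0 b0 H1 H2.
have H : S * c *+ 2 <= A * b + a * B.
  apply: le_trans (ler_norm _) _; rewrite -[leRHS]ger0_norm ?addr_ge0 ?mulr_ge0//.
  rewrite -ler_sqr ?nnegrE// !real_normK ?num_real//.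
  have h3 : (S * c) ^+ 2 <= (A * B) * (a * b) by rewrite exprMn ler_pM ?sqr_ge0.
  have : 0 <= (A * b - a * B) ^+ 2 by exact: sqr_ge0.
  by rewrite -mulr_natl; move: h3; rewrite !exprMn; nra.
rewrite sqrrD; nra.
Qed.

Lemma cs_gen a b c N : (forall i, 0 <= a i) -> (forall i, 0 <= b i) ->
  (forall i, c i ^+ 2 <= a i * b i) ->
  (\sum_(i < N) c i) ^+ 2 <= (\sum_(i < N) a i) * (\sum_(i < N) b i).
Proof.
move=> a0 b0 H; elim: N => [|N IH]; first by rewrite !big_ord0 expr0n/= mul0r.
by rewrite !big_ord_recr/=; apply: cs_step => //; apply: sumr_ge0.
Qed.

Lemma sum_inv_sq N : \sum_(j < N) ((j%:R : R) ^+ 2)^-1 <= 2.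
Proof.
(* The bound is strengthened by 1 / (n + 1), which telescopes. The term j = 0 counts as 0 because
   0^-1 = 0. *)
suff H n : \sum_(j < n.+2) ((j%:R : R) ^+ 2)^-1 <= 2 - n.+1%:R^-1.
  case: N => [|[|N]]; first by rewrite big_ord0.
    by rewrite big_ord_recr big_ord0/= expr0n/= invr0 addr0.
  by apply: le_trans (H N) _; rewrite gerBl invr_ge0.
elim: n => [|n IH].
  by rewrite !big_ord_recr big_ord0/= expr0n/= invr0 expr1n invr1; lra.
rewrite big_ord_recr/=; apply: le_trans (lerD IH (lexx _)) _.
have -> : n.+2%:R = n.+1%:R + 1 :> R by rewrite natr1.
have : 0 < n.+1%:R :> R by rewrite ltr0n.
move: (n.+1%:R) => m m0.
rewrite -subr_ge0.
have -> : 2 - (m + 1)^-1 - (2 - m^-1 + ((m + 1) ^+ 2)^-1) = (m * (m + 1) ^+ 2)^-1.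
  field; rewrite !gt_eqF//; lra.
by rewrite invr_ge0 mulr_ge0// ?sqr_ge0// ltW.
Qed.

Lemma le_sqr_le (x y : R) : 0 <= y -> x ^+ 2 <= y ^+ 2 -> x <= y.
Proof.
move=> y0 H; apply: le_trans (ler_norm _) _; rewrite -(ger0_norm y0).
by rewrite -ler_sqr ?nnegrE// !real_normK ?num_real.
Qed.

Lemma sum_shift_le (g : nat -> R) (B : R) j : (forall i, 0 <= g i) ->
  (forall N, \sum_(n < N) g n <= B) -> forall N, \sum_(n < N) g (n + j)%N <= B.
Proof.
move=> g0 HB N; apply: le_trans (HB (j + N)%N); rewrite big_split_ord/=.
rewrite -[leLHS]add0r lerD ?sumr_ge0//.
by apply: ler_sum => i _; rewrite addnC.
Qed.

(** Cauchy-Schwarz against 1 / n^2: square summability with weight n^4 gives summability with weight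
    n. The constant sqrt 2 is rounded up to 2. *)
Lemma sum_freq_le x (A : R) : 0 <= A -> (forall N, \sum_(n < N) n%:R ^+ 4 * x n ^+ 2 <= A ^+ 2) ->
  forall N, \sum_(n < N) n%:R * `|x n| <= 2 * A.
Proof.
move=> A0 H N; apply: le_sqr_le; first by rewrite mulr_ge0.
apply: le_trans (@cs_gen (fun n => (n%:R ^+ 2)^-1) (fun n => n%:R ^+ 4 * x n ^+ 2) (fun n => n%:R * `|x n|) N _ _ _) _.
- by move=> i; rewrite invr_ge0 sqr_ge0.
- by move=> i; rewrite mulr_ge0 ?sqr_ge0// exprn_ge0.
- case=> [|i]; first by rewrite mul0r expr0n/= invr0 mul0r.
  rewrite exprMn real_normK ?num_real// mulrA ler_wpM2r ?sqr_ge0//.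
  by rewrite -[4%N]/(2 + 2)%N exprD mulrA mulVf ?mul1r// gt_eqF// exprn_gt0// ltr0n.
have h1 := sum_inv_sq N; have h2 := H N.
apply: (@le_trans _ _ (2 * A ^+ 2)); last by rewrite exprMn; have := sqr_ge0 A; nra.
apply: ler_pM => //; apply: sumr_ge0 => i _.
  by rewrite invr_ge0 sqr_ge0.
by apply: mulr_ge0; [exact: exprn_ge0|exact: sqr_ge0].
Qed.

End FiniteSums.

(** * The interaction kernel and its weighted bounds *)

Section Kernel.
Context {R : realFieldType}.
Variable nu : R.
Hypothesis nu0 : 0 < nu.
Implicit Types (X Y d om : nat -> R).

Definition lam (n : nat) : R := nu * n%:R ^+ 3 + n%:R.
Definition ker (n j : nat) : R := n%:R * lam j / lam n.

Lemma lam0 : lam 0 = 0.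
Proof. by rewrite /lam expr0n/= mulr0 addr0. Qed.

Lemma lam_gt0 n : (0 < n)%N -> 0 < lam n.
Proof. by move=> n0; rewrite addr_gt0// ?mulr_gt0// ?exprn_gt0// ltr0n. Qed.

Lemma lam_ge0 n : 0 <= lam n.
Proof. by rewrite addr_ge0// mulr_ge0 ?exprn_ge0// ltW. Qed.

Lemma lam_mono n m : (n <= m)%N -> lam n <= lam m.
Proof.
move=> nm; have h : n%:R <= m%:R :> R by rewrite ler_nat.
by apply: lerD => //; apply: ler_wpM2l; [exact: ltW|rewrite lerXn2r ?nnegrE].
Qed.

Lemma lam_ker n j : lam n * ker n j = n%:R * lam j.
Proof.
case: n => [|n]; first by rewrite lam0 !mul0r.
by rewrite /ker mulrC divfK// gt_eqF// lam_gt0.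
Qed.

Lemma ker_ge0 n j : 0 <= ker n j.
Proof. by rewrite /ker divr_ge0 ?mulr_ge0 ?lam_ge0. Qed.

Lemma ker0 n : ker n 0 = 0.
Proof. by rewrite /ker lam0 mulr0 mul0r. Qed.

Lemma kerE n j : (0 < n)%N -> ker n j = j%:R * (1 + nu * j%:R ^+ 2) / (1 + nu * n%:R ^+ 2).
Proof.
move=> n0; rewrite /ker /lam; have : 0 < n%:R :> R by rewrite ltr0n.
move: (n%:R) (j%:R) => x y x0; field; apply/andP; split.
  by rewrite gt_eqF// addr_gt0// mulr_gt0// exprn_gt0.
by rewrite gt_eqF// addr_gt0// mulr_gt0// exprn_gt0.
Qed.

Let den_gt0 (x : R) : 0 < 1 + nu * x ^+ 2.
Proof. by rewrite ltr_pwDl// mulr_ge0 ?sqr_ge0// ltW. Qed.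

(** After removing j it suffices that n^2 (1 + nu j^2) <= (n^2 + j^2) (1 + nu n^2). The terms nu n^2
    j^2 agree on both sides, so the bound is uniform in [nu]. *)
Lemma ker_le n j : n%:R ^+ 2 * ker n j <= (n + j)%:R ^+ 2 * j%:R.
Proof.
case: n => [|n]; first by rewrite expr0n/= mul0r mulr_ge0 ?sqr_ge0.
rewrite kerE// natrD; have : 0 <= n.+1%:R :> R by []. have : 0 <= j%:R :> R by [].
move: (n.+1%:R) (j%:R) => x y y0 x0.
rewrite [leLHS](_ : _ = y * (x ^+ 2 * (1 + nu * y ^+ 2)) / (1 + nu * x ^+ 2)); last first.
  by field; rewrite gt_eqF.
rewrite ler_pdivrMr// [leRHS](_ : _ = y * ((x + y) ^+ 2 * (1 + nu * x ^+ 2))); last by ring.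
apply: ler_wpM2l => //.
apply: (@le_trans _ _ ((x ^+ 2 + y ^+ 2) * (1 + nu * x ^+ 2))).
  by have := sqr_ge0 x; have := sqr_ge0 y; move: nu0; move: (x ^+ 2) (y ^+ 2) => a b; nra.
by apply: ler_wpM2r; [exact: ltW|nra].
Qed.

(** The inequality behind [ker_le], divided by j^2, for estimates whose weight sits on the factor of
    frequency j. At j = 0 both sides are 0 because 0^-1 = 0. *)
Lemma ker_le2 n j : n%:R ^+ 2 * ker n j * (j%:R ^+ 2)^-1 <= j%:R^-1 * n%:R ^+ 2 + j%:R.
Proof.
case: n => [|n]; first by rewrite expr0n/= !mul0r mulr0 add0r.
case: j => [|j]; first by rewrite ker0 mulr0 mul0r invr0 mul0r add0r.
rewrite kerE//; have : 0 < n.+1%:R :> R by rewrite ltr0n. have : 0 < j.+1%:R :> R by rewrite ltr0n.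
move: (n.+1%:R) (j.+1%:R) => x y y0 x0.
have -> : x ^+ 2 * (y * (1 + nu * y ^+ 2) / (1 + nu * x ^+ 2)) * (y ^+ 2)^-1 =
   (x ^+ 2 * (1 + nu * y ^+ 2)) / (y * (1 + nu * x ^+ 2)).
  by field; rewrite !gt_eqF// !addr_gt0// ?mulr_gt0// exprn_gt0.
rewrite ler_pdivrMr ?mulr_gt0//.
have -> : (y^-1 * x ^+ 2 + y) * (y * (1 + nu * x ^+ 2)) = (x ^+ 2 + y ^+ 2) * (1 + nu * x ^+ 2).
  by field; rewrite gt_eqF.
by have := sqr_ge0 x; have := sqr_ge0 y; move: nu0; move: (x ^+ 2) (y ^+ 2) => a b; nra.
Qed.

Definition Qsum X Y J n : R := \sum_(j < J) ker n j * X (n + j)%N * Y j.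

Lemma Qsum_ge0 X Y J n : (forall k, 0 <= X k) -> (forall k, 0 <= Y k) -> 0 <= Qsum X Y J n.
Proof. by move=> X0 Y0; apply: sumr_ge0 => j _; apply: mulr_ge0 => //; apply: mulr_ge0 => //; exact: ker_ge0. Qed.

(* Young's inequality for l1 * l2, with the weight n^4 om n moved from n to n + j. *)
Lemma Qsum_weighted X Y om J (S B : R) : (forall k, 0 <= X k) -> (forall k, 0 <= Y k) ->
  (forall k, 0 <= om k) -> {homo om : m n / (m <= n)%N >-> m <= n} ->
  0 <= S -> (forall N, \sum_(j < N) j%:R * Y j <= S) ->
  (forall N, \sum_(n < N) n%:R ^+ 4 * om n * X n ^+ 2 <= B) ->
  forall N, \sum_(n < N) n%:R ^+ 4 * om n * Qsum X Y J n ^+ 2 <= S ^+ 2 * B.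
Proof.
move=> X0 Y0 om0 omm S0 HS HB N.
have B0 : 0 <= B by apply: le_trans (HB 0%N); rewrite big_ord0.
pose g m := m%:R ^+ 4 * om m * X m ^+ 2.
have g0 m : 0 <= g m by rewrite !mulr_ge0 ?exprn_ge0.
have step n : n%:R ^+ 4 * om n * Qsum X Y J n ^+ 2 <= S * \sum_(j < J) j%:R * Y j * g (n + j)%N.
  have h1 : n%:R ^+ 2 * Qsum X Y J n <= \sum_(j < J) (j%:R * Y j) * ((n + j)%:R ^+ 2 * X (n + j)%N).
    rewrite mulr_sumr; apply: ler_sum => j _.
    rewrite [leLHS](_ : _ = n%:R ^+ 2 * ker n j * (X (n + j)%N * Y j)); last by ring.
    rewrite [leRHS](_ : _ = (n + j)%:R ^+ 2 * j%:R * (X (n + j)%N * Y j)); last by ring.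
    by rewrite ler_wpM2r ?mulr_ge0// ker_le.
  have h2 := @cs_gen _ (fun j => j%:R * Y j) (fun j => j%:R * Y j * ((n + j)%:R ^+ 4 * X (n + j)%N ^+ 2))
    (fun j => (j%:R * Y j) * ((n + j)%:R ^+ 2 * X (n + j)%N)) J.
  have {}h2 : (\sum_(j < J) (j%:R * Y j) * ((n + j)%:R ^+ 2 * X (n + j)%N)) ^+ 2 <=
     S * (\sum_(j < J) j%:R * Y j * ((n + j)%:R ^+ 4 * X (n + j)%N ^+ 2)).
    apply: le_trans (h2 _ _ _) _.
    - by move=> i; rewrite mulr_ge0.
    - by move=> i; rewrite !mulr_ge0 ?exprn_ge0.
    - by move=> i; rewrite le_eqVlt; apply/orP; left; apply/eqP; ring.
    - apply: ler_wpM2r; last exact: HS.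
      by apply: sumr_ge0 => i _; rewrite !mulr_ge0 ?exprn_ge0.
  rewrite [leLHS](_ : _ = om n * (n%:R ^+ 2 * Qsum X Y J n) ^+ 2); last by ring.
  apply: (@le_trans _ _ (om n * (S * (\sum_(j < J) j%:R * Y j * ((n + j)%:R ^+ 4 * X (n + j)%N ^+ 2))))).
    apply: ler_wpM2l => //; apply: le_trans h2.
    by rewrite lerXn2r// ?nnegrE ?mulr_ge0 ?sqr_ge0 ?Qsum_ge0 ?sumr_ge0// => i _; rewrite !mulr_ge0 ?exprn_ge0.
  rewrite mulrCA ler_wpM2l// mulr_sumr; apply: ler_sum => j _.
  rewrite /g [leLHS](_ : _ = om n * (j%:R * Y j * ((n + j)%:R ^+ 4 * X (n + j)%N ^+ 2))); last by ring.
  rewrite [leRHS](_ : _ = om (n + j)%N * (j%:R * Y j * ((n + j)%:R ^+ 4 * X (n + j)%N ^+ 2))); last by ring.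
  by rewrite ler_wpM2r ?omm ?leq_addr// !mulr_ge0 ?exprn_ge0.
apply: le_trans (ler_sum _ (fun (n : 'I_N) _ => step n)) _.
rewrite -mulr_sumr expr2 -mulrA ler_wpM2l// exchange_big/=.
apply: (@le_trans _ _ (\sum_(j < J) j%:R * Y j * B)).
  apply: ler_sum => j _; rewrite -mulr_sumr ler_wpM2l ?mulr_ge0//.
  exact: (@sum_shift_le _ g B j g0 HB N).
by rewrite -mulr_suml ler_wpM2r.
Qed.

(** A difference at frequency n + j is handled by [ker_le] and the bound 2 A on the sum of j |X_j|.
    For a difference at frequency j, [ker_le2] leaves two sums, each at most 2 A. Together they give
    6 A M. *)
Lemma ker_diff X d J (A M : R) n : 0 <= A -> 0 <= M ->
  (forall N, \sum_(n < N) n%:R ^+ 4 * X n ^+ 2 <= A ^+ 2) ->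
  (forall k, k%:R ^+ 2 * `|d k| <= M) ->
  n%:R ^+ 2 * (\sum_(j < J) ker n j * (`|d (n + j)%N| * `|X j| + `|X (n + j)%N| * `|d j|)) <= 6 * A * M.
Proof.
move=> A0 M0 HX Hd.
have S1 := sum_freq_le A0 HX.
have g0 i : 0 <= i%:R * `|X i| by rewrite mulr_ge0.
have h1 : \sum_(j < J) n%:R ^+ 2 * ker n j * (`|d (n + j)%N| * `|X j|) <= 2 * A * M.
  apply: (@le_trans _ _ (\sum_(j < J) M * (j%:R * `|X j|))); last first.
    by rewrite -mulr_sumr mulrC ler_wpM2r.
  apply: ler_sum => j _.
  apply: (@le_trans _ _ ((n + j)%:R ^+ 2 * j%:R * (`|d (n + j)%N| * `|X j|))).
    by rewrite ler_wpM2r ?mulr_ge0// ker_le.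
  rewrite [leLHS](_ : _ = ((n + j)%:R ^+ 2 * `|d (n + j)%N|) * (j%:R * `|X j|)); last by ring.
  by rewrite ler_wpM2r.
have h2 : \sum_(j < J) n%:R ^+ 2 * ker n j * (`|X (n + j)%N| * `|d j|) <= 4 * A * M.
  apply: (@le_trans _ _ (\sum_(j < J) (M * (j%:R^-1 * ((n + j)%:R ^+ 2 * `|X (n + j)%N|))
      + M * ((j + n)%:R * `|X (j + n)%N|)))).
    apply: ler_sum => j _; rewrite -mulrDr [X in _ <= M * (_ + X)](_ : _ = (n + j)%:R * `|X (n + j)%N|); last by rewrite addnC.
    have [j0|j0] := posnP j.
      by rewrite j0 ker0 mulr0 mul0r mulr_ge0// addr_ge0// ?mulr_ge0 ?invr_ge0 ?sqr_ge0.
    have jn0 : j%:R != 0 :> R by rewrite pnatr_eq0 -lt0n.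
    rewrite [leLHS](_ : _ = (j%:R ^+ 2 * `|d j|) * (n%:R ^+ 2 * ker n j * (j%:R ^+ 2)^-1 * `|X (n + j)%N|)); last by field.
    apply: ler_pM => //.
      apply: mulr_ge0 => //; apply: mulr_ge0; last by rewrite invr_ge0 sqr_ge0.
      by apply: mulr_ge0; [exact: sqr_ge0|exact: ker_ge0].
    apply: le_trans (ler_wpM2r (normr_ge0 _) (ker_le2 n j)) _.
    rewrite mulrDl; apply: lerD; last by apply: ler_wpM2r => //; rewrite ler_nat leq_addl.
    rewrite -mulrA; apply: ler_wpM2l; first by rewrite invr_ge0.
    by apply: ler_wpM2r => //; rewrite lerXn2r ?nnegrE// ler_nat leq_addr.
  rewrite big_split/= -!mulr_sumr -mulrDr mulrC ler_wpM2r//.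
  have k1 : \sum_(j < J) j%:R^-1 * ((n + j)%:R ^+ 2 * `|X (n + j)%N|) <= 2 * A.
    apply: le_sqr_le; first by rewrite mulr_ge0.
    apply: le_trans (@cs_gen _ (fun j => (j%:R ^+ 2)^-1) (fun j => (j + n)%:R ^+ 4 * X (j + n)%N ^+ 2) (fun j => j%:R^-1 * ((n + j)%:R ^+ 2 * `|X (n + j)%N|)) J _ _ _) _.
    - by move=> i; rewrite invr_ge0 sqr_ge0.
    - by move=> i; rewrite mulr_ge0 ?sqr_ge0// exprn_ge0.
    - move=> i; rewrite [(n + i)%N]addnC !exprMn real_normK ?num_real// exprVn.
      by rewrite le_eqVlt; apply/orP; left; apply/eqP; congr (_ * _); ring.
    have e1 := @sum_inv_sq R J.
    have e2 := @sum_shift_le _ (fun m => m%:R ^+ 4 * X m ^+ 2) (A ^+ 2) n.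
    apply: (@le_trans _ _ (2 * A ^+ 2)); last by rewrite exprMn; have := sqr_ge0 A; nra.
    apply: ler_pM.
    - by apply: sumr_ge0 => i _; rewrite invr_ge0 sqr_ge0.
    - by apply: sumr_ge0 => i _; apply: mulr_ge0; [exact: exprn_ge0|exact: sqr_ge0].
    - exact: e1.
    - by apply: e2 => // i; apply: mulr_ge0; [exact: exprn_ge0|exact: sqr_ge0].
  have k2 := @sum_shift_le _ (fun m => m%:R * `|X m|) (2 * A) n g0 S1 J.
  by apply: le_trans (lerD k1 k2) _; lra.
rewrite mulr_sumr [leLHS](_ : _ = \sum_(j < J) n%:R ^+ 2 * ker n j * (`|d (n + j)%N| * `|X j|) +
   \sum_(j < J) n%:R ^+ 2 * ker n j * (`|X (n + j)%N| * `|d j|)); last first.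
  by rewrite -big_split/=; apply: eq_bigr => j _; ring.
by apply: le_trans (lerD h1 h2) _; nra.
Qed.

End Kernel.

(** * The majorant sequence *)

Section Majorant.
Context {R : realType}.
Variables (nu : R) (al : nat -> R) (A : R).
Hypothesis nu0 : 0 < nu.
Hypothesis al0 : forall n, 0 <= al n.
Hypothesis A0 : 0 <= A.
Hypothesis alA : forall N, \sum_(n < N) n%:R ^+ 4 * al n ^+ 2 <= A ^+ 2.
Hypothesis A_small : 64 * A <= 1.

(* Monotone iteration for Y_n = al_n + 2 sum_j ker n j Y_(n+j) Y_j. *)
Fixpoint maj_iter (k : nat) : nat -> R :=
  if k is k'.+1 then fun n => al n + 2 * Qsum nu (maj_iter k') (maj_iter k') k' n else al.

Let Yit := maj_iter.

Let Yit_ge0 k n : 0 <= Yit k n.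
Proof.
elim: k n => [|k IH] n //=; apply: addr_ge0 => //; apply: mulr_ge0 => //.
by apply: Qsum_ge0.
Qed.

Let Yit_mono k n : Yit k n <= Yit k.+1 n.
Proof.
elim: k n => [|k IH] n; first by rewrite /= /Qsum big_ord0 mulr0 addr0.
rewrite /= lerD2l ler_wpM2l// -/(maj_iter k.+1) /Qsum big_ord_recr/=.
rewrite -[leLHS]addr0; apply: lerD.
  apply: ler_sum => j _; rewrite -[leLHS]mulrA -[leRHS]mulrA.
  apply: ler_wpM2l; first exact: (ker_ge0 nu0).
  by apply: ler_pM => //; first [exact: Yit_ge0|exact: IH].
by apply: mulr_ge0; [apply: mulr_ge0; [exact: ker_ge0 nu0 _ _|exact: (Yit_ge0 k.+1)]|exact: (Yit_ge0 k.+1)].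
Qed.

(** Young's inequality bounds the weighted square of 2 Q by 4 (4 A)^2 (4 B) = 256 A^2 B, which is at
    most B / 16 because 4096 A^2 <= 1. Then (a + b)^2 <= 2 a^2 + 2 b^2 gives at most 2 B + B / 8,
    and the bound 4 B reproduces itself. *)
Let step (Y om : nat -> R) (B : R) J : (forall n, 0 <= Y n) -> (forall k, 0 <= om k) ->
  {homo om : m n / (m <= n)%N >-> m <= n} ->
  (forall N, \sum_(j < N) j%:R * Y j <= 4 * A) ->
  (forall N, \sum_(n < N) n%:R ^+ 4 * om n * al n ^+ 2 <= B) ->
  (forall N, \sum_(n < N) n%:R ^+ 4 * om n * Y n ^+ 2 <= 4 * B) ->
  (forall N, \sum_(n < N) n%:R ^+ 4 * om n * (2 * Qsum nu Y Y J n) ^+ 2 <= B / 16) /\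
  (forall N, \sum_(n < N) n%:R ^+ 4 * om n * (al n + 2 * Qsum nu Y Y J n) ^+ 2 <= 4 * B).
Proof.
move=> Y0 om0 omm HS HB HY; have S0 : 0 <= 4 * A by rewrite mulr_ge0.
have B0 : 0 <= B by apply: le_trans (HB 0%N); rewrite big_ord0.
have H1 N : \sum_(n < N) n%:R ^+ 4 * om n * (2 * Qsum nu Y Y J n) ^+ 2 <= B / 16.
  have h := Qsum_weighted nu0 J Y0 Y0 om0 omm S0 HS HY N.
  rewrite [leLHS](_ : _ = 4 * \sum_(n < N) n%:R ^+ 4 * om n * Qsum nu Y Y J n ^+ 2); last first.
    by rewrite mulr_sumr; apply: eq_bigr => n _; ring.
  have hA : A ^+ 2 * 4096 <= 1.
    by have := A_small; have := A0; nra.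
  have : A ^+ 2 * 4096 * B <= 1 * B by rewrite ler_wpM2r.
  by move: h; rewrite exprMn; lra.
split=> // N; apply: (@le_trans _ _ (2 * (\sum_(n < N) n%:R ^+ 4 * om n * al n ^+ 2) +
   2 * \sum_(n < N) n%:R ^+ 4 * om n * (2 * Qsum nu Y Y J n) ^+ 2)).
  rewrite !mulr_sumr -big_split/=; apply: ler_sum => n _.
  have w0 : 0 <= n%:R ^+ 4 * om n by rewrite mulr_ge0 ?exprn_ge0.
  move: (n%:R ^+ 4 * om n) w0 (al n) (2 * Qsum _ _ _ _ _) => w w0 a b.
  rewrite -subr_ge0 (_ : _ - _ = w * (a - b) ^+ 2); last by ring.
  by rewrite mulr_ge0 ?sqr_ge0.
by have := H1 N; have := HB N; lra.
Qed.

Let one_mono : {homo (fun=> 1 : R) : m n / (m <= n)%N >-> m <= n}. Proof. by []. Qed.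

Let S_of (Y : nat -> R) : (forall n, 0 <= Y n) -> (forall N, \sum_(n < N) n%:R ^+ 4 * 1 * Y n ^+ 2 <= 4 * A ^+ 2) ->
  forall N, \sum_(j < N) j%:R * Y j <= 4 * A.
Proof.
move=> Y0 HY N; have A20 : 0 <= 2 * A by rewrite mulr_ge0.
have H : forall N, \sum_(n < N) n%:R ^+ 4 * Y n ^+ 2 <= (2 * A) ^+ 2.
  move=> M; rewrite (_ : (2 * A) ^+ 2 = 4 * A ^+ 2); last by ring.
  apply: le_trans (HY M); rewrite le_eqVlt; apply/orP; left; apply/eqP.
  by apply: eq_bigr => n _; rewrite mulr1.
have := sum_freq_le A20 H N; rewrite mulrA -natrM; apply: le_trans.
by apply: ler_sum => n _; rewrite ger0_norm.
Qed.

Let Yit_A k N : \sum_(n < N) n%:R ^+ 4 * 1 * Yit k n ^+ 2 <= 4 * A ^+ 2.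
Proof.
have al1 M : \sum_(n < M) n%:R ^+ 4 * 1 * al n ^+ 2 <= A ^+ 2.
  by apply: le_trans (alA M); apply: ler_sum => n _; rewrite mulr1.
elim: k N => [|k IH] N; first by apply: le_trans (al1 N) _; have := sqr_ge0 A; lra.
have HS := S_of (Yit_ge0 k) IH.
exact: (step k (Yit_ge0 k) (fun=> ler01) one_mono HS al1 IH).2.
Qed.

Let Yit_S k N : \sum_(j < N) j%:R * Yit k j <= 4 * A.
Proof. exact: (S_of (Yit_ge0 k) (Yit_A k)). Qed.

Let Yit_om (om : nat -> R) (B : R) k : (forall k, 0 <= om k) ->
  {homo om : m n / (m <= n)%N >-> m <= n} ->
  (forall N, \sum_(n < N) n%:R ^+ 4 * om n * al n ^+ 2 <= B) ->
  (forall N, \sum_(n < N) n%:R ^+ 4 * om n * Yit k n ^+ 2 <= 4 * B) /\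
  (forall N, \sum_(n < N) n%:R ^+ 4 * om n * (Yit k n - al n) ^+ 2 <= B / 16).
Proof.
move=> om0 omm HB; have B0 : 0 <= B by apply: le_trans (HB 0%N); rewrite big_ord0.
elim: k => [|k [IH _]].
  split=> N; first by apply: le_trans (HB N) _; lra.
  by rewrite big1 ?divr_ge0// => n _; rewrite subrr expr0n mulr0.
have [h1 h2] := step k (Yit_ge0 k) om0 omm (Yit_S k) HB IH.
split=> // N; apply: le_trans (h1 N); apply: ler_sum => n _.
by rewrite /Yit/= addrC addKr.
Qed.

(** [Y] is the monotone limit of the iterates. The second item keeps the equation as an inequality
    for each truncation, which is what comparison with a supersolution uses. The last item is the
    source of the constant in the energy inequality. *)
Lemma majorant : exists Y : nat -> R, [/\ forall n, al n <= Y n,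
  forall J n, al n + 2 * Qsum nu Y Y J n <= Y n,
  forall N, \sum_(n < N) n%:R ^+ 4 * Y n ^+ 2 <= (2 * A) ^+ 2 &
  forall (om : nat -> R) (B : R), (forall k, 0 <= om k) ->
    {homo om : m n / (m <= n)%N >-> m <= n} ->
    (forall N, \sum_(n < N) n%:R ^+ 4 * om n * al n ^+ 2 <= B) ->
    forall N, \sum_(n < N) n%:R ^+ 4 * om n * (Y n - al n) ^+ 2 <= B / 16].
Proof.
have nd n : {homo (fun k => Yit k n) : k l / (k <= l)%N >-> k <= l}.
  by apply: homo_leq => [x//|x y z|k]; [exact: le_trans|exact: Yit_mono].
have bd n : exists M, forall k, Yit k n <= M.
  (* The weight n^4 controls nothing at frequency 0, but there the kernel vanishes and the iteration
     is constant. *)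
  case: n => [|n].
    exists (al 0%N) => -[|k]//=; rewrite /Qsum big1 ?mulr0 ?addr0// => j _.
    by rewrite /ker mul0r mul0r !mul0r.
  exists (2 * A) => k; apply: le_sqr_le; first by rewrite mulr_ge0.
  have := Yit_A k n.+2; rewrite big_ord_recr/= => H.
  rewrite (_ : (2 * A) ^+ 2 = 4 * A ^+ 2); last by ring.
  apply: le_trans H; rewrite -[leLHS]add0r; apply: lerD.
    by apply: sumr_ge0 => i _; rewrite mulr1 mulr_ge0 ?sqr_ge0 ?exprn_ge0.
  by rewrite mulr1 ler_peMl ?sqr_ge0// exprn_ege1// ler1n.
have cv n : cvgn (fun k => Yit k n).
  apply: nondecreasing_is_cvgn; first exact: nd.
  by have [M HM] := bd n; exists M => _ [k _ <-].
pose Y n := limn (fun k => Yit k n).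
have leY k n : Yit k n <= Y n by exact: (nondecreasing_cvgn_le (nd n) (cv n) k).
have cvsum N (w f : nat -> R) : \sum_(n < N) w n * (Yit k n - f n) ^+ 2 @[k --> \oo] -->
    \sum_(n < N) w n * (Y n - f n) ^+ 2.
  elim: N => [|N IH].
    by rewrite big_ord0; under eq_fun do rewrite big_ord0; exact: cvg_cst.
  rewrite big_ord_recr/=; under eq_fun do rewrite big_ord_recr/=.
  apply: cvgD => //; apply: cvgM; first exact: cvg_cst.
  apply: (@cvg_comp _ _ _ (fun k => Yit k N - f N) (fun y => y ^+ 2)); last exact: exprn_continuous.
  by apply: cvgB; [exact: cv|exact: cvg_cst].
exists Y; split.
- by move=> n; exact: (leY 0%N).
- move=> J n.
  have c : al n + 2 * Qsum nu (Yit k) (Yit k) J n @[k --> \oo] --> al n + 2 * Qsum nu Y Y J n.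
    apply: cvgD; first exact: cvg_cst.
    apply: cvgM; first exact: cvg_cst.
    rewrite /Qsum; elim: J => [|J IH].
      by rewrite big_ord0; under eq_fun do rewrite big_ord0; exact: cvg_cst.
    rewrite big_ord_recr/=; under eq_fun do rewrite big_ord_recr/=.
    apply: cvgD => //; apply: cvgM; last exact: cv.
    by apply: cvgM; [exact: cvg_cst|exact: cv].
  rewrite -(cvg_lim _ c)//; apply: limr_le; first by apply/cvg_ex; eexists; exact: c.
  exists J => // k /= Jk; apply: le_trans (leY k.+1 n); rewrite /= lerD2l ler_wpM2l//.
  rewrite /Qsum (big_ord_widen k (fun j => ker nu n j * Yit k (n + j)%N * Yit k j))//.
  rewrite big_mkcond/=; apply: ler_sum => j _; case: ifP => // _.
  by apply: mulr_ge0; [apply: mulr_ge0; [exact: ker_ge0 nu0 _ _|exact: Yit_ge0]|exact: Yit_ge0].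
- move=> N; have c := cvsum N (fun n => n%:R ^+ 4) (fun=> 0).
  have <- : \sum_(n < N) n%:R ^+ 4 * (Y n - 0) ^+ 2 = \sum_(n < N) n%:R ^+ 4 * Y n ^+ 2.
    by apply: eq_bigr => n _; rewrite subr0.
  rewrite -(cvg_lim _ c)//; apply: limr_le; first by apply/cvg_ex; eexists; exact: c.
  apply: nearW => k; rewrite (_ : (2 * A) ^+ 2 = 4 * A ^+ 2); last by ring.
  apply: le_trans (Yit_A k N).
  by apply: ler_sum => n _; rewrite subr0 mulr1.
- move=> om B om0 omm HB N; have c := cvsum N (fun n => n%:R ^+ 4 * om n) al.
  rewrite -(cvg_lim _ c)//; apply: limr_le; first by apply/cvg_ex; eexists; exact: c.
  by apply: nearW => k; exact: (Yit_om k om0 omm HB).2.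
Qed.

End Majorant.

(** * Duhamel's formula and comparison with supersolutions *)

Section Duhamel.
Context {R : realType}.
Implicit Types (F y U : R -> R) (l t T a G S : R).
Local Notation mu := (@lebesgue_measure R).

Lemma is_derive_expRl (l t : R) : is_derive t (1 : R) (fun s => expR (l * s)) (l * expR (l * t)).
Proof.
have h : is_derive t (1 : R) (fun s : R => l * s) l.
  by have := @is_deriveZ R R R id l t 1 1 _; rewrite /GRing.scale/= mulr1; apply; exact: is_derive_id.
rewrite mulrC; exact: (@is_derive1_comp R expR (fun s => l * s) t (expR (l * t)) l (is_derive_expR _) h).
Qed.

Lemma within_derive (h h' : R -> R) a b : (forall t : R, a <= t <= b -> is_derive t (1 : R) h (h' t)) ->
  {within `[a, b], continuous h}.
Proof.
move=> H; apply: continuous_in_subspaceT => t; rewrite inE/= in_itv/= => tab.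
have := H t tab => -[dt _]; apply: differentiable_continuous; exact/derivable1_diffP.
Qed.

Lemma prim_derive F a t : continuous F -> a < t ->
  is_derive t (1 : R) (fun s => \int[mu]_(x in `[a, s]) F x) (F t).
Proof.
move=> cF at_.
have [||d e] := @continuous_FTC1_closed R F a t (t + 1) _ _ at_ (cF t).
- by rewrite ltrDl.
- apply: continuous_compact_integrable; first exact: segment_compact.
  exact: continuous_subspaceT.
by rewrite -e derive1E; apply: DeriveDef => //.
Qed.

(* Starting the integrals at -1 makes the formula differentiable on both sides of t = 0. *)
Definition duh l a F t := expR (- l * t) * (a + (\int[mu]_(s in `[-1, t]) (expR (l * s) * F s)
   - \int[mu]_(s in `[-1, 0]) (expR (l * s) * F s))).

Lemma duh0 l a F : duh l a F 0 = a.
Proof. by rewrite /duh mulr0 expR0 mul1r subrr addr0. Qed.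

Lemma duh_derive l a F t : continuous F -> 0 <= t ->
  is_derive t (1 : R) (duh l a F) (- (l * duh l a F t) + F t).
Proof.
rewrite /duh; set k := (X in _ - X) => cF t0.
have ce : continuous (fun s : R => expR (l * s)).
  by apply: (@is_derive_continuous R _ (fun t => l * expR (l * t))) => x; exact: is_derive_expRl.
have cg : continuous (fun s => expR (l * s) * F s) by move=> s; exact: (@continuousM R R _ _ s (ce s) (cF s)).
have h1 := @prim_derive _ (-1) t cg _.
have {}h1 := h1 ltac:(exact: (lt_le_trans (ltrN10 _) t0)).
have h2 : is_derive t (1 : R) (fun s => a + (\int[mu]_(x in `[-1, s]) (expR (l * x) * F x) - k)) (expR (l * t) * F t).
  have h2a := @is_deriveB R R R (fun s => \int[mu]_(x in `[-1, s]) (expR (l * x) * F x)) (cst k) t 1 _ 0 h1 (is_derive_cst _ _ _).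
  by have := @is_deriveD R R R (cst a) _ t 1 0 _ (is_derive_cst _ _ _) h2a; rewrite add0r subr0.
have h3 := is_derive_expRl (- l) t.
have h4 := @is_deriveM R R (fun s => expR (- l * s)) _ t 1 _ _ h3 h2.
rewrite (_ : - (l * duh l a F t) + F t = expR (- l * t) *: (expR (l * t) * F t) +
  (a + (\int[mu]_(x in `[-1, t]) (expR (l * x) * F x) - k)) *: (- l * expR (- l * t)))//.
rewrite /duh -/k /GRing.scale/=.
have e1 : expR (- l * t) * expR (l * t) = 1 by rewrite -expRD mulNr addNr expR0.
by rewrite [expR (- l * t) * (_ * _)]mulrA e1; ring.
Qed.

(** With the integrating factor exp (l t), the difference y - U becomes a nonincreasing function. *)
Lemma supersol l T y U F U' : 0 <= T -> {within `[0, T], continuous y} -> {within `[0, T], continuous U} ->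
  (forall t, 0 < t < T -> is_derive t (1 : R) y (- (l * y t) + F t)) ->
  (forall t, 0 < t < T -> is_derive t (1 : R) U (U' t)) ->
  (forall t, 0 < t < T -> F t <= U' t + l * U t) -> y 0 <= U 0 -> y T <= U T.
Proof.
move=> T0 cy cU dy dU H h0.
pose w t := expR (l * t) * (y t - U t).
have dw t : 0 < t < T -> is_derive t (1 : R) w (expR (l * t) * (F t - (U' t + l * U t))).
  move=> tT.
  have h1 := @is_deriveB R R R y U t 1 _ _ (dy t tT) (dU t tT).
  have h4 := @is_deriveM R R (fun s => expR (l * s)) (fun s => y s - U s) t 1 _ _ (is_derive_expRl l t) h1.
  rewrite (_ : expR (l * t) * _ = expR (l * t) *: (- (l * y t) + F t - U' t) + (y t - U t) *: (l * expR (l * t)))//.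
  by rewrite /GRing.scale/=; ring.
have cw : {within `[0, T], continuous w}.
  have ce : {within `[0, T], continuous (fun s : R => expR (l * s))}.
    by apply: (@within_derive _ (fun t => l * expR (l * t))) => x _; exact: is_derive_expRl.
  by move=> t; exact: (@continuousM R (subspace `[0, T]) _ _ t (ce t) (@continuousB R R (subspace `[0, T]) _ _ t (cy t) (cU t))).
have : w T <= w 0.
  apply: (@ler0_derive1_le_cc R w 0 T) => //.
  - by move=> t; rewrite in_itv/= => tT; have [] := dw t tT.
  - move=> t; rewrite in_itv/= => tT; rewrite derive1E; have [_ ->] := dw t tT.
    by rewrite pmulr_rle0 ?expR_gt0// subr_le0 H.
  - by rewrite in_itv/= lexx T0.
  - by rewrite in_itv/= lexx.
rewrite /w mulr0 expR0 mul1r => h; rewrite -subr_le0 -(pmulr_rle0 _ (expR_gt0 (l * T))).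
by apply: le_trans h _; rewrite subr_le0.
Qed.

Lemma norm_supersol l T y U F U' : 0 <= T -> {within `[0, T], continuous y} -> {within `[0, T], continuous U} ->
  (forall t, 0 < t < T -> is_derive t (1 : R) y (- (l * y t) + F t)) ->
  (forall t, 0 < t < T -> is_derive t (1 : R) U (U' t)) ->
  (forall t, 0 < t < T -> `|F t| <= U' t + l * U t) -> `|y 0| <= U 0 -> `|y T| <= U T.
Proof.
move=> T0 cy cU dy dU H h0; rewrite ler_norml lerNl; apply/andP; split.
  apply: (@supersol l T (fun t => - y t) U (fun t => - F t) U') => //.
  - by move=> t; apply: continuousN; exact: cy.
  - move=> t tT; have := @is_deriveN R R R y t 1 _ (dy t tT).
    by rewrite opprD mulrN.
  - by move=> t tT; apply: le_trans (H t tT); rewrite -normrN ler_norm.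
  - by apply: le_trans h0; rewrite -normrN ler_norm.
apply: (@supersol l T y U F U') => //.
- by move=> t tT; apply: le_trans (H t tT); rewrite ler_norm.
- by apply: le_trans h0; rewrite ler_norm.
Qed.

(** Half of the linear rate: a forcing proportional to l [xp] stays off resonance, and its response
    is of the size of [xp] without a factor l t. *)
Definition xp l t := expR (- (l / 2) * t).

Lemma xp0 l : xp l 0 = 1. Proof. by rewrite /xp mulr0 expR0. Qed.
Lemma xp_gt0 l t : 0 < xp l t. Proof. exact: expR_gt0. Qed.
Lemma xp_le1 l t : 0 <= l -> 0 <= t -> xp l t <= 1.
Proof. by move=> l0 t0; rewrite -[leRHS]expR0 ler_expR mulNr oppr_le0 mulr_ge0// divr_ge0. Qed.
Lemma xp_mono l1 l2 t : l1 <= l2 -> 0 <= t -> xp l2 t <= xp l1 t.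
Proof. by move=> h t0; rewrite ler_expR ler_wpM2r// lerN2; lra. Qed.

Lemma is_derive_xp l t : is_derive t (1 : R) (xp l) (- (l / 2) * xp l t).
Proof. exact: is_derive_expRl. Qed.

(** The right-hand side is the exact solution of U' + l U = l G [xp] with U (0) = a, hence a
    supersolution for both y and - y. *)
Lemma decay_bound l T y F a G : 0 <= T -> {within `[0, T], continuous y} ->
  (forall t, 0 < t < T -> is_derive t (1 : R) y (- (l * y t) + F t)) ->
  (forall t, 0 < t < T -> `|F t| <= l * G * xp l t) -> `|y 0| <= a ->
  `|y T| <= a * xp l T ^+ 2 + 2 * G * (xp l T - xp l T ^+ 2).
Proof.
move=> T0 cy dy H h0.
have dU t : is_derive t (1 : R) (fun t => a * xp l t ^+ 2 + 2 * G * (xp l t - xp l t ^+ 2))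
   (a * (- l * xp l t ^+ 2) + 2 * G * (- (l / 2) * xp l t + l * xp l t ^+ 2)).
  have h1 := is_derive_xp l t.
  have h2 : is_derive t (1 : R) (fun t => xp l t ^+ 2) (- l * xp l t ^+ 2).
    have := @is_deriveM R R (xp l) (xp l) t 1 _ _ h1 h1.
    rewrite /GRing.scale/= (_ : xp l t * _ + _ = - l * xp l t ^+ 2)//.
    by field.
  have h3 := @is_deriveZ R R R _ a t 1 _ h2.
  have h4 := @is_deriveZ R R R _ (2 * G) t 1 _ (@is_deriveB R R R _ _ t 1 _ _ h1 h2).
  have := @is_deriveD R R R _ _ t 1 _ _ h3 h4.
  rewrite /GRing.scale/= (_ : - (l / 2) * xp l t - _ = - (l / 2) * xp l t + l * xp l t ^+ 2)//.
  by rewrite mulNr [- l * _]mulNr opprK.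
apply: (@norm_supersol l T y _ F) (_ : forall t, _ -> is_derive t (1:R) _ _) _ _ => //.
- by apply: within_derive => t _; exact: dU.
- move=> t tT; apply: le_trans (H t tT) _; rewrite [leRHS](_ : _ = l * G * xp l t)//.
  by field.
- by rewrite xp0 expr1n mulr1 subrr mulr0 addr0.
Qed.

Lemma const_bound l T y F S : 0 <= T -> {within `[0, T], continuous y} ->
  (forall t, 0 < t < T -> is_derive t (1 : R) y (- (l * y t) + F t)) ->
  (forall t, 0 < t < T -> `|F t| <= l * S) -> `|y 0| <= S -> `|y T| <= S.
Proof.
move=> T0 cy dy H h0.
apply: (@norm_supersol l T y (cst S) F (cst 0)) => //.
- by move=> t; exact: cst_continuous.
- by move=> t tT /=; rewrite add0r; exact: H.
Qed.

Lemma within_cont0 y T : (forall t : R, 0 <= t -> derivable y t 1) -> {within `[0, T], continuous y}.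
Proof.
move=> H; apply: continuous_in_subspaceT => t; rewrite inE/= in_itv/= => /andP[t0 _].
by apply: differentiable_continuous; exact/derivable1_diffP/H.
Qed.

End Duhamel.

Lemma subr_trans_eq {V : zmodType} (a b c : V) : a - c = (b - c) + (a - b).
Proof. by rewrite [RHS]addrC addrA subrK. Qed.

Lemma norm_lim_le {R : realType} (u : nat -> R) (l c e : R) : u k @[k --> \oo] --> l ->
  (exists N, forall k, (N <= k)%N -> `|u k - c| <= e) -> `|l - c| <= e.
Proof.
move=> ul [N H].
have cv : `|u k - c| @[k --> \oo] --> `|l - c|.
  by apply: cvg_norm; apply: cvgB => //; exact: cvg_cst.
rewrite -(cvg_lim _ cv)//; apply: limr_le; first by apply/cvg_ex; eexists; exact: cv.
by exists N => // k /= Nk; exact: H.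
Qed.

Lemma cauchy_tail_cvg {R : realType} (u : nat -> R) :
  (forall eps : R, 0 < eps -> exists N, forall k k', (N <= k)%N -> (k <= k')%N -> `|u k' - u k| <= eps) ->
  cvgn u.
Proof.
move=> H; apply/cauchy_cvgP/cauchy_ballP => eps e0.
have e2 : 0 < eps / 3 by rewrite divr_gt0.
have [N HN] := H _ e2.
pose S := [set x | exists2 k, (N <= k)%N & u k = x].
have fS : nbhs (u @ \oo) S by exists N => // k /= Nk; exists k.
exists (S, S); first by split.
move=> [_ _] [/= [i Ni <-] [j Nj <-]]; have h1 := HN N i (leqnn _) Ni; have h2 := HN N j (leqnn _) Nj.
rewrite /ball/= (_ : u i - u j = (u i - u N) - (u j - u N)); last by ring.
apply: le_lt_trans (ler_normB _ _) _; apply: le_lt_trans (lerD h1 h2) _; lra.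
Qed.

Lemma scale_tail {R : realType} (l eps : R) : 0 <= l -> 0 < eps ->
  0 < eps / (l + 1) /\ l * (eps / (l + 1)) <= eps.
Proof.
move=> l0 e0; have l1 : 0 < l + 1 by rewrite ltr_pwDr.
split; first by rewrite divr_gt0.
by rewrite mulrA ler_pdivrMr// mulrC; apply: ler_wpM2l; [exact: ltW|rewrite lerDl].
Qed.

(** * The truncated bilinear form *)

Section Bilinear.
Context {R : realType}.
Variable nu : R.
Hypothesis nu0 : 0 < nu.
Implicit Types (z : bool -> nat -> R) (X D : nat -> R).
Local Notation lam := (lam nu).
Local Notation ker := (ker nu).

(** The cosine and sine equations differ by a sign and an exchange of the two families. This sign,
    together with negation of the Boolean index, merges them into one formula. *)
Definition sgb (b : bool) : R := if b then 1 else -1.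

(* [z true] and [z false] are the cosine and sine coefficients; those
   of d_x ([H, f] (nu Lambda^3 f + Lambda f)) are the limits of [Bn] as J tends to
   infinity. *)
Definition Bterm z (b : bool) n j : R :=
  lam j * (z b (n + j)%N * z true j + sgb b * (z (~~ b) (n + j)%N * z false j)).
Definition Bn z (b : bool) (J n : nat) : R := n%:R / pi * \sum_(j < J) Bterm z b n j.

Lemma norm_sgb b : `|sgb b| = 1.
Proof. by case: b; rewrite /sgb ?normrN normr1. Qed.

Lemma pi2_le1 : 2 / pi <= 1 :> R.
Proof. by rewrite ler_pdivrMr ?pi_gt0// mul1r pi_ge2. Qed.

Lemma Bn0 z b J : Bn z b J 0 = 0. Proof. by rewrite /Bn !mul0r. Qed.

(** Every frequency j contributes two products, and the resulting factor 2 is absorbed by 2 / pi <=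
    1. *)
Lemma norm_Bsum (t : nat -> R) (K : nat -> R) n (J J' : nat) : (J <= J')%N ->
  (forall j, `|t j| <= lam j * (2 * K j)) -> (forall j, 0 <= K j) ->
  `|n%:R / pi * \sum_(J <= j < J') t j| <= lam n * \sum_(J <= j < J') ker n j * K j.
Proof.
move=> JJ H K0; rewrite normrM ger0_norm; last by rewrite divr_ge0// pi_ge0.
apply: (@le_trans _ _ (n%:R / pi * \sum_(J <= j < J') lam j * (2 * K j))).
  apply: ler_wpM2l; first by rewrite divr_ge0// pi_ge0.
  by apply: le_trans (ler_norm_sum _ _ _) _; apply: ler_sum.
rewrite !mulr_sumr; apply: ler_sum => j _.
rewrite [leRHS]mulrA lam_ker//.
rewrite [leLHS](_ : _ = (n%:R * lam j * K j) * (2 / pi)); last first.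
  by have H1 (P : R) : n%:R / P * (lam j * (2 * K j)) = n%:R * lam j * K j * (2 / P); [move=> *; ring|exact: H1].
by apply: ler_piMr pi2_le1; apply: mulr_ge0 => //; apply: mulr_ge0 => //; exact: lam_ge0.
Qed.

(** The decay factor [x] is taken only from the coefficient at frequency n + j >= n. The coefficient
    at frequency j may decay more slowly, so only its size is used. *)
Lemma norm_BnT z X (x : R) b J J' n : (J <= J')%N -> 0 <= x -> (forall m, 0 <= X m) ->
  (forall c m, `|z c m| <= X m) -> (forall c m, (n <= m)%N -> `|z c m| <= X m * x) ->
  `|Bn z b J' n - Bn z b J n| <= lam n * (\sum_(J <= j < J') ker n j * X (n + j)%N * X j) * x.
Proof.
move=> JJ x0 X0 H1 H2; rewrite /Bn -mulrBr -!(big_mkord xpredT (Bterm z b n)) (big_cat_nat (leq0n J) JJ)/= [X in X - _]addrC addrK.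
apply: le_trans (@norm_Bsum _ (fun j => X (n + j)%N * x * X j) n J J' JJ _ _) _ => [j|j|].
- rewrite /Bterm normrM ger0_norm ?lam_ge0//; apply: ler_wpM2l; first exact: lam_ge0.
  rewrite mulr_natl mulr2n; apply: le_trans (ler_normD _ _) _; apply: lerD.
    by rewrite normrM; apply: ler_pM => //; apply: H2; exact: leq_addr.
  by rewrite normrM norm_sgb mul1r normrM; apply: ler_pM => //; apply: H2; exact: leq_addr.
- by rewrite mulr_ge0// mulr_ge0.
- rewrite -mulrA; apply: ler_wpM2l; first exact: lam_ge0.
  by rewrite mulr_suml; apply: ler_sum => j _; rewrite le_eqVlt; apply/orP; left; apply/eqP; ring.
Qed.

Lemma norm_Bn z X (x : R) b J n : 0 <= x -> (forall m, 0 <= X m) ->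
  (forall c m, `|z c m| <= X m) -> (forall c m, (n <= m)%N -> `|z c m| <= X m * x) ->
  `|Bn z b J n| <= lam n * Qsum nu X X J n * x.
Proof.
move=> x0 X0 H1 H2; have := norm_BnT b (leq0n J) x0 X0 H1 H2.
by rewrite /Qsum big_mkord [Bn z b 0 n]/Bn big_ord0 mulr0 subr0.
Qed.

(** Each difference of products is split so that exactly one factor is a difference; in both pieces
    the decay again comes from frequency n + j. *)
Lemma norm_BnB z z' X D (x : R) b J n : 0 <= x -> (forall m, 0 <= X m) -> (forall m, 0 <= D m) ->
  (forall c m, `|z c m| <= X m) -> (forall c m, (n <= m)%N -> `|z' c m| <= X m * x) ->
  (forall c m, `|z c m - z' c m| <= D m) -> (forall c m, (n <= m)%N -> `|z c m - z' c m| <= D m * x) ->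
  `|Bn z b J n - Bn z' b J n| <=
    lam n * (\sum_(j < J) ker n j * (`|D (n + j)%N| * `|X j| + `|X (n + j)%N| * `|D j|)) * x.
Proof.
move=> x0 X0 D0 Hz Hz' Hd Hdx; rewrite /Bn -mulrBr -sumrB.
rewrite -(big_mkord xpredT (fun j => Bterm z b n j - Bterm z' b n j)).
have T c d (j : nat) : `|z c (n + j)%N * z d j - z' c (n + j)%N * z' d j| <= (D (n + j)%N * X j + X (n + j)%N * D j) * x.
  rewrite [X in `|X|](_ : _ = (z c (n + j)%N - z' c (n + j)%N) * z d j + z' c (n + j)%N * (z d j - z' d j)); last by ring.
  apply: le_trans (ler_normD _ _) _; rewrite !normrM.
  rewrite [leRHS](_ : _ = (D (n + j)%N * x) * X j + (X (n + j)%N * x) * D j); last by ring.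
  by apply: lerD; apply: ler_pM => //; [apply: Hdx|apply: Hz']; exact: leq_addr.
apply: le_trans (@norm_Bsum _ (fun j => (D (n + j)%N * X j + X (n + j)%N * D j) * x) n 0 J (leq0n J) _ _) _ => [j|j|].
- rewrite /Bterm -mulrBr normrM ger0_norm ?lam_ge0//; apply: ler_wpM2l; first exact: lam_ge0.
  rewrite mulr_natl mulr2n.
  rewrite [X in `|X|](_ : _ = (z b (n + j)%N * z true j - z' b (n + j)%N * z' true j) +
     sgb b * (z (~~ b) (n + j)%N * z false j - z' (~~ b) (n + j)%N * z' false j)); last by ring.
  by apply: le_trans (ler_normD _ _) _; apply: lerD; rewrite // normrM norm_sgb mul1r.
- by apply: mulr_ge0 => //; apply: addr_ge0; apply: mulr_ge0.
- rewrite -mulrA; apply: ler_wpM2l; first exact: lam_ge0.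
  rewrite big_mkord mulr_suml; apply: ler_sum => j _.
  by rewrite !ger0_norm// mulrA.
Qed.

End Bilinear.

(** * Picard iteration for the coefficients *)

Section Picard.
Context {R : realType}.
Variables (nu A : R) (z0 : bool -> nat -> R) (Y : nat -> R).
Hypothesis nu0 : 0 < nu.
Let al n : R := `|z0 true n| + `|z0 false n|.
Hypothesis A0 : 0 <= A.
Hypothesis A64 : 64 * A <= 1.
Hypothesis z00 : forall b, z0 b 0%N = 0.
Hypothesis alY : forall n, al n <= Y n.
Hypothesis QY : forall J n, al n + 2 * Qsum nu Y Y J n <= Y n.
Hypothesis YA : forall N, \sum_(n < N) n%:R ^+ 4 * Y n ^+ 2 <= (2 * A) ^+ 2.
Local Notation lam := (lam nu).
Local Notation ker := (ker nu).
Implicit Types (b : bool) (k n m : nat) (t : R).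

(* Picard iteration, the k-th step keeping k terms of the nonlinearity. *)
Fixpoint it k b n (t : R) : R :=
  if k is k'.+1 then
    duh (lam n) (z0 b n) (fun s => Bn nu (fun c m => it k' c m s) b k' n) `|t|
  else 0.

Definition Fit k b n (t : R) : R := Bn nu (fun c m => it k c m t) b k n.

Let z0al b n : `|z0 b n| <= al n.
Proof. by case: b; rewrite /al ?lerDl ?lerDr. Qed.
Let al0 n : 0 <= al n. Proof. by rewrite /al addr_ge0. Qed.
Let Y0 n : 0 <= Y n. Proof. exact: le_trans (al0 n) (alY n). Qed.

Lemma continuous_mul (f g : R -> R) t : {for t, continuous f} -> {for t, continuous g} ->
  {for t, continuous (fun s => f s * g s)}.
Proof. by move=> cf cg; exact: continuousM. Qed.

Lemma continuous_add (f g : R -> R) t : {for t, continuous f} -> {for t, continuous g} ->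
  {for t, continuous (fun s => f s + g s)}.
Proof. by move=> cf cg; exact: continuousD. Qed.

Lemma continuous_cst (a : R) t : {for t, continuous (fun _ : R => a)}.
Proof. exact: cst_continuous. Qed.

Lemma continuous_Bn (z : bool -> nat -> R -> R) b J n : (forall c m, continuous (z c m)) ->
  continuous (fun t => Bn nu (fun c m => z c m t) b J n).
Proof.
move=> cz t; rewrite /Bn /Bterm.
pose T j (s : R) := lam j * (z b (n + j)%N s * z true j s + sgb b * (z (~~ b) (n + j)%N s * z false j s)).
have c1 j : {for t, continuous (T j)}.
  have h1 := @continuous_mul _ _ t (cz b (n + j)%N t) (cz true j t).
  have h2 := @continuous_mul _ _ t (cz (~~ b) (n + j)%N t) (cz false j t).
  have h3 := @continuous_mul _ _ t (@continuous_cst (sgb b) t) h2.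
  exact: (@continuous_mul _ _ t (@continuous_cst (lam j) t) (@continuous_add _ _ t h1 h3)).
have c2 : {for t, continuous (fun s => \sum_(j < J) T j s)}.
  elim: J => [|J IH].
    by rewrite (_ : (fun _ => _) = (fun _ => 0)); [exact: continuous_cst|apply/funext => s; rewrite big_ord0].
  rewrite (_ : (fun _ => _) = (fun s => \sum_(j < J) T j s + T J s)).
    exact: (@continuous_add _ _ t IH (c1 J)).
  by apply/funext => s; rewrite big_ord_recr.
exact: (@continuous_mul _ _ t (@continuous_cst (n%:R / pi) t) c2).
Qed.

Lemma continuous_duh l (a : R) F t : continuous F -> 0 <= t -> {for t, continuous (duh l a F)}.
Proof.
move=> cF t0; apply: differentiable_continuous; apply/derivable1_diffP.
by have [] := @duh_derive R l a F t cF t0.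
Qed.

(** The absolute value in [it] extends the iterates evenly to negative times. The forcing is thus
    continuous on the whole line, which suits the integrals of [duh] that start at -1. *)
Lemma continuous_it k b n : continuous (it k b n).
Proof.
elim: k b n => [|k IH] b n t; first exact: cst_continuous.
apply: (@continuous_comp _ _ _ (fun t : R => `|t|) (duh (lam n) (z0 b n) (Fit k b n))).
  exact: norm_continuous.
by apply: continuous_duh => //; exact: continuous_Bn.
Qed.

Lemma continuous_Fit k b n : continuous (Fit k b n).
Proof. by apply: continuous_Bn => c m; exact: continuous_it. Qed.

Lemma itS k b n t : 0 <= t -> it k.+1 b n t = duh (lam n) (z0 b n) (Fit k b n) t.
Proof. by move=> t0; rewrite /= ger0_norm. Qed.

Lemma duh_within l (a : R) F T : continuous F -> {within `[0, T], continuous (duh l a F)}.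
Proof. by move=> cF; apply: within_cont0 => t t0; have [] := @duh_derive R l a F t cF t0. Qed.

Lemma duh_bound n b (F : R -> R) (G : R) t : continuous F -> 0 <= t ->
  (forall s, 0 <= s -> `|F s| <= lam n * G * xp (lam n) s) ->
  `|duh (lam n) (z0 b n) F t| <= `|z0 b n| * xp (lam n) t ^+ 2 + 2 * G * (xp (lam n) t - xp (lam n) t ^+ 2).
Proof.
move=> cF t0 H.
have := @decay_bound R (lam n) t (duh (lam n) (z0 b n) F) F `|z0 b n| G t0 (@duh_within (lam n) (z0 b n) F t cF).
apply; [|by move=> s /andP[/ltW s0 _]; exact: H|by rewrite duh0].
by move=> s /andP[/ltW s0 _]; exact: duh_derive.
Qed.

(** As x^2 <= x, the profile is at most Y_n x. This coarser form is what the bilinear estimates take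
    as input. *)
Lemma zbound_xp b n t (y : R) : 0 <= t ->
  y <= `|z0 b n| * xp (lam n) t ^+ 2 + (Y n - al n) * (xp (lam n) t - xp (lam n) t ^+ 2) ->
  y <= Y n * xp (lam n) t.
Proof.
move=> t0 h; apply: le_trans h _.
have x0 := xp_gt0 (lam n) t; have x1 := xp_le1 (lam_ge0 nu0 n) t0.
have h1 := z0al b n; have h2 := alY n; have h3 := normr_ge0 (z0 b n).
move: (xp _ _) x0 x1 => x x0 x1.
have : `|z0 b n| * x ^+ 2 <= al n * x ^+ 2 by apply: ler_wpM2r => //; exact: sqr_ge0.
have : 0 <= (Y n - al n) * x ^+ 2 by rewrite mulr_ge0 ?sqr_ge0 ?subr_ge0.
have : al n * x ^+ 2 <= al n * x by apply: ler_wpM2l => //; rewrite expr2; apply: ler_piMl => //; exact: ltW.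
by lra.
Qed.

(** [QY] bounds the quadratic sum by (Y_n - al_n) / 2, the forcing whose response in [decay_bound]
    is the second part of the profile; so the bounds close. *)
Lemma Bn_xp (z : bool -> nat -> R) b J n t : 0 <= t -> (forall c m, `|z c m| <= Y m * xp (lam m) t) ->
  `|Bn nu z b J n| <= lam n * ((Y n - al n) / 2) * xp (lam n) t.
Proof.
move=> t0 H; have x0 := ltW (xp_gt0 (lam n) t).
apply: le_trans (@norm_Bn R nu nu0 z Y (xp (lam n) t) b J n x0 Y0 _ _) _.
- move=> c m; apply: le_trans (H c m) _; apply: ler_piMr => //.
  by apply: xp_le1 => //; exact: lam_ge0.
- move=> c m nm; apply: le_trans (H c m) _; apply: ler_wpM2l => //.
  by apply: xp_mono => //; exact: lam_mono.
apply: ler_wpM2r => //; apply: ler_wpM2l; first exact: lam_ge0.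
by have := QY J n; lra.
Qed.

Lemma it_bound k b n t : 0 <= t ->
  `|it k b n t| <= `|z0 b n| * xp (lam n) t ^+ 2 + (Y n - al n) * (xp (lam n) t - xp (lam n) t ^+ 2).
Proof.
elim: k b n t => [|k IH] b n t t0.
  have x0 := xp_gt0 (lam n) t; have x1 := xp_le1 (lam_ge0 nu0 n) t0.
  rewrite normr0; apply: addr_ge0; first by apply: mulr_ge0 => //; exact: sqr_ge0.
  by apply: mulr_ge0; rewrite subr_ge0// expr2; apply: ler_piMl => //; exact: ltW.
rewrite itS//; have := @duh_bound n b (Fit k b n) ((Y n - al n) / 2) t (@continuous_Fit k b n) t0.
have -> : 2 * ((Y n - al n) / 2) = Y n - al n by field.
apply => s s0.
by apply: Bn_xp => // c m; apply: zbound_xp => //; exact: IH.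
Qed.

Lemma it_le k b n t : 0 <= t -> `|it k b n t| <= Y n * xp (lam n) t.
Proof. by move=> t0; apply: zbound_xp => //; exact: it_bound. Qed.

(** Size of the k-th increment in sup n^2 |d_n|. Half of the previous size comes from the
    contraction, and [k'%:R * Y k'] from the term of the nonlinearity that the new step adds. *)
Fixpoint Mit k : R := if k is k'.+1 then Mit k' / 2 + k'%:R * Y k' else 2 * A.

Lemma Mit_ge0 k : 0 <= Mit k.
Proof. by elim: k => [|k IH] /=; [rewrite mulr_ge0|rewrite addr_ge0 ?divr_ge0// mulr_ge0]. Qed.

Lemma sum_Mit N : \sum_(k < N) Mit k <= 12 * A.
Proof.
have A20 : 0 <= 2 * A by rewrite mulr_ge0.
have h := sum_freq_le A20 YA.
case: N => [|N]; first by rewrite big_ord0 mulr_ge0.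
(* 12 A is the fixed point of s = 2 A + s / 2 + 4 A: the initial size, the halving, and the bound 4
   A on the sum of k Y_k. *)
have : \sum_(k < N) Mit k <= 12 * A -> \sum_(k < N.+1) Mit k <= 12 * A.
  rewrite big_ord_recl/= => IH.
  rewrite (eq_bigr (fun k : 'I_N => Mit k / 2 + k%:R * `|Y k|)); last by move=> i _; rewrite ger0_norm.
  rewrite big_split/= -mulr_suml; have := h N; move: IH.
  by move: (\sum_(i < N) Mit i) (\sum_(i < N) _) => a c; lra.
apply; elim: N => [|N IH]; first by rewrite big_ord0 mulr_ge0.
rewrite big_ord_recl/=.
rewrite (eq_bigr (fun k : 'I_N => Mit k / 2 + k%:R * `|Y k|)); last by move=> i _; rewrite ger0_norm.
rewrite big_split/= -mulr_suml; have := h N; move: IH.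
by move: (\sum_(i < N) Mit i) (\sum_(i < N) _) => a c; lra.
Qed.

Lemma Y_le n : n%:R ^+ 2 * Y n <= 2 * A.
Proof.
apply: le_sqr_le; first by rewrite mulr_ge0.
apply: le_trans (YA n.+1); rewrite big_ord_recr/= exprMn -exprM lerDr.
by apply: sumr_ge0 => i _; rewrite mulr_ge0 ?sqr_ge0// exprn_ge0.
Qed.

Let sqV n : (n%:R ^+ 2)^-1 <= 1 :> R.
Proof.
case: n => [|n]; first by rewrite expr0n/= invr0.
by rewrite invf_le1 ?exprn_gt0 ?ltr0n// expr_ge1// ler1n.
Qed.

Let from_sq n (K c : R) : n%:R ^+ 2 * K <= c -> lam n * K <= lam n * ((n%:R ^+ 2)^-1 * c).
Proof.
case: n => [|n] h; first by rewrite lam0 !mul0r.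
apply: ler_wpM2l; first exact: lam_ge0.
by rewrite ler_pdivlMl// exprn_gt0 ?ltr0n.
Qed.

Let DM (M : R) m : 0 <= M -> m%:R ^+ 2 * `|(m%:R ^+ 2)^-1 * M| <= M.
Proof.
move=> M0; rewrite ger0_norm; last by rewrite mulr_ge0// invr_ge0 sqr_ge0.
case: m => [|m]; first by rewrite expr0n/= mul0r.
by rewrite mulVKf// expf_neq0// pnatr_eq0.
Qed.

Lemma Bn_diff (z z' : bool -> nat -> R) (M : R) b J n t : 0 <= t -> 0 <= M ->
  (forall c m, `|z c m| <= Y m * xp (lam m) t) -> (forall c m, `|z' c m| <= Y m * xp (lam m) t) ->
  (forall c m, `|z c m - z' c m| <= (m%:R ^+ 2)^-1 * M * xp (lam m) t) ->
  `|Bn nu z b J n - Bn nu z' b J n| <= lam n * ((n%:R ^+ 2)^-1 * (12 * A * M)) * xp (lam n) t.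
Proof.
move=> t0 M0 Hz Hz' Hd; pose D m := (m%:R ^+ 2)^-1 * M.
have D0 m : 0 <= D m by rewrite mulr_ge0// invr_ge0 sqr_ge0.
have x0 := ltW (xp_gt0 (lam n) t).
have xm m : (n <= m)%N -> xp (lam m) t <= xp (lam n) t by move=> nm; apply: xp_mono => //; exact: lam_mono.
have x1 m : xp (lam m) t <= 1 by apply: xp_le1 => //; exact: lam_ge0.
apply: le_trans (@norm_BnB R nu nu0 z z' Y D (xp (lam n) t) b J n x0 Y0 D0 _ _ _ _) _.
- by move=> c m; apply: le_trans (Hz c m) _; exact: ler_piMr.
- by move=> c m nm; apply: le_trans (Hz' c m) _; apply: ler_wpM2l => //; exact: xm.
- by move=> c m; apply: le_trans (Hd c m) _; apply: ler_piMr => //; exact: D0.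
- by move=> c m nm; apply: le_trans (Hd c m) _; apply: ler_wpM2l; [exact: D0|exact: xm].
apply: ler_wpM2r => //; apply: from_sq.
have A20 : 0 <= 2 * A by rewrite mulr_ge0.
have := @ker_diff R nu nu0 Y D J (2 * A) M n A20 M0 YA (fun m => DM m M0).
by rewrite (_ : 6 * (2 * A) * M = 12 * A * M)//; ring.
Qed.

(** The difference splits into the term added to the truncation, of size 2 A k Y_k, and the change
    of iterate, of size 12 A [Mit k]. As 64 A <= 1, these are below k Y_k / 2 and [Mit k] / 4. *)
Lemma Fit_step k n b t : 0 <= t ->
  (forall c m, `|it k.+1 c m t - it k c m t| <= (m%:R ^+ 2)^-1 * Mit k * xp (lam m) t) ->
  `|Fit k.+1 b n t - Fit k b n t| <= lam n * ((n%:R ^+ 2)^-1 * (Mit k.+1 / 2)) * xp (lam n) t.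
Proof.
move=> t0 IH; have x0 := ltW (xp_gt0 (lam n) t).
rewrite /Fit (subr_trans_eq _ (Bn nu (fun c m => it k.+1 c m t) b k n)) addrC.
apply: le_trans (ler_normD _ _) _.
apply: le_trans (lerD (_ : _ <= lam n * ((n%:R ^+ 2)^-1 * (2 * A * (k%:R * Y k))) * xp (lam n) t)
   (@Bn_diff _ _ (Mit k) b k n t t0 (Mit_ge0 k) _ _ IH)) _.
- apply: le_trans (@norm_BnT R nu nu0 _ Y (xp (lam n) t) b k k.+1 n (leqnSn k) x0 Y0 _ _) _.
  + move=> c m; apply: le_trans (it_le _ _ _ t0) _; apply: ler_piMr => //.
    by apply: xp_le1 => //; exact: lam_ge0.
  + move=> c m nm; apply: le_trans (it_le _ _ _ t0) _; apply: ler_wpM2l => //.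
    by apply: xp_mono => //; exact: lam_mono.
  apply: ler_wpM2r => //; rewrite big_nat1; apply: from_sq.
  apply: (@le_trans _ _ (((n + k)%:R ^+ 2 * k%:R) * Y (n + k)%N * Y k)).
    rewrite [leLHS](_ : _ = n%:R ^+ 2 * ker n k * Y (n + k)%N * Y k); last by ring.
    by apply: ler_wpM2r => //; apply: ler_wpM2r => //; exact: ker_le.
  have h := Y_le (n + k)%N.
  rewrite [leLHS](_ : _ = ((n + k)%:R ^+ 2 * Y (n + k)%N) * (k%:R * Y k)); last by ring.
  by apply: ler_wpM2r => //; rewrite mulr_ge0.
- by move=> c m; exact: it_le.
- by move=> c m; exact: it_le.
rewrite -mulrDl -mulrDr -mulrDr; apply: ler_wpM2r => //; apply: ler_wpM2l; first exact: lam_ge0.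
apply: ler_wpM2l; first by rewrite invr_ge0 sqr_ge0.
have M0 := Mit_ge0 k; have kY : 0 <= k%:R * Y k by rewrite mulr_ge0.
rewrite [Mit k.+1]/=; move: (Mit k) (k%:R * Y k) M0 kY => M y M0 y0.
have : 0 <= (1 - 64 * A) * M by rewrite mulr_ge0 ?subr_ge0.
have : 0 <= (1 - 64 * A) * y by rewrite mulr_ge0 ?subr_ge0.
by lra.
Qed.

Lemma it_step k n b t : 0 <= t ->
  `|it k.+1 b n t - it k b n t| <= (n%:R ^+ 2)^-1 * Mit k * xp (lam n) t.
Proof.
elim: k n b t => [|k IH] n b t t0.
  rewrite subr0; have x0 := xp_gt0 (lam n) t; have x1 := xp_le1 (lam_ge0 nu0 n) t0.
  case: n x0 x1 => [|n] x0 x1; last first.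
    apply: le_trans (@it_le 1 b n.+1 t t0) _; apply: ler_wpM2r; first exact: ltW.
    by rewrite ler_pdivlMl ?exprn_gt0 ?ltr0n//; exact: Y_le.
  (* At frequency 0 the right-hand side is 0, again because 0^-1 = 0, so the iterate has to vanish
     exactly. This is where the zero mean enters. *)
  apply: le_trans (@it_bound 1 b 0%N t t0) _.
  by rewrite z00 normr0 lam0 /xp !mul0r oppr0 mul0r expR0 expr1n subrr mulr0 expr0n/= invr0 !mul0r addr0.
have x0 := xp_gt0 (lam n) t; have x1 := xp_le1 (lam_ge0 nu0 n) t0.
pose G := (n%:R ^+ 2)^-1 * (Mit k.+1 / 2).
have G0 : 0 <= G by rewrite mulr_ge0 ?invr_ge0 ?sqr_ge0// divr_ge0// Mit_ge0.
have H := @decay_bound R (lam n) t (fun s => duh (lam n) (z0 b n) (Fit k.+1 b n) s - duh (lam n) (z0 b n) (Fit k b n) s)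
  (fun s => Fit k.+1 b n s - Fit k b n s) 0 G t0.
rewrite !itS//; apply: le_trans (H _ _ _ _) _.
- by move=> s; apply: continuousB; apply: duh_within; exact: continuous_Fit.
- move=> s /andP[/ltW s0 _].
  have := @is_deriveB R R R _ _ s 1 _ _ (@duh_derive R (lam n) (z0 b n) (Fit k.+1 b n) s (@continuous_Fit _ _ _) s0)
    (@duh_derive R (lam n) (z0 b n) (Fit k b n) s (@continuous_Fit _ _ _) s0).
  by rewrite (_ : - (lam n * _) + _ - _ = - (lam n * (duh (lam n) (z0 b n) (Fit k.+1 b n) s - duh (lam n) (z0 b n) (Fit k b n) s)) +
    (Fit k.+1 b n s - Fit k b n s))//; ring.
- by move=> s /andP[/ltW s0 _]; apply: Fit_step => // c m; exact: IH.
- by rewrite !duh0 subrr normr0.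
have -> : 2 * G = (n%:R ^+ 2)^-1 * Mit k.+1 by rewrite /G; move: (_^-1) => v; field.
rewrite mul0r add0r.
apply: ler_wpM2l; first by rewrite mulr_ge0 ?invr_ge0 ?sqr_ge0// Mit_ge0.
by rewrite gerBl sqr_ge0.
Qed.

Lemma it_tail (eps : R) : 0 < eps -> exists N, forall k k' b n t, (N <= k)%N -> (k <= k')%N -> 0 <= t ->
  `|it k' b n t - it k b n t| <= (n%:R ^+ 2)^-1 * eps * xp (lam n) t.
Proof.
move=> e0; have [N HN] := tail_small Mit_ge0 sum_Mit e0; exists N => k k' b n t Nk kk' t0.
apply: (@le_trans _ _ ((n%:R ^+ 2)^-1 * (\sum_(i < k') Mit i - \sum_(i < k) Mit i) * xp (lam n) t)); last first.
  apply: ler_wpM2r; first exact: ltW (xp_gt0 _ _).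
  by apply: ler_wpM2l; [rewrite invr_ge0 sqr_ge0|exact: HN].
elim: k' kk' => [|k' IH].
  by rewrite leqn0 => /eqP ->; rewrite !subrr normr0 mulr0 mul0r.
rewrite leq_eqVlt => /predU1P[->|/IH{}IH]; first by rewrite !subrr normr0 mulr0 mul0r.
rewrite (subr_trans_eq _ (it k' b n t)).
apply: le_trans (ler_normD _ _) _; apply: le_trans (lerD IH (it_step k' n b t0)) _.
by rewrite big_ord_recr/= -mulrDl -mulrDr [X in _ * X * _ <= _]addrAC.
Qed.

Lemma Fit_tail (eps : R) : 0 < eps -> exists N, forall k k' b n t, (N <= k)%N -> (k <= k')%N -> 0 <= t ->
  `|Fit k' b n t - Fit k b n t| <= lam n * eps.
Proof.
move=> e0; have [N HN] := tail_small Mit_ge0 sum_Mit e0; exists N => k k' b n t Nk kk' t0.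
apply: (@le_trans _ _ (lam n * (\sum_(i < k'.+1) Mit i - \sum_(i < k.+1) Mit i))); last first.
  apply: ler_wpM2l; first exact: lam_ge0.
  by apply: HN; [exact: leqW|].
elim: k' kk' => [|k' IH].
  by rewrite leqn0 => /eqP ->; rewrite !subrr normr0 mulr0.
rewrite leq_eqVlt => /predU1P[->|/IH{}IH]; first by rewrite !subrr normr0 mulr0.
rewrite (subr_trans_eq _ (Fit k' b n t)).
apply: le_trans (ler_normD _ _) _.
have h : `|Fit k'.+1 b n t - Fit k' b n t| <= lam n * Mit k'.+1.
  apply: le_trans (@Fit_step k' n b t t0 (fun c m => @it_step k' m c t t0)) _.
  rewrite -mulrA; apply: ler_wpM2l; first exact: lam_ge0.
  have M0 := Mit_ge0 k'.+1; have v0 : 0 <= (n%:R ^+ 2)^-1 :> R by rewrite invr_ge0 sqr_ge0.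
  have x0 := ltW (xp_gt0 (lam n) t); have x1 := xp_le1 (lam_ge0 nu0 n) t0.
  apply: (@le_trans _ _ (Mit k'.+1 / 2)); last by move: (Mit _) M0 => M; lra.
  have M2 : 0 <= Mit k'.+1 / 2 by rewrite divr_ge0.
  move: (Mit k'.+1 / 2) M2 => M M2; apply: (@le_trans _ _ ((n%:R ^+ 2)^-1 * M)).
    by apply: ler_piMr => //; exact: mulr_ge0.
  by apply: ler_piMl => //; exact: sqV.
apply: le_trans (lerD IH h) _.
by rewrite [X in _ <= lam n * (X - _)]big_ord_recr/= -mulrDr [X in _ * X <= _]addrAC.
Qed.

Lemma it_norm k b n t : it k b n `|t| = it k b n t.
Proof. by case: k => [//|k]; rewrite /= normr_id. Qed.

Lemma Fit_norm k b n t : Fit k b n `|t| = Fit k b n t.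
Proof. by rewrite /Fit; congr Bn; apply/funext => c; apply/funext => m; exact: it_norm. Qed.

(** The limit is taken on the forcing, and the solution is then defined by Duhamel's formula. It is
    thus differentiable by construction, and [it_cvg] identifies it with the limit of the
    iterates. *)
Definition Fl b n t : R := limn (fun k => Fit k b n t).
Definition zl b n t : R := duh (lam n) (z0 b n) (Fl b n) t.

Lemma Fit_cvg b n t : Fit k b n t @[k --> \oo] --> Fl b n t.
Proof.
apply: cauchy_tail_cvg => eps e0.
have [e1 e2] := scale_tail (lam_ge0 nu0 n) e0.
have [N HN] := Fit_tail e1; exists N => k k' h1 h2.
rewrite -![Fit _ b n t]Fit_norm; apply: le_trans (HN k k' b n `|t| h1 h2 (normr_ge0 _)) e2.
Qed.

Lemma Fl_tail (eps : R) : 0 < eps -> exists N, forall k b n t, (N <= k)%N ->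
  `|Fl b n t - Fit k b n t| <= lam n * eps.
Proof.
move=> e0; have [N HN] := Fit_tail e0; exists N => k b n t Nk.
have := norm_lim_le (@Fit_cvg b n t); apply; exists k => k' kk'.
by rewrite -![Fit _ b n t]Fit_norm; exact: HN.
Qed.

Lemma continuous_Fl b n : continuous (Fl b n).
Proof.
move=> t; apply: (@unif_lim_continuous R (fun k => Fit k b n) (Fl b n) t).
  by move=> k; exact: continuous_Fit.
move=> eps e0.
have [e1 e2] := scale_tail (lam_ge0 nu0 n) e0.
have [N HN] := Fl_tail e1; exists N => k Nk s; rewrite distrC; apply: le_trans (HN k b n s Nk) e2.
Qed.

Lemma duh_diff l (a eps : R) (F G : R -> R) t : continuous F -> continuous G -> 0 <= t -> 0 <= eps ->
  (forall s, `|F s - G s| <= l * eps) -> `|duh l a F t - duh l a G t| <= eps.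
Proof.
move=> cF cG t0 e0 H.
have := @const_bound R l t (fun s => duh l a F s - duh l a G s) (fun s => F s - G s) eps t0; apply.
- by move=> s; apply: continuousB; exact: duh_within.
- move=> s /andP[/ltW s0 _].
  have := @is_deriveB R R R _ _ s 1 _ _ (@duh_derive R l a F s cF s0) (@duh_derive R l a G s cG s0).
  by rewrite (_ : - (l * _) + _ - _ = - (l * (duh l a F s - duh l a G s)) + (F s - G s))//; ring.
- by move=> s _; exact: H.
- by rewrite !duh0 subrr normr0.
Qed.

Lemma it_cvg b n t : 0 <= t -> it k b n t @[k --> \oo] --> zl b n t.
Proof.
move=> t0; rewrite -(cvg_shiftS (fun k => it k b n t)); apply/cvgrPdist_le => eps e0.
have [N HN] := Fl_tail e0; exists N => // k Nk.
change (`|zl b n t - it k.+1 b n t| <= eps).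
rewrite (itS k b n t0); apply: duh_diff => //; [exact: continuous_Fl|exact: continuous_Fit|exact: ltW|].
by move=> s; exact: HN.
Qed.

Lemma zl_tail (eps : R) : 0 < eps -> exists N, forall k b n t, (N <= k)%N -> 0 <= t ->
  `|zl b n t - it k b n t| <= (n%:R ^+ 2)^-1 * eps * xp (lam n) t.
Proof.
move=> e0; have [N HN] := it_tail e0; exists N => k b n t Nk t0.
by have := norm_lim_le (@it_cvg b n t t0); apply; exists k => k' kk'; exact: HN.
Qed.

Lemma Fl_bound b n t : 0 <= t -> `|Fl b n t| <= lam n * ((Y n - al n) / 2) * xp (lam n) t.
Proof.
move=> t0; rewrite -(subr0 (Fl b n t)); have := norm_lim_le (@Fit_cvg b n t); apply; exists 0%N => k _.
by rewrite subr0; apply: Bn_xp => // c m; exact: it_le.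
Qed.

Lemma zl_bound b n t : 0 <= t ->
  `|zl b n t| <= `|z0 b n| * xp (lam n) t ^+ 2 + (Y n - al n) * (xp (lam n) t - xp (lam n) t ^+ 2).
Proof.
move=> t0; rewrite -(subr0 (zl b n t)); have := norm_lim_le (@it_cvg b n t t0); apply; exists 0%N => k _.
by rewrite subr0; exact: it_bound.
Qed.

(** A diagonal argument: the series of the limit truncated at k is compared with the forcing of the
    k-th iterate, which has the same truncation, and the comparison is uniform by [zl_tail]. *)
Lemma Fl_series b n t : 0 <= t -> Bn nu (fun c m => zl c m t) b J n @[J --> \oo] --> Fl b n t.
Proof.
move=> t0; apply/cvgrPdist_le => eps e0.
have l1 : 0 < 2 * (lam n + 1) by rewrite mulr_gt0// ltr_pwDr// lam_ge0.
have e1 : 0 < eps / (2 * (lam n + 1)) by rewrite divr_gt0.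
have [N1 H1] := Fl_tail e1; have [N2 H2] := zl_tail e1; exists (maxn N1 N2) => // k /=.
rewrite geq_max => /andP[k1 k2]; rewrite (subr_trans_eq _ (Fit k b n t)).
apply: le_trans (ler_normD _ _) _; rewrite addrC.
set e := eps / _ in e1 H1 H2.
have b1 : lam n * e <= eps / 2.
  rewrite /e mulrA ler_pdivrMr// [leRHS](_ : _ = eps * (lam n + 1)); last by field.
  by rewrite mulrC; apply: ler_wpM2l; [exact: ltW|rewrite lerDl].
apply: le_trans (lerD (le_trans (H1 k b n t k1) b1) (_ : _ <= eps / 2)) _; last by rewrite -splitr.
apply: le_trans b1; rewrite distrC.
have Hz c m : `|zl c m t| <= Y m * xp (lam m) t by apply: zbound_xp => //; exact: zl_bound.
apply: le_trans (@Bn_diff _ _ e b k n t t0 (ltW e1) Hz (fun c m => it_le k c m t0) (fun c m => H2 k c m t k2 t0)) _.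
have x0 := ltW (xp_gt0 (lam n) t); have x1 := xp_le1 (lam_ge0 nu0 n) t0.
rewrite -mulrA; apply: ler_wpM2l; first exact: lam_ge0.
have a1 : 0 <= 12 * A by rewrite mulr_ge0.
have a2 : 0 <= 12 * A * e by rewrite mulr_ge0// ltW.
apply: (@le_trans _ _ (12 * A * e)).
  apply: (@le_trans _ _ ((n%:R ^+ 2)^-1 * (12 * A * e))).
    by apply: ler_piMr => //; apply: mulr_ge0 => //; rewrite invr_ge0 sqr_ge0.
  by apply: ler_piMl => //; exact: sqV.
by apply: ler_piMl; [exact: ltW|have := A64; lra].
Qed.

Lemma zl_derive b n t : 0 <= t -> is_derive t (1 : R) (zl b n) (- (lam n * zl b n t) + Fl b n t).
Proof. by move=> t0; apply: duh_derive => //; exact: continuous_Fl. Qed.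

Lemma zl_init b n : zl b n 0 = z0 b n.
Proof. exact: duh0. Qed.

End Picard.

(** The interface between the construction of the coefficients and its uses. It keeps the majorant
    along with the solution, since regularity, energy and domination are all read off from [Y]. *)
Record coef_solution {R : realType} (nu A : R) (z0 : bool -> nat -> R) (Y : nat -> R)
    (z F : bool -> nat -> R -> R) : Prop := CoefSolution {
  cs_Y_ge : forall n, `|z0 true n| + `|z0 false n| <= Y n;
  cs_Y_sum : forall N, \sum_(n < N) n%:R ^+ 4 * Y n ^+ 2 <= (2 * A) ^+ 2;
  cs_Y_om : forall (om : nat -> R) (B : R), (forall k, 0 <= om k) ->
    {homo om : m n / (m <= n)%N >-> m <= n} ->
    (forall N, \sum_(n < N) n%:R ^+ 4 * om n * (`|z0 true n| + `|z0 false n|) ^+ 2 <= B) ->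
    forall N, \sum_(n < N) n%:R ^+ 4 * om n * (Y n - (`|z0 true n| + `|z0 false n|)) ^+ 2 <= B / 16;
  cs_init : forall b n, z b n 0 = z0 b n;
  cs_derive : forall b n (t : R), 0 <= t -> is_derive t (1 : R) (z b n) (- (lam nu n * z b n t) + F b n t);
  cs_cont : forall b n, continuous (F b n);
  cs_series : forall b n (t : R), 0 <= t ->
    Bn nu (fun c m => z c m t) b J n @[J --> \oo] --> F b n t;
  cs_bound : forall b n (t : R), 0 <= t -> `|z b n t| <= `|z0 b n| * xp (lam nu n) t ^+ 2 +
    (Y n - (`|z0 true n| + `|z0 false n|)) * (xp (lam nu n) t - xp (lam nu n) t ^+ 2);
  cs_Fbound : forall b n (t : R), 0 <= t -> `|F b n t| <=
    lam nu n * ((Y n - (`|z0 true n| + `|z0 false n|)) / 2) * xp (lam nu n) t }.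

Lemma coef_solution_exists {R : realType} (nu A : R) (z0 : bool -> nat -> R) :
  0 < nu -> 0 <= A -> 64 * A <= 1 -> (forall b, z0 b 0%N = 0) ->
  (forall N, \sum_(n < N) n%:R ^+ 4 * (`|z0 true n| + `|z0 false n|) ^+ 2 <= A ^+ 2) ->
  exists Y z F, coef_solution nu A z0 Y z F.
Proof.
move=> nu0 A0 A64 z00 H.
have [Y [alY QY YA Yom]] := @majorant R nu (fun n => `|z0 true n| + `|z0 false n|) A nu0
  (fun n => addr_ge0 (normr_ge0 _) (normr_ge0 _)) A0 H A64.
exists Y.
exists (zl nu z0).
exists (Fl nu z0).
constructor.
- exact: alY.
- exact: YA.
- exact: Yom.
- move=> b n; exact: zl_init.
- move=> b n t t0; exact: (@zl_derive R nu A z0 Y nu0 A0 A64 z00 alY QY YA b n t t0).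
- move=> b n; exact: (@continuous_Fl R nu A z0 Y nu0 A0 A64 z00 alY QY YA b n).
- move=> b n t t0; exact: (@Fl_series R nu A z0 Y nu0 A0 A64 z00 alY QY YA b n t t0).
- move=> b n t t0; exact: (@zl_bound R nu A z0 Y nu0 A0 A64 z00 alY QY YA b n t t0).
- move=> b n t t0; exact: (@Fl_bound R nu A z0 Y nu0 A0 A64 z00 alY QY YA b n t t0).
Qed.

(** * Energy estimate for a single frequency *)

Section EnergyOne.
Context {R : realType}.
Local Notation mu := (@lebesgue_measure R).

Lemma is_derive_xp2 (l t : R) : is_derive t (1 : R) (fun t => xp l t ^+ 2) (- l * xp l t ^+ 2).
Proof.
have h1 := is_derive_xp l t.
have := @is_deriveM R R (xp l) (xp l) t 1 _ _ h1 h1.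
by rewrite /GRing.scale/= (_ : xp l t * _ + _ = - l * xp l t ^+ 2)//; field.
Qed.

Lemma is_derive_xp3 (l t : R) : is_derive t (1 : R) (fun t => xp l t ^+ 3) (- (3 / 2 * l) * xp l t ^+ 3).
Proof.
have := @is_deriveM R R (xp l) (fun t => xp l t ^+ 2) t 1 _ _ (is_derive_xp l t) (is_derive_xp2 l t).
by rewrite /GRing.scale/= (_ : xp l t * _ + _ = - (3 / 2 * l) * xp l t ^+ 3)//; field.
Qed.

(* Jensen: [(a x + b (1 - x))^2 <= a^2 x + b^2 (1 - x)], which makes the time integral explicit. *)
Lemma energy_one (l a ze t : R) (y : R -> R) : 0 <= l -> 0 <= a -> 0 <= ze -> 0 < t ->
  {within `[0, t], continuous y} ->
  (forall s, 0 <= s -> `|y s| <= a * xp l s ^+ 2 + ze * (xp l s - xp l s ^+ 2)) ->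
  y t ^+ 2 + l * (\int[mu]_(s in `[0, t]) y s ^+ 2) <=
    a ^+ 2 + (1 - xp l t ^+ 3) * ((ze ^+ 2 - a ^+ 2) / 3).
Proof.
move=> l0 a0 ze0 t0 cy H.
have H2 s : 0 <= s -> y s ^+ 2 <= (a ^+ 2 - ze ^+ 2) * xp l s ^+ 3 + ze ^+ 2 * xp l s ^+ 2.
  move=> s0; have := H s s0; have x0 := xp_gt0 l s; have x1 := xp_le1 l0 s0.
  move: (xp l s) x0 x1 => x x0 x1 h.
  have p0 : 0 <= a * x ^+ 2 + ze * (x - x ^+ 2) by exact: le_trans h.
  apply: (@le_trans _ _ ((a * x ^+ 2 + ze * (x - x ^+ 2)) ^+ 2)).
    by rewrite -(real_normK (num_real (y s))); rewrite lerXn2r ?nnegrE.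
  rewrite -subr_ge0 [leRHS](_ : _ = x ^+ 2 * (x * (1 - x) * (a - ze) ^+ 2)); last by ring.
  apply: mulr_ge0; first exact: sqr_ge0.
  by apply: mulr_ge0; [apply: mulr_ge0; [exact: ltW|rewrite subr_ge0]|exact: sqr_ge0].
have cpt : compact (`[0, t] : set R) by exact: segment_compact.
(* [g] is [l] times the convexity bound on y^2, and [G] is a primitive of it. *)
pose g s := (a ^+ 2 - ze ^+ 2) * (l * xp l s ^+ 3) + ze ^+ 2 * (l * xp l s ^+ 2).
pose G s := (a ^+ 2 - ze ^+ 2) * (- (2 / 3) * xp l s ^+ 3) + ze ^+ 2 * (- 1 * xp l s ^+ 2).
have dG (s : R) : is_derive s (1 : R) G (g s).
  have h3 := @is_deriveZ R R R _ (a ^+ 2 - ze ^+ 2) s 1 _ (@is_deriveZ R R R _ (- (2 / 3)) s 1 _ (is_derive_xp3 l s)).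
  have h2 := @is_deriveZ R R R _ (ze ^+ 2) s 1 _ (@is_deriveZ R R R _ (- 1) s 1 _ (is_derive_xp2 l s)).
  have := @is_deriveD R R R _ _ s 1 _ _ h3 h2.
  rewrite [X in is_derive _ _ _ X](_ : _ = g s)//.
  by rewrite /g /GRing.scale/=; field.
have cg : continuous g.
  have c2 : continuous (fun s => xp l s ^+ 2) by apply: is_derive_continuous => s; exact: is_derive_xp2.
  have c3 : continuous (fun s => xp l s ^+ 3) by apply: is_derive_continuous => s; exact: is_derive_xp3.
  move=> s; apply: (@continuous_add R (fun s => (a ^+ 2 - ze ^+ 2) * (l * xp l s ^+ 3)) (fun s => ze ^+ 2 * (l * xp l s ^+ 2))).
    exact: (continuous_mul (@continuous_cst R _ s) (continuous_mul (@continuous_cst R _ s) (c3 s))).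
  exact: (continuous_mul (@continuous_cst R _ s) (continuous_mul (@continuous_cst R _ s) (c2 s))).
have ig : mu.-integrable `[0, t] (EFin \o g).
  by apply: continuous_compact_integrable => //; exact: continuous_subspaceT.
have cy2 : {within `[0, t], continuous (fun s => y s ^+ 2)}.
  by move=> s; exact: (@continuousM R (subspace `[0, t]) _ _ s (cy s) (cy s)).
have iy : mu.-integrable `[0, t] (EFin \o (fun s => y s ^+ 2)) by exact: continuous_compact_integrable.
have FT : \int[mu]_(s in `[0, t]) g s = G t - G 0.
  have := @continuous_FTC2 R g G 0 t t0 (continuous_subspaceT cg) (derive_oo_LR 0 t dG) _.
  rewrite /Rintegral => ->//.
  by move=> s _; rewrite derive1E; have [_ ->] := dG s.
have L : l * (\int[mu]_(s in `[0, t]) y s ^+ 2) <= G t - G 0.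
  rewrite -FT -RintegralZl//; apply: le_Rintegral => //.
    have := @integrableZl _ _ R mu `[0, t] _ l (fun s => (y s ^+ 2)%:E) iy.
    by apply.
  move=> s; rewrite /= in_itv/= => /andP[s0 _].
  rewrite (_ : g s = l * ((a ^+ 2 - ze ^+ 2) * xp l s ^+ 3 + ze ^+ 2 * xp l s ^+ 2)); last by rewrite /g; ring.
  by apply: ler_wpM2l => //; exact: H2.
apply: le_trans (lerD (H2 t (ltW t0)) L) _.
by rewrite /G !xp0 le_eqVlt; apply/orP; left; apply/eqP; field.
Qed.

End EnergyOne.

(** * Summation of the energy estimate over the frequencies *)

Section EnergyAll.
Context {R : realType}.
Local Notation mu := (@lebesgue_measure R).
Variables (nu A : R) (z0 : bool -> nat -> R) (Y : nat -> R) (z F : bool -> nat -> R -> R).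
Hypothesis nu0 : 0 < nu.
Hypothesis cs : coef_solution nu A z0 Y z F.
Let al n : R := `|z0 true n| + `|z0 false n|.

Lemma cs_within b n T : {within `[0, T], continuous (z b n)}.
Proof. by apply: within_cont0 => t t0; have [] := cs_derive cs b n t0. Qed.

Lemma cs_xp b n (t : R) : 0 <= t -> `|z b n t| <= Y n * xp (lam nu n) t.
Proof. by move=> t0; apply: (@zbound_xp R nu z0 Y) => //; [exact: cs_Y_ge cs|exact: cs_bound cs _ _ _ t0]. Qed.

Lemma cs_Y0 n : 0 <= Y n.
Proof. by apply: le_trans (cs_Y_ge cs n); rewrite addr_ge0. Qed.

Definition Iz b n t := \int[mu]_(s in `[0, t]) z b n s ^+ 2.

Lemma Iz_ge0 b n t : 0 <= Iz b n t.
Proof. by apply: Rintegral_ge0 => s _; exact: sqr_ge0. Qed.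

Lemma coef_energy (S t : R) : 0 < t ->
  (forall N, \sum_(n < N) n%:R ^+ 4 * (z0 true n ^+ 2 + z0 false n ^+ 2) <= S) ->
  forall N, \sum_(n < N) n%:R ^+ 4 * ((z true n t ^+ 2 + z false n t ^+ 2) +
     lam nu n * (Iz true n t + Iz false n t)) <= S.
Proof.
move=> t0 HS N.
pose om n := 1 - xp (lam nu n) t ^+ 3.
have x0 n := xp_gt0 (lam nu n) t.
have x1 n : xp (lam nu n) t <= 1 by apply: xp_le1 (lam_ge0 nu0 n) (ltW t0).
have om0 n : 0 <= om n by rewrite subr_ge0 exprn_ile1// ltW.
have om1 n : om n <= 1 by rewrite gerBl exprn_ge0// ltW.
have omm : {homo om : m n / (m <= n)%N >-> m <= n}.
  move=> m n mn; rewrite lerD2l lerN2 lerXn2r ?nnegrE ?(ltW (x0 _))//.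
  by apply: xp_mono (ltW t0); exact: lam_mono.
pose e n := n%:R ^+ 4 * om n * (z0 true n ^+ 2 + z0 false n ^+ 2).
pose a2 n := n%:R ^+ 4 * (z0 true n ^+ 2 + z0 false n ^+ 2).
have n4 n : 0 <= n%:R ^+ 4 :> R by exact: exprn_ge0.
have e0 n : 0 <= e n.
  by apply: mulr_ge0; [exact: mulr_ge0|rewrite addr_ge0 ?sqr_ge0].
have ea n : e n <= a2 n.
  rewrite /e /a2 -mulrA mulrCA; apply: ler_piMl => //.
  by apply: mulr_ge0 => //; rewrite addr_ge0 ?sqr_ge0.
have eS M : \sum_(n < M) e n <= S by apply: le_trans (HS M); apply: ler_sum => i _; exact: ea.
have cE : cvgn (series e).
  apply: nondecreasing_is_cvgn.
    by apply/nondecreasing_seqP => n; rewrite /series/= big_nat_recr//= lerDl.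
  by exists S => _ [n _ <-]; rewrite /series/= big_mkord; exact: eS.
(* The gain has to be collected over all frequencies, since the loss is controlled only in sum and
   not mode by mode. *)
pose E := limn (series e).
have EM M : \sum_(n < M) e n <= E.
  rewrite -(big_mkord xpredT); apply: (@nondecreasing_cvgn_le R (series e)) => //.
  by apply/nondecreasing_seqP => n; rewrite /series/= big_nat_recr//= lerDl.
pose ze n := Y n - al n.
have ze0 n : 0 <= ze n by rewrite subr_ge0; exact: cs_Y_ge cs n.
(* The factor 2 comes from (|p| + |q|)^2 <= 2 (p^2 + q^2). *)
have HZ M : \sum_(n < M) n%:R ^+ 4 * om n * ze n ^+ 2 <= (2 * E) / 16.
  apply: (cs_Y_om cs) => // M'; apply: (@le_trans _ _ (2 * \sum_(n < M') e n)); last first.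
    by rewrite ler_pM2l.
  rewrite mulr_sumr; apply: ler_sum => n _.
  rewrite /e [leRHS]mulrCA; apply: ler_wpM2l; first exact: mulr_ge0.
  rewrite -[z0 true n ^+ 2](real_normK (num_real _)) -[z0 false n ^+ 2](real_normK (num_real _)).
  have := sqr_ge0 (`|z0 true n| - `|z0 false n|); lra.
pose L n := n%:R ^+ 4 * ((z true n t ^+ 2 + z false n t ^+ 2) + lam nu n * (Iz true n t + Iz false n t)).
have L0 n : 0 <= L n.
  apply: mulr_ge0 => //; apply: addr_ge0; first by rewrite addr_ge0 ?sqr_ge0.
  by apply: mulr_ge0; [exact: lam_ge0|rewrite addr_ge0 ?Iz_ge0].
have Ln n : L n <= a2 n + (2 / 3) * (n%:R ^+ 4 * om n * ze n ^+ 2) - e n / 3.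
  have H b := @energy_one R (lam nu n) `|z0 b n| (ze n) t (z b n) (lam_ge0 nu0 n) (normr_ge0 _) (ze0 n) t0
    (@cs_within b n t) (@cs_bound _ _ _ _ _ _ _ cs b n).
  have := lerD (H true) (H false); rewrite -/(Iz true n t) -/(Iz false n t).
  rewrite !real_normK ?num_real// -/(om n) => h.
  rewrite [leRHS](_ : _ = n%:R ^+ 4 * (z0 true n ^+ 2 + om n * ((ze n ^+ 2 - z0 true n ^+ 2) / 3) +
       (z0 false n ^+ 2 + om n * ((ze n ^+ 2 - z0 false n ^+ 2) / 3)))); last first.
    by rewrite /a2 /e; field.
  apply: ler_wpM2l => //; apply: le_trans h.
  by rewrite le_eqVlt; apply/orP; left; apply/eqP; ring.
(* Cosine and sine parts together lose (2/3) (2 E / 16) = E / 12, against a gain that tends to E / 3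
   as M grows. *)
have key M : (N <= M)%N -> \sum_(n < N) L n <= S + E / 12 - (\sum_(n < M) e n) / 3.
  move=> NM; apply: (@le_trans _ _ (\sum_(n < M) L n)).
    rewrite -(subnKC NM) big_split_ord/= lerDl; exact: sumr_ge0.
  apply: (@le_trans _ _ (\sum_(n < M) (a2 n + (2 / 3) * (n%:R ^+ 4 * om n * ze n ^+ 2) - e n / 3))).
    by apply: ler_sum => n _; exact: Ln.
  rewrite sumrB big_split/= -mulr_sumr -mulr_suml.
  by have := HS M; have := HZ M; lra.
have E0 : 0 <= E by apply: le_trans (EM 0%N); rewrite big_ord0.
apply: (@le_trans _ _ (S + E / 12 - E / 3)); last by lra.
have cv : S + E / 12 - series e M / 3 @[M --> \oo] --> S + E / 12 - E / 3.
  by apply: cvgB; [exact: cvg_cst|apply: cvgMl; exact: cE].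
rewrite -(cvg_lim _ cv)//; apply: limr_ge; first by apply/cvg_ex; eexists; exact: cv.
by exists N => // M /= NM; rewrite /series/= big_mkord; exact: key.
Qed.

End EnergyAll.

(** * Integrals of almost everywhere equal functions *)

Section IntegralAE.
Import HBSimple HBNNSimple.
Context d (T : measurableType d) {R : realType} (mu : {measure set T -> \bar R}).

(** A simple function below f, cut off on the null set, lies below g and keeps its integral. *)
Lemma le_integral_ae (f g : T -> \bar R) : (forall x, 0 <= f x)%E -> (forall x, 0 <= g x)%E ->
  {ae mu, forall x, f x = g x} -> (\int[mu]_x f x <= \int[mu]_x g x)%E.
Proof.
move=> f0 g0 [N [mN N0 sub]]; rewrite !ge0_integralTE//; apply: ge_ereal_sup => _ [h hf <-].
have mC : measurable (~` N) by exact: measurableC.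
pose h' := proj_nnsfun h mC.
have -> : sintegral mu h = sintegral mu h'.
  rewrite -!integralT_nnsfun; apply: ge0_ae_eq_integral => //.
  - exact/measurable_EFinP.
  - exact/measurable_EFinP.
  - by move=> x _; rewrite lee_fin.
  - by move=> x _; rewrite lee_fin.
  exists N; split => // x /= H; apply: contrapT => Nx; apply: H => _.
  by rewrite /h' /proj_nnsfun/= mindicE mem_set//= mulr1.
apply: ereal_sup_ubound; exists h' => // x.
rewrite /h' /proj_nnsfun/= mindicE; case: (boolP (x \in ~` N)) => xN; last by rewrite mulr0.
rewrite mulr1; apply: le_trans (hf x) _; suff -> : f x = g x by [].
by apply: contrapT => H; move: xN; rewrite inE; apply; exact: sub.
Qed.

(* No measurability is needed, the library's integral being a supremum over simple functions. *)
Lemma ae_integral_eq (D : set T) (f g : T -> \bar R) : {ae mu, forall x, D x -> f x = g x} ->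
  (\int[mu]_(x in D) f x = \int[mu]_(x in D) g x)%E.
Proof.
move=> H; rewrite integral_mkcond [RHS]integral_mkcond.
have H' : {ae mu, forall x, (f \_ D) x = (g \_ D) x}.
  by apply: aeS H => x; rewrite !patchE; case: ifPn => // /set_mem Dx; apply.
have E (a b : T -> \bar R) : (forall x, 0 <= a x)%E -> (forall x, 0 <= b x)%E ->
    {ae mu, forall x, a x = b x} -> (\int[mu]_x a x = \int[mu]_x b x)%E.
  move=> a0 b0 ab; apply/eqP; rewrite eq_le !le_integral_ae//.
  by apply: aeS ab => x ->.
rewrite integralE [RHS]integralE; congr (_ - _)%E; apply: E => //.
- by apply: aeS H' => x /= e; rewrite !funeposE e.
- by apply: aeS H' => x /= e; rewrite !funenegE e.
Qed.

Lemma ae_Rintegral_eq (D : set T) (f g : T -> R) : {ae mu, forall x, D x -> f x = g x} ->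
  \int[mu]_(x in D) f x = \int[mu]_(x in D) g x.
Proof.
move=> H; rewrite /Rintegral; congr fine; apply: ae_integral_eq.
by apply: aeS H => x e /e ->.
Qed.

End IntegralAE.

(** * Series of nonnegative terms and extended reals *)

Section Series.
Context {R : realType}.

Lemma nneseries_le (e : nat -> R) (B : R) : (forall k, 0 <= e k) ->
  (forall N, \sum_(k < N) e k <= B) -> (\sum_(k <oo) (e k)%:E <= B%:E)%E.
Proof.
move=> e0 H; apply: lime_le; first by apply: is_cvg_nneseries => n _ _; rewrite lee_fin.
by near=> N; rewrite /= sumEFin lee_fin big_mkord.
Unshelve. all: by end_near. Qed.

Lemma nneseries_ge (e : nat -> R) N : (forall k, 0 <= e k) ->
  ((\sum_(k < N) e k)%:E <= \sum_(k <oo) (e k)%:E)%E.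
Proof.
move=> e0; have := @nneseries_lim_ge R (fun k => (e k)%:E) xpredT 0 N.
by rewrite sumEFin big_mkord; apply => k _ _; rewrite lee_fin.
Qed.

Lemma nneseries_fin_bound (e : nat -> R) : (forall k, 0 <= e k) -> (\sum_(k <oo) (e k)%:E < +oo)%E ->
  exists S, 0 <= S /\ (\sum_(k <oo) (e k)%:E)%E = S%:E /\ forall N, \sum_(k < N) e k <= S.
Proof.
move=> e0 H; have h0 : (0 <= \sum_(k <oo) (e k)%:E)%E by apply: nneseries_ge0 => n _ _; rewrite lee_fin.
exists (fine (\sum_(k <oo) (e k)%:E)%E); split; first exact: fine_ge0.
have e1 : (\sum_(k <oo) (e k)%:E)%E = (fine (\sum_(k <oo) (e k)%:E)%E)%:E.
  by rewrite fineK// ge0_fin_numE.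
by split => // N; rewrite -lee_fin -e1 nneseries_ge.
Qed.

Lemma sobolev_norm_ge0 s (u : R -> R) : (0 <= sobolev_norm s u)%E.
Proof. exact: sqrte_ge0. Qed.

Lemma sqre_lty (x : \bar R) : (0 <= x)%E -> (x < +oo)%E = (x ^+ 2 < +oo)%E.
Proof. by case: x => [r| |]//= _; rewrite ?ltry// expe2 ?mulyy. Qed.

Lemma sqre_le (x y : \bar R) : (0 <= x)%E -> (0 <= y)%E -> (x ^+ 2 <= y ^+ 2)%E -> (x <= y)%E.
Proof. by move=> x0 y0; rewrite lee_sqr. Qed.

End Series.

(** * The solution as a function: regularity and energy inequality *)

Section Solution.
Context {R : realType}.
Implicit Types (s t T : R) (w : nat -> R).
Local Notation mu := (@lebesgue_measure R).
Local Notation intc u := (mu.-integrable (@circle R) (EFin \o u)).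
Variables (nu A : R) (z0 : bool -> nat -> R) (Y : nat -> R) (z F : bool -> nat -> R -> R).
Hypothesis nu0 : 0 < nu.
Hypothesis A0 : 0 <= A.
Hypothesis z00 : forall b, z0 b 0%N = 0.
Hypothesis cs : coef_solution nu A z0 Y z F.

Lemma cs_Y n b t : 0 <= t -> `|z b n t| <= Y n.
Proof.
move=> t0; apply: le_trans (cs_xp nu0 cs b n t0) _.
by apply: ler_piMr; [exact: cs_Y0 cs n|apply: xp_le1 => //; exact: lam_ge0].
Qed.

Lemma cs_z0 b t : 0 <= t -> z b 0%N t = 0.
Proof.
move=> t0; apply/eqP; rewrite -normr_le0.
apply: le_trans (cs_bound cs b 0%N t0) _.
by rewrite z00 normr0 lam0 /xp !mul0r oppr0 mul0r expR0 expr1n subrr mulr0 addr0.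
Qed.

Lemma sum_nY N : \sum_(n < N) n%:R * Y n <= 4 * A.
Proof.
have A20 : 0 <= 2 * A by rewrite mulr_ge0.
have := sum_freq_le A20 (cs_Y_sum cs) N.
rewrite (eq_bigr (fun n : 'I_N => n%:R * Y n)) => [|i _]; first by rewrite mulrA -natrM.
by rewrite ger0_norm//; exact: cs_Y0 cs i.
Qed.

Lemma sum_Y N : \sum_(n < N) Y n <= Y 0%N + 4 * A.
Proof.
case: N => [|N]; first by rewrite big_ord0 addr_ge0 ?(cs_Y0 cs)// mulr_ge0.
rewrite big_ord_recl lerD2l; apply: le_trans (sum_nY N.+1).
rewrite big_ord_recl/= mul0r add0r; apply: ler_sum => i _.
by apply: ler_peMl; [exact: cs_Y0 cs _|rewrite ler1n].
Qed.

Lemma abs_coef t : 0 <= t -> abs_summable (fun n => z true n t) (fun n => z false n t).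
Proof.
move=> t0; exists (2 * (Y 0%N + 4 * A)) => N.
apply: (@le_trans _ _ (2 * \sum_(n < N) Y n)); last by rewrite ler_pM2l// sum_Y.
rewrite mulr_sumr; apply: ler_sum => n _; rewrite mulr_natl mulr2n.
by apply: lerD; exact: cs_Y.
Qed.

(** At time 0 the given representative [f0] is kept, so that the datum is attained exactly; at later
    times the continuous sum of the series is taken. *)
Lemma realize (f0 : R -> R) : L2T f0 -> cc f0 =1 z0 true -> ss f0 =1 z0 false ->
  exists f : R -> R -> R, f 0 = f0 /\ forall t, 0 <= t ->
    [/\ L2T (f t), forall n, cc (f t) n = z true n t & forall n, ss (f t) n = z false n t].
Proof.
move=> lf cf sf.
have H (t : R) : exists u : R -> R, (t = 0 -> u = f0) /\ (0 <= t ->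
    [/\ L2T u, forall n, cc u n = z true n t & forall n, ss u n = z false n t]).
  have [->|tn0] := eqVneq t 0.
    by exists f0; split => // _; split => // n; rewrite (cs_init cs) ?cf ?sf.
  have [t0|_] := boolP (0 <= t); last by exists f0; split => // h; rewrite h eqxx in tn0.
  have [U [cU pU _ ccU ssU]] := abs_series (@cs_z0 false t t0) (abs_coef t0).
  exists U; split => [h|_]; first by rewrite h eqxx in tn0.
  by split => //; exact: continuous_L2T.
have [f Hf] := choice H; exists f; split; first by apply: (Hf 0).1.
by move=> t; exact: (Hf t).2.
Qed.

Variable f : R -> R -> R.
Hypothesis Hf : forall t, 0 <= t ->
    [/\ L2T (f t), forall n, cc (f t) n = z true n t & forall n, ss (f t) n = z false n t].

Definition sqz n t := z true n t ^+ 2 + z false n t ^+ 2.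

Lemma sqz_ge0 n t : 0 <= sqz n t. Proof. by rewrite addr_ge0 ?sqr_ge0. Qed.

Lemma sq_f n t : 0 <= t -> sq (f t) n = sqz n t.
Proof. by move=> t0; have [_ hc hs] := Hf t0; rewrite /sq hc hs. Qed.

Lemma f_int t : 0 <= t -> intc (f t).
Proof. by move=> t0; have [/L2T_int] := Hf t0. Qed.

Definition Phi (w : nat -> R) t : \bar R := (\sum_(n <oo) (w n * sqz n t)%:E)%E.

Lemma sobolev_norm_f s t : s != 0 -> 0 <= t ->
  (sobolev_norm s (f t) ^+ 2 = Phi (fun n => pi^-1 * n%:R `^ (2 * s))%R t)%E.
Proof.
move=> s0 t0; rewrite sobolev_norm_sqr//; last exact: f_int.
by apply: eq_eseriesr => n _; rewrite sq_f.
Qed.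

Lemma cs_continuous b n t : 0 <= t -> {for t, continuous (z b n)}.
Proof.
move=> t0; apply: differentiable_continuous; apply/derivable1_diffP.
by have [] := cs_derive cs b n t0.
Qed.

Lemma measurable_z b n : measurable_fun (`[0, +oo[ : set R) (z b n).
Proof.
apply: subspace_continuous_measurable_fun => //.
by apply: continuous_in_subspaceT => t; rewrite inE/= in_itv/= andbT; exact: cs_continuous.
Qed.

Lemma measurable_sqz (w : nat -> R) n : measurable_fun (`[0, +oo[ : set R) (fun t => (w n * sqz n t)%:E).
Proof.
apply/measurable_EFinP; apply: measurable_funM => //.
by apply: measurable_funD; apply: measurable_funM; exact: measurable_z.
Qed.

Lemma Phi_measurable (w : nat -> R) : (forall n, 0 <= w n) -> measurable_fun (`[0, +oo[ : set R) (Phi w).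
Proof.
move=> w0; apply: ge0_emeasurable_sum.
- by move=> k x _ _; rewrite lee_fin mulr_ge0// sqz_ge0.
- by move=> k _; exact: measurable_sqz.
Qed.

Lemma sub_halfline T : `[0, T] `<=` (`[0, +oo[ : set R).
Proof. by move=> t; rewrite /= !in_itv/= andbT => /andP[]. Qed.

Lemma Phi_int (w : nat -> R) T : (forall n, 0 <= w n) ->
  (\int[mu]_(t in `[0%R, T]) Phi w t = \sum_(n <oo) (w n * (Iz z true n T + Iz z false n T))%:E)%E.
Proof.
move=> w0; rewrite integral_nneseries//.
- apply: eq_eseriesr => n _.
  have i2 b : mu.-integrable (`[0, T] : set R) (EFin \o (fun t => z b n t ^+ 2)).
    apply: continuous_compact_integrable; first exact: segment_compact.
    by move=> s; have c := @cs_within _ _ _ _ _ _ _ cs b n T; exact: (@continuousM R (subspace `[0, T]) _ _ s (c s) (c s)).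
  have i1 : mu.-integrable (`[0, T] : set R) (EFin \o sqz n).
    by have := integrableD _ (i2 true) (i2 false); apply.
  rewrite -[LHS]fineK.
    congr EFin; transitivity (\int[mu]_(t in `[0, T]) (w n * sqz n t)); first by [].
    by rewrite RintegralZl// /sqz RintegralD.
  apply: integrable_fin_num => //.
  by have := @integrableZl _ _ R mu `[0, T] _ (w n) _ i1; apply.
- by move=> n; apply: measurable_funS (measurable_sqz w n) => //; exact: sub_halfline.
- by move=> n t _; rewrite lee_fin mulr_ge0// sqz_ge0.
Qed.

Variable S : R.
Hypothesis HS : forall N, \sum_(n < N) n%:R ^+ 4 * (z0 true n ^+ 2 + z0 false n ^+ 2) <= S.

Let piV : 0 <= pi^-1 :> R. Proof. by rewrite invr_ge0 pi_ge0. Qed.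

Lemma Phi_energy t : 0 < t ->
  (Phi (fun n => pi^-1 * n%:R ^+ 4)%R t + \int[mu]_(s in `[0%R, t]) Phi (fun n => pi^-1 * n%:R ^+ 4 * lam nu n)%R s
   <= (pi^-1 * S)%:E)%E.
Proof.
move=> t0; have w0 n : 0 <= pi^-1 * n%:R ^+ 4 :> R by rewrite mulr_ge0// exprn_ge0.
have w1 n : 0 <= pi^-1 * n%:R ^+ 4 * lam nu n by rewrite mulr_ge0// lam_ge0.
rewrite Phi_int// /Phi -nneseriesD; last 2 first.
- by move=> n _; rewrite lee_fin mulr_ge0// sqz_ge0.
- by move=> n _; rewrite lee_fin mulr_ge0// addr_ge0// Iz_ge0.
under eq_eseriesr do rewrite -EFinD.
apply: nneseries_le => [n|N].
  by rewrite addr_ge0// mulr_ge0 ?sqz_ge0// addr_ge0// Iz_ge0.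
apply: le_trans (ler_wpM2l piV (coef_energy nu0 cs t0 HS N)).
rewrite mulr_sumr; apply: ler_sum => n _; rewrite le_eqVlt; apply/orP; left; apply/eqP.
by rewrite /sqz; move: (pi^-1) => P; ring.
Qed.

Lemma sobolev_f s t : s != 0 -> 0 <= t ->
  (exists B, forall N, \sum_(n < N) n%:R `^ (2 * s) * sqz n t <= B) -> sobolev s (f t).
Proof.
move=> s0 t0 [B HB]; split.
- by have [] := Hf t0.
- by have [_ + _] := Hf t0 => /(_ 0%N); rewrite cc0 => ->; exact: cs_z0.
rewrite sqre_lty ?sobolev_norm_ge0// sobolev_norm_f//.
apply: (@le_lt_trans _ _ (pi^-1 * B)%:E); last exact: ltry.
apply: nneseries_le => [n|N]; first by rewrite !mulr_ge0 ?powR_ge0 ?sqz_ge0.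
apply: le_trans (ler_wpM2l piV (HB N)).
by rewrite mulr_sumr; apply: ler_sum => n _; rewrite mulrA.
Qed.

Lemma powR4 (n : nat) : (n%:R : R) `^ (2 * 2) = n%:R ^+ 4.
Proof. by rewrite -natrM powR_mulrn. Qed.

Lemma powR7 (n : nat) : (n%:R : R) `^ (2 * (7 / 2)) = n%:R ^+ 7.
Proof. by rewrite mulrCA divff// mulr1 powR_mulrn. Qed.

Lemma sqz_le n t : 0 <= t -> sqz n t <= 2 * Y n ^+ 2.
Proof.
move=> t0; rewrite mulr_natl mulr2n; apply: lerD.
  by rewrite -(real_normK (num_real _)) lerXn2r ?nnegrE ?(cs_Y0 cs) ?cs_Y.
by rewrite -(real_normK (num_real _)) lerXn2r ?nnegrE ?(cs_Y0 cs) ?cs_Y.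
Qed.

Lemma f_H2 t : 0 <= t -> sobolev 2 (f t).
Proof.
move=> t0; apply: sobolev_f => //; exists (2 * (2 * A) ^+ 2) => N.
apply: le_trans (ler_wpM2l _ (cs_Y_sum cs N)) => //; rewrite mulr_sumr; apply: ler_sum => n _.
by rewrite powR4 mulrCA; apply: ler_wpM2l; [exact: exprn_ge0|exact: sqz_le].
Qed.

(** High frequencies are controlled uniformly in time by the tail of the sum of n^4 Y_n^2, and the
    remaining finite sum is continuous. *)
Lemma f_continuous : C_sobolev 2 f.
Proof.
split => [|t0 t00]; first exact: f_H2.
pose D n t := (z true n t - z true n t0) ^+ 2 + (z false n t - z false n t0) ^+ 2.
have D0 n t : 0 <= D n t by rewrite addr_ge0 ?sqr_ge0.
have norm2 t : 0 <= t -> (sobolev_norm 2 (fun x => f t x - f t0 x)%R ^+ 2 =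
    \sum_(n <oo) (pi^-1 * n%:R ^+ 4 * D n t)%:E)%E.
  move=> tt0; have i1 := f_int tt0; have i2 := f_int t00.
  rewrite sobolev_norm_sqr//; last exact: intcB.
  apply: eq_eseriesr => n _; rewrite powR4; congr (_ * _)%:E.
  by rewrite /sq ccB// ssB//; have [_ -> ->] := Hf tt0; have [_ -> ->] := Hf t00.
have key (eps : R) : 0 < eps -> \forall t \near t0, 0 <= t ->
    (sobolev_norm 2 (fun x => f t x - f t0 x)%R <= eps%:E)%E.
  move=> e0; have e2 : 0 < eps ^+ 2 / 2 by rewrite divr_gt0// exprn_gt0.
  (* Each coefficient varies by at most 2 Y_n, and the squares of the two families add up to 8
     Y_n^2. *)
  pose e n := n%:R ^+ 4 * (8 * Y n ^+ 2).
  have n4 n : 0 <= n%:R ^+ 4 :> R by exact: exprn_ge0.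
  have he0 n : 0 <= e n by rewrite mulr_ge0// mulr_ge0// sqr_ge0.
  have heB N : \sum_(n < N) e n <= 8 * (2 * A) ^+ 2.
    rewrite (eq_bigr (fun n : 'I_N => 8 * (n%:R ^+ 4 * Y n ^+ 2))) => [|i _]; last by rewrite /e; ring.
    by rewrite -mulr_sumr ler_pM2l//; exact: cs_Y_sum cs N.
  have [N0 HN] := tail_small he0 heB e2.
  have De n t : 0 <= t -> n%:R ^+ 4 * D n t <= e n.
    move=> tt0; apply: ler_wpM2l => //.
    have h b : (z b n t - z b n t0) ^+ 2 <= 4 * Y n ^+ 2.
      rewrite (_ : 4 * _ = (Y n + Y n) ^+ 2); last by ring.
      rewrite -(real_normK (num_real _)) lerXn2r ?nnegrE ?addr_ge0 ?(cs_Y0 cs)//.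
      by apply: le_trans (ler_normB _ _) _; apply: lerD; exact: cs_Y.
    rewrite (_ : 8 * _ = 4 * Y n ^+ 2 + 4 * Y n ^+ 2); last by ring.
    exact: lerD (h true) (h false).
  have hc : {for t0, continuous (fun t => \sum_(n < N0) n%:R ^+ 4 * D n t)}.
    have cz b n : {for t0, continuous (fun t => (z b n t - z b n t0) * (z b n t - z b n t0))}.
      have c1 := continuous_add (@cs_continuous b n t0 t00) (@continuous_cst R (- z b n t0) t0).
      exact: (continuous_mul c1 c1).
    have cD n : {for t0, continuous (fun t => n%:R ^+ 4 * D n t)}.
      exact: (continuous_mul (@continuous_cst R (n%:R ^+ 4) t0) (continuous_add (cz true n) (cz false n))).
    elim: N0 {HN} => [|N0 IH].
      by rewrite (_ : (fun _ => _) = (fun _ => 0)); [exact: continuous_cst|apply/funext => s; rewrite big_ord0].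
    rewrite (_ : (fun _ => _) = (fun s => \sum_(n < N0) n%:R ^+ 4 * D n s + N0%:R ^+ 4 * D N0 s)).
      exact: (continuous_add IH (cD N0)).
    by apply/funext => s; rewrite big_ord_recr.
  have /cvgrPdist_le/(_ _ e2) := hc.
  rewrite big1 => [|i _]; last by rewrite /D !subrr expr0n/= addr0 mulr0.
  apply: filterS => t; rewrite sub0r normrN ger0_norm; last by apply: sumr_ge0 => i _; rewrite mulr_ge0.
  move=> h tt0; apply: sqre_le; [exact: sobolev_norm_ge0|by rewrite lee_fin ltW|].
  rewrite norm2// -EFin_expe; apply: nneseries_le => [n|N]; first by rewrite !mulr_ge0.
  have p1 : (pi^-1 : R) <= 1 by have := kap_le1 (R:=R) 1.
  apply: (@le_trans _ _ (\sum_(n < maxn N N0) n%:R ^+ 4 * D n t)).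
    apply: (@le_trans _ _ (\sum_(n < N) n%:R ^+ 4 * D n t)).
      apply: ler_sum => n _; rewrite -mulrA; apply: ler_piMl => //; exact: mulr_ge0.
    rewrite -(subnKC (leq_maxl N N0)) big_split_ord/= lerDl.
    by apply: sumr_ge0 => i _; rewrite mulr_ge0.
  rewrite -(subnKC (leq_maxr N N0)) big_split_ord/= [eps ^+ 2]splitr.
  apply: lerD => //; apply: le_trans (HN N0 (maxn N N0) (leqnn _) (leq_maxr _ _)).
  rewrite -[in leRHS](subnKC (leq_maxr N N0)) big_split_ord/= addrAC subrr add0r.
  by apply: ler_sum => i _; exact: De.
have wi (P : R -> Prop) : (\forall t \near t0, 0 <= t -> P t) ->
    \forall t \near within `[0, +oo[ (nbhs t0), P t.
  by move=> H; rewrite near_withinE; apply: filterS H => t H; rewrite /= in_itv/= andbT; exact: H.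
apply/fine_cvgP; split.
  apply: wi; apply: filterS (key 1 ltr01) => t H tt0.
  rewrite ge0_fin_numE ?sobolev_norm_ge0//; exact: le_lt_trans (H tt0) (ltry _).
apply/cvgrPdist_le => eps e0; apply: wi; apply: filterS (key eps e0) => t H tt0.
rewrite sub0r normrN ger0_norm ?fine_ge0 ?sobolev_norm_ge0//.
have h := H tt0; rewrite -lee_fin fineK// ge0_fin_numE ?sobolev_norm_ge0//.
exact: le_lt_trans h (ltry _).
Qed.

(** Parabolic smoothing: exp (s) >= 1 + s gives lam_n exp (- lam_n t / 2) <= 2 / t, so
    multiplication by lam_n keeps the coefficients in H^2 at positive times. *)
Lemma sqz_lam_bound t : 0 < t -> exists B, forall N, \sum_(n < N) n%:R ^+ 4 * lam nu n ^+ 2 * sqz n t <= B.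
Proof.
move=> t0; exists (2 * (4 / t ^+ 2) * (2 * A) ^+ 2) => N.
apply: le_trans (ler_wpM2l _ (cs_Y_sum cs N)); last by rewrite mulr_ge0// divr_ge0// sqr_ge0.
rewrite mulr_sumr; apply: ler_sum => n _.
have l0 := lam_ge0 nu0 n; have x0 := xp_gt0 (lam nu n) t.
have h b : lam nu n ^+ 2 * z b n t ^+ 2 <= 4 / t ^+ 2 * Y n ^+ 2.
  have h1 : `|lam nu n * z b n t| <= 2 / t * Y n.
    rewrite normrM (ger0_norm l0); apply: le_trans (ler_wpM2l l0 (cs_xp nu0 cs b n (ltW t0))) _.
    rewrite mulrCA mulrC; apply: ler_wpM2r; first exact: cs_Y0 cs n.
    rewrite ler_pdivlMr//.
    have -> : xp (lam nu n) t = (expR (lam nu n / 2 * t))^-1 by rewrite /xp mulNr expRN.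
    rewrite mulrAC ler_pdivrMr ?expR_gt0//.
    have := expR_ge1Dx (lam nu n / 2 * t).
    by have := expR_gt0 (lam nu n / 2 * t); lra.
  rewrite -exprMn -(real_normK (num_real _)) (_ : 4 / t ^+ 2 * _ = (2 / t * Y n) ^+ 2); last first.
    by field; rewrite gt_eqF.
  by rewrite lerXn2r// nnegrE// mulr_ge0 ?divr_ge0 ?(ltW t0)// (cs_Y0 cs).
have n4 : 0 <= n%:R ^+ 4 :> R by exact: exprn_ge0.
rewrite [leRHS](_ : _ = n%:R ^+ 4 * (4 / t ^+ 2 * Y n ^+ 2 + 4 / t ^+ 2 * Y n ^+ 2)); last by ring.
by rewrite -mulrA; apply: ler_wpM2l => //; rewrite /sqz mulrDr; exact: lerD.
Qed.

Lemma sqz0 t : 0 <= t -> sqz 0 t = 0.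
Proof. by move=> t0; rewrite /sqz !cs_z0// expr0n/= addr0. Qed.

Lemma sqz_bound (w : nat -> R) t (c : R) : 0 < t ->
  (forall n, (0 < n)%N -> `|w n| <= c * (n%:R ^+ 4 * lam nu n ^+ 2)) ->
  exists B, forall N, \sum_(n < N) w n * sqz n t <= B.
Proof.
move=> t0 H; have [B HB] := sqz_lam_bound t0; exists (`|c| * B) => N.
apply: le_trans (ler_wpM2l (normr_ge0 c) (HB N)); rewrite mulr_sumr; apply: ler_sum => -[[|n] i] _ /=.
  by rewrite sqz0 ?(ltW t0)// !mulr0.
rewrite mulrA; apply: ler_wpM2r; first exact: sqz_ge0.
have w0 : 0 <= n.+1%:R ^+ 4 * lam nu n.+1 ^+ 2 by rewrite mulr_ge0 ?sqr_ge0// exprn_ge0.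
by apply: le_trans (ler_norm _) _; apply: le_trans (H n.+1 isT) _; apply: ler_wpM2r => //; exact: ler_norm.
Qed.

Lemma lam_lower n : nu * n%:R ^+ 3 <= lam nu n /\ n%:R <= lam nu n.
Proof.
by rewrite /lam lerDl lerDr; split => //; rewrite mulr_ge0 ?exprn_ge0// ltW.
Qed.

Lemma f_H72 t : 0 < t -> sobolev (7 / 2) (f t).
Proof.
move=> t0; apply: sobolev_f => //; [exact: ltW|].
apply: (@sqz_bound (fun n => n%:R `^ (2 * (7 / 2))) t (nu^-1)) => // n n0; rewrite powR7 ger0_norm ?exprn_ge0//.
rewrite ler_pdivlMl//.
have [h1 h2] := lam_lower n; have n1 : 1 <= n%:R :> R by rewrite ler1n.
have x0 : 0 <= n%:R :> R by [].
rewrite [leLHS](_ : _ = n%:R ^+ 4 * (nu * n%:R ^+ 3 * 1)); last by ring.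
apply: ler_wpM2l; first exact: exprn_ge0.
rewrite expr2; apply: ler_pM => //; first by rewrite mulr_ge0 ?exprn_ge0// ltW.
exact: le_trans h2.
Qed.

Lemma f_L2 : L2_sobolev (7 / 2) f.
Proof.
have HR k : measurable_fun (`[0, +oo[ : set R) (fun t => complex.Re (fourier (f t) k)) /\
    measurable_fun (`[0, +oo[ : set R) (fun t => complex.Im (fourier (f t) k)).
  have E (g : R -> R) b n c : (forall t, 0 <= t -> g t = c * z b n t) ->
      measurable_fun (`[0, +oo[ : set R) g.
    move=> H; apply: (eq_measurable_fun (fun t => c * z b n t)).
      by move=> t; rewrite inE/= in_itv/= andbT => t0; rewrite H.
    by apply: measurable_funM => //; exact: measurable_z.
  pose ka : R := (Num.sqrt (pi *+ 2))^-1.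
  case: k => n; split.
  - by apply: (E _ true n ka) => t t0; rewrite fourier_nat/=; have [_ -> _] := Hf t0.
  - by apply: (E _ false n (- ka)) => t t0; rewrite fourier_nat/= mulNr; have [_ _ ->] := Hf t0.
  - by apply: (E _ true n.+1 ka) => t t0; rewrite fourier_neg ?f_int//=; have [_ -> _] := Hf t0.
  - by apply: (E _ false n.+1 ka) => t t0; rewrite fourier_neg ?f_int//=; have [_ _ ->] := Hf t0.
split => //.
  apply: aeS (ae_neq 0) => t tn0; rewrite le_eqVlt eq_sym (negPf tn0)/=; exact: f_H72.
pose w n : R := pi^-1 * n%:R `^ (2 * (7 / 2)).
have w0 n : 0 <= w n by rewrite mulr_ge0// powR_ge0.
rewrite (_ : (\int[mu]_(t in _) _)%E = (\int[mu]_(t in `[0%R, +oo[) Phi w t)%E); last first.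
  by apply: eq_integral => t; rewrite inE/= in_itv/= andbT => t0; exact: sobolev_norm_f.
have U : \bigcup_i `[(0 : R), i.+1%:R]%classic = `[0, +oo[%classic.
  apply/seteqP; split => t /=.
    by move=> [i _]; exact: sub_halfline.
  rewrite in_itv/= andbT => t0; exists (Num.truncn t) => //=.
  by rewrite in_itv/= t0/= ltW// truncnS_gt.
have S0 : 0 <= S by apply: le_trans (HS 0%N); rewrite big_ord0.
(* The energy bound is uniform in [T], and nu n^7 <= n^4 lam_n turns its dissipation into the
   H^(7/2) norm at the price of 1 / nu. *)
have bnd T : 0 < T -> (\int[mu]_(t in `[0%R, T]) Phi w t <= (nu^-1 * (pi^-1 * S))%:E)%E.
  move=> T0; rewrite Phi_int//; apply: nneseries_le => [n|N].
    by rewrite mulr_ge0// addr_ge0// Iz_ge0.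
  have := ler_wpM2l piV (coef_energy nu0 cs T0 HS N).
  have nuV : 0 <= nu^-1 by rewrite invr_ge0 ltW.
  move/(ler_wpM2l nuV); apply: le_trans.
  rewrite !mulr_sumr; apply: ler_sum => n _.
  have I0 : 0 <= Iz z true n T + Iz z false n T by rewrite addr_ge0// Iz_ge0.
  apply: (@le_trans _ _ (nu^-1 * (pi^-1 * (n%:R ^+ 4 * (lam nu n * (Iz z true n T + Iz z false n T)))))); last first.
    apply: ler_wpM2l => //; apply: ler_wpM2l => //; apply: ler_wpM2l; first exact: exprn_ge0.
    by rewrite lerDr; exact: sqz_ge0.
  rewrite ler_pdivlMl// /w powR7.
  rewrite [leLHS](_ : _ = pi^-1 * (n%:R ^+ 4 * ((nu * n%:R ^+ 3) * (Iz z true n T + Iz z false n T)))); last first.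
    by move: (pi^-1) => P; ring.
  apply: ler_wpM2l => //; apply: ler_wpM2l; first exact: exprn_ge0.
  by apply: ler_wpM2r => //; exact: (lam_lower n).1.
apply: (@le_lt_trans _ _ (nu^-1 * (pi^-1 * S))%:E); last exact: ltry.
rewrite -U; have mPhi := Phi_measurable w0.
have cv : (\int[mu]_(t in `[0%R, i.+1%:R]) Phi w t @[i --> \oo] -->
    \int[mu]_(t in \bigcup_i `[0%R, i.+1%:R]%classic) Phi w t)%E.
  apply: ge0_nondecreasing_set_cvg_integral.
  - apply/nondecreasing_seqP => i; rewrite subsetEset => t /=; rewrite !in_itv/= => /andP[-> h]/=.
    by apply: le_trans h _; rewrite ler_nat.
  - by [].
  - by move=> i; apply: measurable_funS mPhi => //; exact: sub_halfline.
  - move=> i t /=; rewrite in_itv/= => /andP[t0 _]; apply: nneseries_ge0 => n _ _.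
    by rewrite lee_fin mulr_ge0// sqz_ge0.
rewrite -(cvg_lim _ cv)//; apply: lime_le; first by apply/cvg_ex; eexists; exact: cv.
by near=> i; exact: bnd.
Unshelve. all: by end_near. Qed.

Lemma sobolev_Lambda r t : 0 < t -> (forall n, (0 < n)%N -> (n%:R : R) `^ r <= n%:R ^+ 2) ->
  (sobolev_norm 2 (Lambda r (f t)) ^+ 2 = Phi (fun n => pi^-1 * n%:R ^+ 4 * n%:R `^ r ^+ 2)%R t)%E.
Proof.
move=> t0 H; have [lf hc hs] := Hf (ltW t0).
have n1 n : (0 < n)%N -> 1 <= n%:R :> R by move=> ?; rewrite ler1n.
have [|lL hcL hsL] := @Lambda_spec R r (f t) lf.
  have [|B HB] := @sqz_bound (fun n => (n%:R `^ r) ^+ 2) t 1 t0; last first.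
    by exists B => N; apply: le_trans (HB N); apply: ler_sum => n _; rewrite sq_f//; exact: ltW.
  move=> n n0; rewrite mul1r ger0_norm ?sqr_ge0//.
  have h := H n n0; have h1 := n1 n n0; have [_ h2] := lam_lower n.
  apply: (@le_trans _ _ ((n%:R ^+ 2) ^+ 2)); first by rewrite lerXn2r// ?nnegrE ?powR_ge0.
  rewrite -exprM; apply: ler_peMr; first exact: exprn_ge0.
  by apply: exprn_ege1; exact: le_trans h2.
rewrite sobolev_norm_sqr//; last exact: L2T_int.
apply: eq_eseriesr => n _; congr EFin; rewrite powR4 /sq hcL hsL hc hs /sqz.
by move: (pi^-1) (_ `^ _) => P a; ring.
Qed.

Lemma f_energy t : 0 < t ->
  (sobolev_norm 2 (f t) ^+ 2
   + \int[mu]_(s in `[0%R, t])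
       (nu%:E * sobolev_norm 2 (Lambda (3 / 2) (f s)) ^+ 2
        + sobolev_norm 2 (Lambda (2^-1) (f s)) ^+ 2)
   <= (pi^-1 * S)%:E)%E.
Proof.
move=> t0; apply: le_trans (Phi_energy t0).
rewrite sobolev_norm_f//; last exact: ltW.
rewrite (_ : Phi _ t = Phi (fun n => pi^-1 * n%:R ^+ 4)%R t); last first.
  by apply: eq_eseriesr => n _; rewrite powR4.
apply: leeD => //; rewrite le_eqVlt; apply/orP; left; apply/eqP; apply: ae_integral_eq.
(* The time s = 0 is left out because [sobolev_Lambda] rests on the smoothing at positive times. *)
apply: aeS (ae_neq 0) => s sn0 hs; have s0 : 0 < s.
  by move: hs; rewrite /= in_itv/= le_eqVlt eq_sym (negPf sn0)/= => /andP[].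
have pw (r : R) : r <= 2 -> forall n, (0 < n)%N -> (n%:R : R) `^ r <= n%:R ^+ 2.
  by move=> r2 n n0; rewrite -powR_mulrn//; apply: ler_powR => //; rewrite ler1n.
have r1 : 3 / 2 <= 2 :> R by lra.
have r2 : 2^-1 <= 2 :> R by lra.
have e1 := @sobolev_Lambda (3 / 2) s s0 (pw _ r1).
have e2 := @sobolev_Lambda (2^-1) s s0 (pw _ r2).
transitivity (nu%:E * Phi (fun n => pi^-1 * n%:R ^+ 4 * n%:R `^ (3 / 2) ^+ 2)%R s +
   Phi (fun n => pi^-1 * n%:R ^+ 4 * n%:R `^ 2^-1 ^+ 2)%R s)%E.
  by rewrite -e1 -e2.
have g0 (r : R) n : (0 <= (pi^-1 * n%:R ^+ 4 * n%:R `^ r ^+ 2 * sqz n s)%:E)%E.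
  rewrite lee_fin; apply: mulr_ge0; last exact: sqz_ge0.
  by apply: mulr_ge0; [apply: mulr_ge0 => //; exact: exprn_ge0|exact: sqr_ge0].
rewrite /Phi -nneseriesZl//.
rewrite -nneseriesD; last 2 first.
- by move=> n _ _; apply: mule_ge0; [rewrite lee_fin ltW|exact: g0].
- by move=> n _ _; exact: g0.
apply: eq_eseriesr => n _; rewrite -EFinM -EFinD; congr EFin.
have x0 : 0 <= n%:R :> R by [].
have e3 : ((n%:R : R) `^ (3 / 2)) ^+ 2 = n%:R ^+ 3.
  by rewrite -(powR_mulrn 2 (powR_ge0 _ _)) -powRrM divfK// powR_mulrn.
have e4 : ((n%:R : R) `^ 2^-1) ^+ 2 = n%:R.
  by rewrite -(powR_mulrn 2 (powR_ge0 _ _)) -powRrM mulVf// powRr1.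
rewrite e3 e4 /lam; move: (pi^-1) (n%:R) (sqz n s) => P x q; ring.
Qed.

End Solution.

(** * The flux of the equation in Fourier coefficients *)

Section Commutator.
Context {R : realType}.
Local Notation mu := (@lebesgue_measure R).
Local Notation intc u := (mu.-integrable (@circle R) (EFin \o u)).
Implicit Types (u : R -> R) (nu : R).

Definition coef u (c : bool) (m : nat) : R := if c then cc u m else ss u m.

Lemma abs_summable_H2 u (B : R) : (forall N, \sum_(n < N) n%:R ^+ 4 * sq u n <= B) ->
  abs_summable (cc u) (ss u).
Proof.
move=> H; have B0 : 0 <= B by apply: le_trans (H 0%N); rewrite big_ord0.
have h (x : nat -> R) : (forall n, x n ^+ 2 <= sq u n) -> forall N, \sum_(n < N) n%:R * `|x n| <= 2 * Num.sqrt B.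
  move=> Hx; apply: sum_freq_le; first exact: sqrtr_ge0.
  move=> N; rewrite sqr_sqrtr//; apply: le_trans (H N); apply: ler_sum => n _.
  by apply: ler_wpM2l => //; exact: exprn_ge0.
have hc := h (cc u) (fun n => _); have hs := h (ss u) (fun n => _).
have {}hc := hc ltac:(move=> n; by rewrite /sq lerDl sqr_ge0).
have {}hs := hs ltac:(move=> n; by rewrite /sq lerDr sqr_ge0).
have sh (x : nat -> R) (C : R) : 0 <= C -> (forall N, \sum_(n < N) n%:R * `|x n| <= C) ->
    forall N, \sum_(n < N) `|x n| <= `|x 0%N| + C.
  move=> C0 Hx; case=> [|N]; first by rewrite big_ord0 addr_ge0.
  rewrite big_ord_recl lerD2l; apply: le_trans (Hx N.+1); rewrite big_ord_recl/= mul0r add0r.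
  by apply: ler_sum => i _; apply: ler_peMl => //; rewrite ler1n.
have C0 : 0 <= 2 * Num.sqrt B by rewrite mulr_ge0 ?sqrtr_ge0.
exists ((`|cc u 0| + 2 * Num.sqrt B) + (`|ss u 0| + 2 * Num.sqrt B)) => N.
by rewrite big_split/=; apply: lerD; exact: sh.
Qed.

Definition flux_w nu u : R -> R := fun y => nu * Lambda 3 u y + Lambda 1 u y.

Section One.
Variables (nu : R) (u : R -> R) (B : R).
Hypothesis lu : L2T u.
Hypothesis u0 : cc u 0 = 0.
Hypothesis HB : forall N, \sum_(n < N) n%:R ^+ 6 * sq u n <= B.

Lemma H3_abs : abs_summable (cc u) (ss u).
Proof.
apply: (@abs_summable_H2 u B) => N; apply: le_trans (HB N); apply: ler_sum => -[[|n] i] _ /=.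
  by rewrite !expr0n.
apply: ler_wpM2r; first exact: sq_ge0.
by apply: ler_weXn2l => //; rewrite ler1n.
Qed.

Lemma flux_w_spec : [/\ L2T (flux_w nu u), forall n, cc (flux_w nu u) n = lam nu n * cc u n &
  forall n, ss (flux_w nu u) n = lam nu n * ss u n].
Proof.
have e3 n : (n%:R : R) `^ 3 = n%:R ^+ 3 by rewrite -powR_mulrn.
have [|l3 c3 s3] := @Lambda_spec R 3 u lu.
  exists B => N; apply: le_trans (HB N); apply: ler_sum => n _.
  by rewrite e3 -exprM.
have [|l1 c1 s1] := @Lambda_spec R 1 u lu.
  exists B => N; apply: le_trans (HB N); apply: ler_sum => -[[|n] i] _ /=.
    by rewrite powRr1// !expr0n.
  rewrite powRr1//; apply: ler_wpM2r; first exact: sq_ge0.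
  by apply: ler_weXn2l => //; rewrite ler1n.
have E : flux_w nu u = (fun x => nu * Lambda 3 u x + 1 * Lambda 1 u x).
  by apply/funext => x; rewrite mul1r.
have i3 := L2T_int l3; have i1 := L2T_int l1.
split.
- by rewrite E; exact: L2T_lin.
- move=> n; rewrite /flux_w (@ccD _ (fun y => nu * Lambda 3 u y))//; last exact: intcZ.
  by rewrite ccZ// c3 c1 e3 powRr1// /lam mulrDl mulrA.
- move=> n; rewrite /flux_w (@ssD _ (fun y => nu * Lambda 3 u y))//; last exact: intcZ.
  by rewrite ssZ// s3 s1 e3 powRr1// /lam mulrDl mulrA.
Qed.

Definition flux_N : R -> R := hilbert_comm u (flux_w nu u).

Lemma flux_N_L2T : L2T flux_N.
Proof.
have [lw cw sw] := flux_w_spec.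
have [lh _ _ _] := hilbert_spec lw; have [lhf _ _ _] := hilbert_spec (L2T_prod lu H3_abs lw).
exact: L2T_B lhf (L2T_prod lu H3_abs lh).
Qed.

(** The limits are the coefficients of the x-derivative of the flux: on the Fourier side, d_x
    exchanges cosine and sine and brings out n with a sign. *)
Lemma flux_N_spec n : (0 < n)%N ->
  Bn nu (coef u) true J n @[J --> \oo] --> n%:R * ss flux_N n /\
  Bn nu (coef u) false J n @[J --> \oo] --> - (n%:R * cc flux_N n).
Proof.
move=> n0; have [lw cw sw] := flux_w_spec.
have w0 : cc (flux_w nu u) 0 = 0 by rewrite cw u0 mulr0.
have Hw := hilbert_spec lw; have Hf := hilbert_spec (L2T_prod lu H3_abs lw).
have hs := @ss_comm R u (flux_w nu u) (hilbert (flux_w nu u)) (hilbert (fun x => u x * flux_w nu u x)) lu H3_abs lw w0 Hw Hf n n0.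
have hc := @cc_comm R u (flux_w nu u) (hilbert (flux_w nu u)) (hilbert (fun x => u x * flux_w nu u x)) lu H3_abs lw w0 Hw Hf n n0.
split.
- rewrite (_ : (fun J => _) = (fun J => n%:R * \sum_(j < J) pi^-1 * (cc u (n + j) * cc (flux_w nu u) j + ss u (n + j) * ss (flux_w nu u) j))).
    by apply: cvgMr; exact: hs.
  apply/funext => J; rewrite /Bn -mulrA mulr_sumr; congr (_ * _); apply: eq_bigr => j _.
  by rewrite cw sw /Bterm/= /sgb mul1r; move: (pi^-1) => P; ring.
- rewrite -mulrN (_ : (fun J => _) = (fun J => n%:R * - \sum_(j < J) pi^-1 * (cc u (n + j) * ss (flux_w nu u) j - ss u (n + j) * cc (flux_w nu u) j))).
    by apply: cvgMr; apply: cvgN; exact: hc.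
  apply/funext => J; rewrite /Bn -mulrA mulr_sumr -sumrN; congr (_ * _); apply: eq_bigr => j _.
  by rewrite cw sw /Bterm/= /sgb; move: (pi^-1) => P; ring.
Qed.

End One.
End Commutator.

(** * Fourier coefficients of smooth test functions *)

Section TestCoef.
Context {R : realType}.
Implicit Types (s t x a b : R) (h : R -> R).
Local Notation mu := (@lebesgue_measure R).
Local Notation intc u := (mu.-integrable (@circle R) (EFin \o u)).
Local Notation J u := (\int[mu]_(x in @circle R) u x).

Lemma rect_bound (g : R -> R -> R) a b : continuous (fun p : R * R => g p.1 p.2) ->
  exists M, 0 <= M /\ forall t x, a <= t <= b -> circle x -> `|g t x| <= M.
Proof.
move=> cg.
have cK : compact (`[a, b] `*` (@circle R)).
  by apply: compact_setX; exact: segment_compact.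
have cI := continuous_compact (continuous_subspaceT cg) cK.
have [M [_ HM]] := compact_bounded cI.
exists (Num.max 0 (M + 1)); split; first by rewrite le_max lexx.
move=> t x tab cx; rewrite le_max; apply/orP; right.
apply: (HM (M + 1)); first by rewrite ltrDl.
by exists (t, x) => //; split => //=; rewrite in_itv.
Qed.

Lemma continuous_slice (g : R -> R -> R) t : continuous (fun p : R * R => g p.1 p.2) -> continuous (g t).
Proof.
move=> cg x; have c1 : {for x, continuous (fun y : R => (t, y))}.
  exact: (cvg_pair (cvg_cst t) cvg_id).
exact: (@continuous_comp _ _ _ (fun y => (t, y)) (fun p => g p.1 p.2) x c1 (cg _)).
Qed.

(** Differentiation under the integral; near [t] the integrand's time derivative is dominated by a
    bound for [D1] on a compact rectangle. *)
Lemma diff_coef (D0 D1 : R -> R -> R) h t : continuous (fun p : R * R => D0 p.1 p.2) ->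
  continuous (fun p : R * R => D1 p.1 p.2) -> continuous h -> (forall x, `|h x| <= 1) ->
  (forall t x, is_derive t (1 : R) (fun t' => D0 t' x) (D1 t x)) ->
  is_derive t (1 : R) (fun t => J (fun x => D0 t x * h x)) (J (fun x => D1 t x * h x)).
Proof.
move=> c0 c1 ch h1 dD.
have [M [M0 HM]] := rect_bound (t - 1) (t + 1) c1.
have dDh s x : is_derive s (1 : R) (fun t' => D0 t' x * h x) (D1 s x * h x).
  have := @is_deriveM R R (fun t' => D0 t' x) (cst (h x)) s 1 _ _ (dD s x) (is_derive_cst _ _ _).
  rewrite [X in is_derive _ _ _ X](_ : _ = D1 s x * h x)//.
  by rewrite /GRing.scale/= mulr0 add0r mulrC.
have tI : `]t - 1, t + 1[%classic t by rewrite /= in_itv/= ltrBlDr ltrDl ltr01.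
have ih (g : R -> R -> R) s : continuous (fun p : R * R => g p.1 p.2) -> intc (fun x => g s x * h x).
  by move=> cg; apply: continuous_intc => x; exact: (continuous_mul (@continuous_slice g s cg x) (ch x)).
have mc := @measurable_circle R.
have A1 : forall s, `]t - 1, t + 1[%classic s -> mu.-integrable (@circle R) (EFin \o (fun x => D0 s x * h x)).
  by move=> s _; exact: ih.
have A2 s x : `]t - 1, t + 1[%classic s -> circle x -> derivable (fun t' => D0 t' x * h x) s 1.
  by move=> _ _; have [] := dDh s x.
have A3 : mu.-integrable (@circle R) (EFin \o (fun _ : R => M)).
  by apply: continuous_intc => x; exact: cst_continuous.
have A4 s x : `]t - 1, t + 1[%classic s -> circle x -> `|partial1of2 (fun t' x => D0 t' x * h x) s x| <= M.
  move=> /=; rewrite in_itv/= => /andP[s1 s2] cx.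
  rewrite partial1of2E; have [_ ->] := dDh s x.
  rewrite normrM; apply: (@le_trans _ _ (`|D1 s x| * 1)); first by apply: ler_wpM2l.
  by rewrite mulr1; apply: HM => //; rewrite !ltW.
have d1 := @derivable_under_integral R _ _ mu (fun t' x => D0 t' x * h x) (@circle R) mc t (t - 1) (t + 1) tI A1 A2 (fun _ => M) (fun _ => M0) A3 A4.
have d2 := @differentiation_under_integral R _ _ mu (fun t' x => D0 t' x * h x) (@circle R) mc t (t - 1) (t + 1) tI A1 A2 (fun _ => M) (fun _ => M0) A3 A4.
apply: DeriveDef; first exact: d1.
rewrite -derive1E d2; apply: eq_Rintegral => x _.
by rewrite partial1of2E; have [_ ->] := dDh t x.
Qed.

Lemma diff_coefs (D0 D1 : R -> R -> R) c m t : continuous (fun p : R * R => D0 p.1 p.2) ->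
  continuous (fun p : R * R => D1 p.1 p.2) ->
  (forall t x, is_derive t (1 : R) (fun t' => D0 t' x) (D1 t x)) ->
  is_derive t (1 : R) (fun t => coef (D0 t) c m) (coef (D1 t) c m).
Proof.
move=> c0 c1 dD; case: c; apply: diff_coef => // x; rewrite ?cos_max ?sin_max//.
  have := is_derive_cosl m%:R x => -[dx _]; apply: differentiable_continuous; exact/derivable1_diffP.
have := is_derive_sinl m%:R x => -[dx _]; apply: differentiable_continuous; exact/derivable1_diffP.
Qed.

Lemma coef_bound (g : R -> R -> R) a b : continuous (fun p : R * R => g p.1 p.2) ->
  exists M, 0 <= M /\ forall c m t, a <= t <= b -> `|coef (g t) c m| <= M.
Proof.
move=> cg; have [M [M0 HM]] := rect_bound a b cg.
exists (M * (pi *+ 2)); split; first by rewrite mulr_ge0// ltW// twopi_gt0.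
move=> c m t tab.
have ig : intc (g t) by apply: continuous_intc; exact: continuous_slice.
have H : J (fun x => `|g t x|) <= M * (pi *+ 2).
  rewrite -Jcst; apply: le_J; [exact: intc_norm|exact: L2T_int (L2T_cst _)|].
  by move=> x cx; exact: HM.
by case: c; apply: le_trans H; [exact: norm_cc|exact: norm_ss].
Qed.

End TestCoef.

(** * The constructed function solves the equation in the sense of distributions *)

Section Distributional.
Context {R : realType}.
Implicit Types (s t x T : R) (c : bool).
Local Notation mu := (@lebesgue_measure R).
Local Notation intc u := (mu.-integrable (@circle R) (EFin \o u)).
Local Notation J u := (\int[mu]_(x in @circle R) u x).
Variables (nu A : R) (z0 : bool -> nat -> R) (Y : nat -> R) (z F : bool -> nat -> R -> R).
Hypothesis nu0 : 0 < nu.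
Hypothesis A0 : 0 <= A.
Hypothesis z00 : forall b, z0 b 0%N = 0.
Hypothesis cs : coef_solution nu A z0 Y z F.
Variable f : R -> R -> R.
Hypothesis Hf : forall t, 0 <= t ->
    [/\ L2T (f t), forall n, cc (f t) n = z true n t & forall n, ss (f t) n = z false n t].

Lemma lam_xp (l t : R) : 0 <= l -> 0 < t -> l * xp l t <= 2 / t.
Proof.
move=> l0 t0; rewrite ler_pdivlMr//.
have -> : xp l t = (expR (l / 2 * t))^-1 by rewrite /xp mulNr expRN.
rewrite mulrAC ler_pdivrMr ?expR_gt0//.
have := expR_ge1Dx (l / 2 * t).
by have := expR_gt0 (l / 2 * t); lra.
Qed.

Lemma lam_xp_Y n t : 0 < t -> lam nu n * (Y n * xp (lam nu n) t) <= 2 / t * Y n.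
Proof.
move=> t0; rewrite mulrCA mulrC; apply: ler_wpM2r; first exact: cs_Y0 cs n.
by apply: lam_xp => //; exact: lam_ge0.
Qed.

Lemma lam_z c n t : 0 < t -> `|lam nu n * z c n t| <= 2 / t * Y n.
Proof.
move=> t0; apply: le_trans (lam_xp_Y n t0).
rewrite normrM ger0_norm ?lam_ge0//; apply: ler_wpM2l; first exact: lam_ge0.
by apply: (cs_xp nu0 cs); exact: ltW.
Qed.

Lemma F_le c n t : 0 < t -> `|F c n t| <= 2 / t * Y n.
Proof.
move=> t0; apply: le_trans (lam_xp_Y n t0); apply: le_trans (cs_Fbound cs c n (ltW t0)) _.
rewrite -mulrA; apply: ler_wpM2l; first exact: lam_ge0.
apply: ler_wpM2r; first exact: ltW (xp_gt0 _ _).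
by have := cs_Y0 cs n; have := normr_ge0 (z0 true n); have := normr_ge0 (z0 false n); lra.
Qed.

Lemma coef_f c n t : 0 <= t -> coef (f t) c n = z c n t.
Proof. by move=> t0; have [_ hc hs] := Hf t0; case: c; rewrite /coef ?hc ?hs. Qed.

Lemma cc_f0 t : 0 <= t -> cc (f t) 0 = 0.
Proof. by move=> t0; have [_ -> _] := Hf t0; exact: (cs_z0 z00 cs). Qed.

Lemma H3_f t : 0 < t -> exists B, forall N, \sum_(n < N) n%:R ^+ 6 * sq (f t) n <= B.
Proof.
move=> t0; have [|B HB] := @sqz_bound R nu A z0 Y z F nu0 z00 cs (fun n => n%:R ^+ 6) t (nu^-1 ^+ 2) t0.
  move=> n n0; rewrite ger0_norm ?exprn_ge0//.
  have [h1 _] := lam_lower nu0 n.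
  have h2 : (nu * n%:R ^+ 3) ^+ 2 <= lam nu n ^+ 2.
    by rewrite lerXn2r ?nnegrE ?lam_ge0// mulr_ge0 ?exprn_ge0// ltW.
  rewrite exprVn ler_pdivlMl ?exprn_gt0//.
  apply: (@le_trans _ _ ((nu * n%:R ^+ 3) ^+ 2)); first by rewrite exprMn -exprM.
  apply: le_trans h2 _; apply: ler_peMl; first exact: sqr_ge0.
  by rewrite expr_ge1// ler1n.
exists B => N; apply: le_trans (HB N); apply: ler_sum => n _.
by rewrite (sq_f Hf)//; exact: ltW.
Qed.

Lemma F0_0 c t : 0 <= t -> F c 0%N t = 0.
Proof.
move=> t0; have := @cs_series _ _ _ _ _ _ _ cs c 0%N t t0.
rewrite (_ : (fun J => _) = cst 0); last by apply/funext => J; rewrite Bn0.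
move=> H; have H2 : cst (0 : R) x @[x --> \oo] --> (0 : R) by exact: cvg_cst.
exact: (cvg_unique _ H H2).
Qed.

Lemma flux_F t n : 0 < t -> n%:R * ss (flux_N nu (f t)) n = F true n t /\
  - (n%:R * cc (flux_N nu (f t)) n) = F false n t.
Proof.
move=> t0; case: n => [|n]; first by rewrite !mul0r oppr0 !F0_0// ltW.
have [B HB] := H3_f t0; have [lf _ _] := Hf (ltW t0).
have [h1 h2] := @flux_N_spec R nu (f t) B lf (cc_f0 (ltW t0)) HB n.+1 isT.
have E c : (fun J => Bn nu (coef (f t)) c J n.+1) = (fun J => Bn nu (fun c m => z c m t) c J n.+1).
  apply/funext => J; congr Bn; apply/funext => d; apply/funext => m.
  by rewrite coef_f// ltW.
rewrite E in h1; rewrite E in h2.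
have g1 := @cs_series _ _ _ _ _ _ _ cs true n.+1 t (ltW t0).
have g2 := @cs_series _ _ _ _ _ _ _ cs false n.+1 t (ltW t0).
by split; [exact: (cvg_unique _ h1 g1)|exact: (cvg_unique _ h2 g2)].
Qed.

Lemma abs_w t : 0 < t -> abs_summable (cc (flux_w nu (f t))) (ss (flux_w nu (f t))).
Proof.
move=> t0; have [B HB] := H3_f t0; have [lf hc hs] := Hf (ltW t0).
have [_ cw sw] := flux_w_spec nu lf HB.
have t2 : 0 <= 2 / t by rewrite divr_ge0// ltW.
exists (2 * (2 / t) * (Y 0%N + 4 * A)) => N.
apply: (@le_trans _ _ (2 * (2 / t) * \sum_(n < N) Y n)); last first.
  by apply: ler_wpM2l; [rewrite mulr_ge0|exact: (sum_Y A0 cs)].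
rewrite mulr_sumr; apply: ler_sum => n _; rewrite cw sw hc hs -mulrA mulr_natl mulr2n.
by apply: lerD; exact: lam_z.
Qed.

Lemma abs_N t : 0 < t -> abs_summable (cc (flux_N nu (f t))) (ss (flux_N nu (f t))).
Proof.
move=> t0; have t2 : 0 <= 2 / t by rewrite divr_ge0// ltW.
exists (`|cc (flux_N nu (f t)) 0| + 2 * (2 / t) * (Y 0%N + 4 * A)) => N.
have H n : (0 < n)%N -> `|cc (flux_N nu (f t)) n| + `|ss (flux_N nu (f t)) n| <= 2 * (2 / t) * Y n.
  move=> n0; have [h1 h2] := flux_F n t0.
  have n1 : 1 <= n%:R :> R by rewrite ler1n.
  rewrite -mulrA mulr_natl mulr2n; apply: lerD.
    apply: le_trans (F_le false n t0); rewrite -h2 normrN normrM ger0_norm//.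
    exact: ler_peMl.
  apply: le_trans (F_le true n t0); rewrite -h1 normrM ger0_norm//.
  exact: ler_peMl.
case: N => [|N].
  rewrite big_ord0; apply: addr_ge0 => //; apply: mulr_ge0; first exact: mulr_ge0.
  by apply: addr_ge0; [exact: (cs_Y0 cs)|exact: mulr_ge0].
rewrite big_ord_recl ss0 normr0 addr0 lerD2l.
apply: (@le_trans _ _ (2 * (2 / t) * \sum_(n < N.+1) Y n)); last first.
  by apply: ler_wpM2l; [rewrite mulr_ge0|exact: (sum_Y A0 cs)].
rewrite big_ord_recl mulrDr mulr_sumr -[leLHS]add0r; apply: lerD.
  by apply: mulr_ge0; [rewrite mulr_ge0|exact: (cs_Y0 cs)].
by apply: ler_sum => i _; exact: H.
Qed.

Variable D : nat -> nat -> R -> R -> R.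
Hypothesis HD : forall i j,
      continuous (fun p : R * R => D i j p.1 p.2) /\
      forall t x, is_derive t (1 : R) (fun t' => D i j t' x) (D i.+1 j t x) /\
                  is_derive x (1 : R) (fun x' => D i j t x') (D i j.+1 t x).
Hypothesis pD : forall t, periodic (D 0%N 0%N t) (pi *+ 2).
Variables a b : R.
Hypothesis a0 : 0 < a.
Hypothesis supp : forall t x, D 0%N 0%N t x != 0 -> a <= t <= b.
Local Notation phi := (D 0%N 0%N).

Let cD i j t : continuous (D i j t).
Proof. exact: continuous_slice (HD i j).1. Qed.

Let pDt t : periodic (D 1%N 0%N t) (pi *+ 2).
Proof.
move=> x; have [_ <-] := ((HD 0 0).2 t x).1; have [_ <-] := ((HD 0 0).2 t (x + pi *+ 2)).1.
by congr ('D_1 _ t); apply/funext => s; exact: pD.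
Qed.

Let pDx t : periodic (D 0%N 1%N t) (pi *+ 2).
Proof.
move=> x; have d1 := ((HD 0 0).2 t x).2; have d2 := ((HD 0 0).2 t (x + pi *+ 2)).2.
have h : is_derive x (1 : R) (fun y : R => y + pi *+ 2) 1.
  have := @is_deriveD R R R id (cst (pi *+ 2)) x 1 _ _ (is_derive_id _ _) (is_derive_cst _ _ _).
  by rewrite addr0.
have := @is_derive1_comp R (phi t) (fun y => y + pi *+ 2) x _ _ d2 h.
rewrite mulr1 (_ : _ \o _ = phi t) => [[_ <-]|]; first by case: d1.
by apply/funext => y /=; exact: pD.
Qed.

Let lphi t : L2T (phi t). Proof. exact: continuous_L2T. Qed.
Let lphit t : L2T (D 1%N 0%N t). Proof. exact: continuous_L2T. Qed.
Let lphix t : L2T (D 0%N 1%N t). Proof. exact: continuous_L2T. Qed.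

Definition inner t := J (fun x => f t x * D 1%N 0%N t x - flux_w nu (f t) x * phi t x
  - flux_N nu (f t) x * D 0%N 1%N t x).

(** The k-th Parseval term of [inner t]. Through the coefficient equation it is the time derivative
    of [Gk k]. *)
Definition Tk k t : R := kap k * ((z true k t * coef (D 1%N 0%N t) true k +
     (- (lam nu k * z true k t) + F true k t) * coef (phi t) true k) +
   (z false k t * coef (D 1%N 0%N t) false k +
     (- (lam nu k * z false k t) + F false k t) * coef (phi t) false k)).

Lemma inner_series t : 0 < t -> \sum_(k < N) Tk k t @[N --> \oo] --> inner t.
Proof.
move=> t0; have [B HB] := H3_f t0; have [lf hc hs] := Hf (ltW t0).
have [lw cw sw] := flux_w_spec nu lf HB; have lN := flux_N_L2T nu lf HB.
have p1 := parseval lf (H3_abs HB) (lphit t).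
have p2 := parseval lw (abs_w t0) (lphi t).
have p3 := parseval lN (abs_N t0) (lphix t).
have i1 := L2T_M lf (lphit t); have i2 := L2T_M lw (lphi t); have i3 := L2T_M lN (lphix t).
have E : inner t = J (fun x => f t x * D 1%N 0%N t x) - J (fun x => flux_w nu (f t) x * phi t x)
    - J (fun x => flux_N nu (f t) x * D 0%N 1%N t x).
  rewrite /inner (@JB _ (fun x => f t x * D 1%N 0%N t x - flux_w nu (f t) x * phi t x))//; last exact: intcB.
  by rewrite JB.
rewrite E (_ : (fun N => _) = (fun N =>
  \sum_(k < N) kap k * (cc (f t) k * cc (D 1%N 0%N t) k + ss (f t) k * ss (D 1%N 0%N t) k) -
  \sum_(k < N) kap k * (cc (flux_w nu (f t)) k * cc (phi t) k + ss (flux_w nu (f t)) k * ss (phi t) k) -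
  \sum_(k < N) kap k * (cc (flux_N nu (f t)) k * cc (D 0%N 1%N t) k + ss (flux_N nu (f t)) k * ss (D 0%N 1%N t) k))).
  by apply: cvgB p3; apply: cvgB p1 p2.
apply/funext => N.
rewrite -!sumrB; apply: eq_bigr => k _.
have dc : cc (D 0%N 1%N t) k = k%:R * ss (phi t) k.
  by apply: cc_deriv => //; [move=> x; exact: ((HD 0 0).2 t x).2].
have ds : ss (D 0%N 1%N t) k = - (k%:R * cc (phi t) k).
  by apply: ss_deriv => //; [move=> x; exact: ((HD 0 0).2 t x).2].
have [h1 h2] := flux_F k t0.
by rewrite dc ds cw sw hc hs /Tk -h1 -h2 /coef/=; ring.
Qed.

Let dG c k t : 0 <= t -> is_derive t (1 : R) (fun t => z c k t * coef (phi t) c k)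
  (z c k t * coef (D 1%N 0%N t) c k + (- (lam nu k * z c k t) + F c k t) * coef (phi t) c k).
Proof.
move=> t0; have d1 := @cs_derive _ _ _ _ _ _ _ cs c k t t0.
have d2 := @diff_coefs R phi (D 1%N 0%N) c k t (HD 0 0).1 (HD 1 0).1 (fun t x => ((HD 0 0).2 t x).1).
have := @is_deriveM R R (z c k) (fun t => coef (phi t) c k) t 1 _ _ d1 d2.
rewrite [X in is_derive _ _ _ X](_ : _ = z c k t * coef (D 1%N 0%N t) c k + (- (lam nu k * z c k t) + F c k t) * coef (phi t) c k)//.
by rewrite /GRing.scale/=; congr (_ + _); rewrite mulrC.
Qed.

Definition Gk k t : R := kap k * (z true k t * coef (phi t) true k + z false k t * coef (phi t) false k).

Let dGk k t : 0 <= t -> is_derive t (1 : R) (Gk k) (Tk k t).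
Proof.
move=> t0.
exact: (@is_deriveZ R R R _ (kap k) t 1 _ (@is_deriveD R R R _ _ t 1 _ _ (dG true k t0) (dG false k t0))).
Qed.

Let phi0 t : ~~ (a <= t <= b) -> phi t = fun _ => 0.
Proof. by move=> H; apply/funext => x; apply/eqP; apply: contraNT H => /supp. Qed.

Let coef0 c k : coef (fun _ : R => 0) c k = 0.
Proof.
by case: c; rewrite /coef /cc /ss; under eq_Rintegral do rewrite mul0r; exact: J0.
Qed.

Let Gk0 k t : ~~ (a <= t <= b) -> Gk k t = 0.
Proof. by move=> H; rewrite /Gk phi0// !coef0 !mulr0 addr0 mulr0. Qed.

Let cT k t : 0 <= t -> {for t, continuous (Tk k)}.
Proof.
move=> t0.
have cz c : {for t, continuous (z c k)} by exact: (cs_continuous cs).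
have cc0 c : {for t, continuous (fun t => coef (phi t) c k)}.
  have [d _] := @diff_coefs R phi (D 1%N 0%N) c k t (HD 0 0).1 (HD 1 0).1 (fun t x => ((HD 0 0).2 t x).1).
  by apply: differentiable_continuous; exact/derivable1_diffP.
have cc1 c : {for t, continuous (fun t => coef (D 1%N 0%N t) c k)}.
  have [d _] := @diff_coefs R (D 1%N 0%N) (D 2%N 0%N) c k t (HD 1 0).1 (HD 2 0).1 (fun t x => ((HD 1 0).2 t x).1).
  by apply: differentiable_continuous; exact/derivable1_diffP.
have cF c : {for t, continuous (fun t => - (lam nu k * z c k t) + F c k t)}.
  apply: continuous_add; last exact: (cs_cont cs).
  rewrite (_ : (fun _ => _) = (fun t => - lam nu k * z c k t)); last by apply/funext => s; rewrite mulNr.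
  exact: (continuous_mul (@continuous_cst R _ t) (cz c)).
have c1 c := continuous_add (continuous_mul (cz c) (cc1 c)) (continuous_mul (cF c) (cc0 c)).
exact: (continuous_mul (@continuous_cst R (kap k) t) (continuous_add (c1 true) (c1 false))).
Qed.

(** The interval from [a'] to [b'] contains [a, b] in its interior, so phi vanishes near every
    outside time, together with its derivatives. It stays away from time 0, and the maximum in [b']
    keeps it nonempty even if b < a. *)
Let a' := a / 2.
Let b' := Num.max a b + 1.

Let a'0 : 0 < a'. Proof. by rewrite divr_gt0. Qed.
Let a'a : a' < a. Proof. by rewrite /a'; move: a0 => h; lra. Qed.
Let bb' : b < b'. Proof. by apply: (@le_lt_trans _ _ (Num.max a b)); [rewrite le_max lexx orbT|rewrite ltrDl]. Qed.
Let a'b' : a' < b'.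
Proof. by apply: lt_trans a'a _; apply: (@le_lt_trans _ _ (Num.max a b)); [rewrite le_max lexx|rewrite ltrDl]. Qed.

Let wT k : {within `[a', b'], continuous (Tk k)}.
Proof.
apply: continuous_in_subspaceT => t; rewrite inE/= in_itv/= => /andP[h _]; apply: cT.
exact: le_trans (ltW a'0) h.
Qed.

Let int_Tk k : (\int[mu]_(t in `[a', b']) (Tk k t)%:E = 0)%E.
Proof.
have t0 t : a' <= t -> 0 <= t by move=> h; exact: le_trans (ltW a'0) h.
have cG t : 0 <= t -> {for t, continuous (Gk k)}.
  by move=> h; have [d _] := dGk k h; apply: differentiable_continuous; exact/derivable1_diffP.
rewrite (@continuous_FTC2 R (Tk k) (Gk k) a' b' a'b' (@wT k)).
- by rewrite !Gk0 ?subee//; rewrite negb_and -!ltNge ?a'a ?bb' ?orbT.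
- split.
  + by move=> t; rewrite in_itv/= => /andP[h _]; have [] := dGk k (t0 t (ltW h)).
  + by apply: cvg_at_right_filter; exact: cG (t0 _ (lexx _)).
  + by apply: cvg_at_left_filter; exact: cG (t0 _ (ltW a'b')).
- by move=> t; rewrite in_itv/= => /andP[h _]; rewrite derive1E; have [_ ->] := dGk k (t0 t (ltW h)).
Qed.

Lemma inner_outside t : 0 <= t -> ~~ (a' <= t <= b') -> inner t = 0.
Proof.
move=> t0 H.
have out : \forall s \near t, ~~ (a <= s <= b).
  move: H; rewrite negb_and -!ltNge => /orP[h|h].
    apply: (@filterS _ _ _ (fun s => s < a)); last by apply: lt_nbhsl; exact: lt_trans h a'a.
    by move=> s hs; rewrite negb_and -ltNge hs.
  apply: (@filterS _ _ _ (fun s => b < s)); last by apply: lt_nbhsr; exact: lt_trans bb' h.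
  by move=> s hs; rewrite negb_and -!ltNge hs orbT.
have p0 : phi t = fun _ => 0 by apply: phi0; exact: (nbhs_singleton out).
have d1 x : D 1%N 0%N t x = 0.
  have [_ <-] := ((HD 0 0).2 t x).1.
  rewrite (@near_eq_derive _ _ _ _ (cst 0)) ?derive_cst//.
  by apply: filterS out => s hs /=; rewrite phi0.
have d2 x : D 0%N 1%N t x = 0.
  by have [_ <-] := ((HD 0 0).2 t x).2; rewrite p0 derive_cst.
by rewrite /inner; under eq_Rintegral do rewrite d1 d2 p0 !mulr0 subrr subr0; exact: J0.
Qed.

(** Every [Tk k] integrates to zero, being the derivative of a function that vanishes at both ends.
    Sum and integral are exchanged by domination: at times above [a'] the k-th term is at most a
    constant times Y_k, and Y is summable. *)
Lemma int_inner : \int[mu]_(t in `[0, +oo[) inner t = 0.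
Proof.
have sub : `[a', b'] `<=` (`[0, +oo[ : set R).
  by move=> t /=; rewrite !in_itv/= andbT => /andP[h _]; exact: le_trans (ltW a'0) h.
have -> : \int[mu]_(t in `[0, +oo[) inner t = \int[mu]_(t in `[a', b']) inner t.
  rewrite -[in RHS](setIidr sub) Rintegral_mkcondr; apply: eq_Rintegral => t; rewrite inE/= in_itv/= andbT => t0.
  by rewrite patchE; case: ifPn => //; rewrite notin_setE/= in_itv/= => /negP h; rewrite inner_outside.
have mab : measurable (`[a', b'] : set (measurableTypeR R)) by [].
have [M0 [M00 HM0]] := coef_bound a' b' (HD 0 0).1.
have [M1 [M10 HM1]] := coef_bound a' b' (HD 1 0).1.
(* [M1] bounds the term with the time derivative of phi. The linear term and the forcing are each at
   most (2 / a') Y_k, whence 4 / a'. The factor 2 counts cosine and sine. *)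
pose K := 2 * (M1 + 4 / a' * M0).
have K0 : 0 <= K by rewrite mulr_ge0// addr_ge0// mulr_ge0// divr_ge0// ltW.
have mTk k : measurable_fun (`[a', b'] : set R) (Tk k).
  by apply: subspace_continuous_measurable_fun => //; exact: wT.
have TkK k t : a' <= t <= b' -> `|Tk k t| <= K * Y k.
  move=> tab; have /andP[t1 t2] := tab; have t0 : 0 < t by exact: lt_le_trans t1.
  have Yk := cs_Y0 cs k.
  have ti : 2 / t <= 2 / a' by rewrite ler_pM2l// lef_pV2.
  have h c : `|z c k t * coef (D 1%N 0%N t) c k + (- (lam nu k * z c k t) + F c k t) * coef (phi t) c k|
      <= (M1 + 4 / a' * M0) * Y k.
    apply: le_trans (ler_normD _ _) _.
    rewrite [`|z c k t * _|]normrM [`|(_ + _) * _|]normrM [leRHS]mulrDl; apply: lerD.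
      by rewrite mulrC; apply: ler_pM => //; [exact: HM1|exact: (cs_Y nu0 cs _ _ (ltW t0))].
    rewrite [leRHS]mulrAC; apply: ler_pM => //; last exact: HM0.
    apply: le_trans (ler_normD _ _) _; rewrite normrN.
    apply: le_trans (lerD (lam_z c k t0) (F_le c k t0)) _.
    rewrite -mulrDl; apply: ler_wpM2r => //.
    by have := lerD ti ti; rewrite -[leRHS]mulrDl (_ : 2 + 2 = 4 :> R)//; ring.
  rewrite normrM ger0_norm ?(ltW (kap_gt0 _))//.
  apply: (@le_trans _ _ (1 * (K * Y k))); last by rewrite mul1r.
  apply: ler_pM => //; [exact: ltW (kap_gt0 _)|exact: kap_le1|].
  apply: le_trans (ler_normD _ _) _; apply: le_trans (lerD (h true) (h false)) _.
  by rewrite /K; move: (M1 + _) => q; rewrite le_eqVlt; apply/orP; left; apply/eqP; ring.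
pose S N t : R := \sum_(k < N) Tk k t.
have mS N : measurable_fun (`[a', b'] : set R) (S N).
  by apply: measurable_sum => k; exact: mTk.
have Sb N t : a' <= t <= b' -> `|S N t| <= K * (Y 0%N + 4 * A).
  move=> tab; apply: le_trans (ler_norm_sum _ _ _) _.
  apply: (@le_trans _ _ (K * \sum_(k < N) Y k)).
    by rewrite mulr_sumr; apply: ler_sum => k _; exact: TkK.
  by apply: ler_wpM2l => //; exact: (sum_Y A0 cs).
have cvS t : a' <= t <= b' -> S N t @[N --> \oo] --> inner t.
  by move=> /andP[h _]; apply: inner_series; exact: lt_le_trans h.
have iS N : (\int[mu]_(t in `[a', b']) (S N t)%:E = 0)%E.
  have iT k : mu.-integrable (`[a', b'] : set R) (EFin \o Tk k).
    by apply: continuous_compact_integrable; [exact: segment_compact|exact: wT].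
  transitivity (\sum_(k < N) \int[mu]_(t in `[a', b']) (Tk k t)%:E)%E; last by rewrite big1// => k _; exact: int_Tk.
  rewrite -(@integral_sum _ _ R mu `[a', b'] mab _ (fun k : 'I_N => EFin \o Tk k))//.
  by apply: eq_integral => t _; rewrite /S/= sumEFin.
have mI : measurable_fun (`[a', b'] : set R) (EFin \o inner).
  apply/measurable_EFinP; apply: (@measurable_fun_cvg _ _ R _ S inner) => //.
have [] := @dominated_convergence _ (measurableTypeR R) R mu `[a', b'] mab (fun N t => (S N t)%:E) (EFin \o inner)
  (cst (K * (Y 0%N + 4 * A))%:E).
- by move=> N; apply/measurable_EFinP; exact: mS.
- exact: mI.
- by apply: aeW => t /=; rewrite in_itv/= => h; apply: cvg_EFin; [exact: nearW|exact: cvS].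
- have := @continuous_compact_integrable R (cst (K * (Y 0%N + 4 * A))) `[a', b'] (@segment_compact _ _ _) _.
  by apply; exact: continuous_subspaceT (@cst_continuous _ _ _).
- by apply: aeW => t N /=; rewrite in_itv/= => h; rewrite lee_fin; exact: Sb.
move=> _ _ H; rewrite /Rintegral.
rewrite (_ : [sequence _]_n = cst 0%E) in H; last by apply/funext => N; exact: iS.
have := cvg_lim _ H; rewrite lim_cst// => <-//.
Qed.

End Distributional.

Section Solves.
Context {R : realType}.
Local Notation mu := (@lebesgue_measure R).
Variables (nu A : R) (z0 : bool -> nat -> R) (Y : nat -> R) (z F : bool -> nat -> R -> R).
Hypothesis nu0 : 0 < nu.
Hypothesis A0 : 0 <= A.
Hypothesis z00 : forall b, z0 b 0%N = 0.
Hypothesis cs : coef_solution nu A z0 Y z F.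
Variable f : R -> R -> R.
Hypothesis Hf : forall t, 0 <= t ->
    [/\ L2T (f t), forall n, cc (f t) n = z true n t & forall n, ss (f t) n = z false n t].

Lemma f_distributional : distributional_solution nu f.
Proof.
move=> phi [[D [<- HD]] pD [a [b [a0 supp]]]].
rewrite -[RHS](int_inner nu0 A0 z00 cs Hf HD pD a0 supp).
apply: eq_Rintegral => t _; apply: eq_Rintegral => x _ /=.
have [_ e1] := ((HD 0 0)%N.2 t x).1; have [_ e2] := ((HD 0 0)%N.2 t x).2.
by rewrite !derive1E e1 e2.
Qed.

End Solves.

(** * Smooth bump functions *)

Section Bump.
Context {R : realType}.
Implicit Types (x y t c d s : R) (h : R -> R).

(** The powers of 1 / x in front of exp (- 1 / x) make the family closed under differentiation, up
    to linear combinations. *)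
Definition flat (k : nat) x : R := if 0 < x then (x^-1) ^+ k * expR (- x^-1) else 0.

Lemma flat_pos k x : 0 < x -> flat k x = (x^-1) ^+ k * expR (- x^-1).
Proof. by move=> x0; rewrite /flat x0. Qed.

Lemma flat_neg k x : x <= 0 -> flat k x = 0.
Proof. by rewrite /flat ltNge => ->. Qed.

Lemma flat_ge0 k x : 0 <= flat k x.
Proof.
rewrite /flat; case: ifPn => // x0; apply: mulr_ge0; last exact: expR_ge0.
by rewrite exprn_ge0// invr_ge0 ltW.
Qed.

Lemma flat_gt0 k x : 0 < x -> 0 < flat k x.
Proof. by move=> x0; rewrite flat_pos// mulr_gt0 ?expR_gt0// exprn_gt0// invr_gt0. Qed.

(** With y = 1 / x this is exp (y) >= y^(k+2) / (k+2)!. A quadratic bound is what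
    [is_derive_sqr_flat] turns into a zero derivative at 0. *)
Lemma flat_sqr k x : `|flat k x| <= k.+2`!%:R * x ^+ 2.
Proof.
rewrite ger0_norm ?flat_ge0//; have [x0|x0] := ltP 0 x; last first.
  by rewrite flat_neg// mulr_ge0// sqr_ge0.
have y0 : 0 < x^-1 by rewrite invr_gt0.
rewrite flat_pos// -ler_pdivrMr ?exprn_gt0// -exprVn mulrAC -exprD addn2.
have := expR_ge1Dxn k.+1 (ltW y0); rewrite expRN => h.
rewrite ler_pdivrMr ?expR_gt0//.
have f0 : 0 < (k.+2)`!%:R :> R by rewrite ltr0n fact_gt0.
rewrite -ler_pdivrMl//; apply: le_trans h; rewrite mulrC.
by rewrite lerDr.
Qed.

Lemma is_derive_sqr_flat h (C : R) : (forall x, `|h x| <= C * x ^+ 2) -> is_derive (0 : R) (1 : R) h 0.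
Proof.
move=> H.
have h0 : h 0 = 0 by apply/eqP; rewrite -normr_le0; apply: le_trans (H 0) _; rewrite expr0n/= mulr0.
have C0 : 0 <= C by have := H 1; rewrite expr1n mulr1; apply: le_trans.
have cv : e^-1 *: ((h \o shift 0) (e *: 1) - h 0) @[e --> (0 : R)^'] --> (0 : R).
  apply/cvgrPdist_le => eps e0; rewrite near_withinE.
  have C1 : 0 < C + 1 by rewrite ltr_pwDr.
  exists (eps / (C + 1)); first by rewrite /= divr_gt0.
  move=> x /=; rewrite sub0r normrN => hx xn0.
  rewrite sub0r normrN h0 subr0 addr0 /GRing.scale/= mulr1 normrM normfV.
  rewrite ler_pdivrMl ?normr_gt0//; apply: le_trans (H x) _.
  rewrite -(real_normK (num_real x)) expr2 mulrCA; apply: ler_wpM2l => //.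
  move: hx; rewrite ltr_pdivlMr// => hx; apply: ltW; apply: le_lt_trans hx.
  by rewrite mulrC; apply: ler_wpM2l => //; rewrite lerDl.
apply: DeriveDef; first by apply/cvg_ex; exists 0; exact: cv.
by apply/cvg_lim => //; exact: cv.
Qed.

Lemma is_derive_flat k x : is_derive x (1 : R) (flat k) (- (k%:R * flat k.+1 x) + flat k.+2 x).
Proof.
have [x0|x0|x0] := ltgtP 0 x; last first.
- rewrite -x0 !flat_neg// mulr0 oppr0 addr0; exact: is_derive_sqr_flat (flat_sqr k).
- rewrite !flat_neg ?(ltW x0)// mulr0 oppr0 addr0.
  have dc : is_derive x (1 : R) (cst (0 : R)) (0 : R) by exact: is_derive_cst.
  apply: (near_eq_is_derive _ dc).
  by apply: filterS (lt_nbhsl x0) => y y0 /=; rewrite flat_neg// ltW.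
apply: (@near_eq_is_derive _ _ _ (fun x => (x^-1) ^+ k * expR (- x^-1))).
  by apply: filterS (lt_nbhsr x0) => y y0; rewrite flat_pos.
have xn0 : x != 0 by rewrite gt_eqF.
have d1 : is_derive x (1 : R) (fun y : R => y^-1) (- (x ^- 2)).
  have := @is_deriveV R id x 1 1 xn0 (is_derive_id _ _).
  by rewrite /GRing.scale/= mulr1.
have d2 : is_derive x (1 : R) (fun y : R => (y^-1) ^+ k) (k%:R * x^-1 ^+ k.-1 * - (x ^- 2)).
  have := @is_deriveX R R (fun y : R => y^-1) k x 1 _ d1.
  rewrite (_ : (fun y : R => y^-1) ^+ k = (fun y : R => y^-1 ^+ k)); last by apply/funext => y; rewrite exprfctE.
  by rewrite /GRing.scale/= -mulr_natl.
have d3 : is_derive x (1 : R) (fun y : R => expR (- y^-1)) (expR (- x^-1) * x ^- 2).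
  have d4 := @is_deriveN R R R _ x 1 _ d1; rewrite opprK in d4.
  exact: (@is_derive1_comp R expR (fun y => - y^-1) x _ _ (is_derive_expR _) d4).
have := @is_deriveM R R _ _ x 1 _ _ d2 d3.
rewrite [X in is_derive _ _ _ X](_ : _ = - (k%:R * flat k.+1 x) + flat k.+2 x)//.
rewrite !flat_pos// /GRing.scale/= -exprVn; move: (x^-1) (expR _) => y e.
by case: k {d2} => [|k]/=; rewrite ?mul0r !exprS; ring.
Qed.

(* A class containing the bumps and closed under differentiation. *)
Inductive sm : (R -> R) -> Prop :=
| sm_flat k c d : sm (fun t => flat k (c * t + d))
| sm_cst c : sm (fun=> c)
| sm_add h1 h2 : sm h1 -> sm h2 -> sm (fun t => h1 t + h2 t)
| sm_mul h1 h2 : sm h1 -> sm h2 -> sm (fun t => h1 t * h2 t).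

Lemma sm_derive h : sm h -> exists h', sm h' /\ forall t, is_derive t (1 : R) h (h' t).
Proof.
elim => {h} [k c d|c|h1 h2 s1 [d1 [sd1 H1]] s2 [d2 [sd2 H2]]|h1 h2 s1 [d1 [sd1 H1]] s2 [d2 [sd2 H2]]].
- exists (fun t => c * (- k%:R * flat k.+1 (c * t + d) + flat k.+2 (c * t + d))); split.
    by apply: sm_mul; [exact: sm_cst|apply: sm_add; [apply: sm_mul; [exact: sm_cst|exact: sm_flat]|exact: sm_flat]].
  move=> t.
  have dl : is_derive t (1 : R) (fun s : R => c * s + d) c.
    have dc : is_derive t (1 : R) (fun s : R => c * s) c.
      by have := @is_deriveZ R R R id c t 1 1 (is_derive_id _ _); rewrite /GRing.scale/= mulr1.
    by have := @is_deriveD R R R _ (cst d) t 1 _ _ dc (is_derive_cst _ _ _); rewrite addr0.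
  have := @is_derive1_comp R (flat k) (fun s => c * s + d) t _ _ (is_derive_flat _ _) dl.
  by rewrite mulrC mulNr.
- by exists (fun=> 0); split; [exact: sm_cst|move=> t; exact: is_derive_cst].
- exists (fun t => d1 t + d2 t); split; first exact: sm_add.
  by move=> t; exact: is_deriveD (H1 t) (H2 t).
- exists (fun t => h1 t * d2 t + h2 t * d1 t); split.
    by apply: sm_add; apply: sm_mul.
  by move=> t; exact: is_deriveM (H1 t) (H2 t).
Qed.

Definition smooth1 h := exists d : nat -> R -> R, d 0%N = h /\ forall i t, is_derive t (1 : R) (d i) (d i.+1 t).

Lemma sm_smooth h : sm h -> smooth1 h.
Proof.
move=> sh.
(* The derivative is made total on all functions, so that the choice yields an operator that can be
   iterated. *)
have H (g : R -> R) : exists g', sm g -> sm g' /\ forall t, is_derive t (1 : R) g (g' t).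
  by have [/sm_derive[g' Hg']|ng] := pselect (sm g); [exists g'|exists g].
have [D HD] := choice H; exists (fun i => iter i D h); split => // i.
have S : sm (iter i D h) by elim: i => //= i IH; exact: (HD _ IH).1.
by move=> t; exact: (HD _ S).2.
Qed.

(** Positive exactly on (s, s + d); both arguments are written as an affine c t + d to match
    [sm_flat]. *)
Definition bump s d t : R := flat 0 (1 * t + - s) * flat 0 (-1 * t + (s + d)).

Lemma sm_bump s d : sm (bump s d).
Proof. by apply: sm_mul; exact: sm_flat. Qed.

Lemma bump_ge0 s d t : 0 <= bump s d t.
Proof. by rewrite mulr_ge0 ?flat_ge0. Qed.

Lemma bump_gt0 s d t : s < t < s + d -> 0 < bump s d t.
Proof. by move=> /andP[h1 h2]; apply: mulr_gt0; apply: flat_gt0; lra. Qed.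

Lemma bump_out s d t : ~~ (s < t < s + d) -> bump s d t = 0.
Proof.
rewrite negb_and -!leNgt => /orP[h|h]; rewrite /bump.
  by rewrite flat_neg ?mul0r//; lra.
by rewrite (@flat_neg _ (-1 * t + _)) ?mulr0//; lra.
Qed.

Lemma sm_continuous h : sm h -> continuous h.
Proof.
move=> /sm_derive[h' [_ H]] t; have [d _] := H t.
by apply: differentiable_continuous; exact/derivable1_diffP.
Qed.

End Bump.

(** * From the weak to the pointwise form of an ordinary differential equation *)

Section DuBoisReymond.
Context {R : realType}.
Implicit Types (x y t c d s a b : R) (h : R -> R).
Local Notation mu := (@lebesgue_measure R).

Lemma ftc_on (g G : R -> R) a b : a < b -> {within `[a, b], continuous g} ->
  (forall t, a <= t <= b -> is_derive t (1 : R) G (g t)) ->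
  \int[mu]_(t in `[a, b]) g t = G b - G a.
Proof.
move=> ab cg dG.
have cG t : a <= t <= b -> {for t, continuous G}.
  by move=> h; have [d _] := dG t h; apply: differentiable_continuous; exact/derivable1_diffP.
rewrite /Rintegral (@continuous_FTC2 R g G a b ab cg)//.
- split.
  + by move=> t; rewrite in_itv/= => /andP[h1 h2]; have [] := dG t; rewrite ?(ltW h1) ?(ltW h2).
  + by apply: cvg_at_right_filter; apply: cG; rewrite lexx ltW.
  + by apply: cvg_at_left_filter; apply: cG; rewrite lexx ltW.
- move=> t; rewrite in_itv/= => /andP[h1 h2]; rewrite derive1E.
  have tab : a <= t <= b by rewrite !ltW.
  by have [_ ->] := dG t tab.
Qed.

Lemma within_of_continuous h a b : continuous h -> {within `[a, b], continuous h}.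
Proof. exact: continuous_subspaceT. Qed.

Lemma integrable_cont h a b : continuous h -> mu.-integrable (`[a, b] : set R) (EFin \o h).
Proof.
by move=> ch; apply: continuous_compact_integrable; [exact: segment_compact|exact: continuous_subspaceT].
Qed.

Lemma bump_mass s d a b : a < s -> 0 < d -> s + d < b -> 0 < \int[mu]_(t in `[a, b]) bump s d t.
Proof.
move=> as_ d0 sb; have cb := sm_continuous (sm_bump s d).
pose G t := \int[mu]_(x in `[a - 1, t]) bump s d x.
have dG t : a <= t -> is_derive t (1 : R) G (bump s d t).
  by move=> h; apply: prim_derive => //; lra.
have sd : s < s + d by rewrite ltrDl.
have I1 u v : a <= u -> u < v -> \int[mu]_(t in `[u, v]) bump s d t = G v - G u.
  move=> au uv; apply: ftc_on => //; first exact: within_of_continuous.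
  by move=> t /andP[h _]; apply: dG; exact: le_trans h.
have mono u v : a <= u -> u < v -> G u <= G v.
  by move=> au uv; rewrite -subr_ge0 -I1//; apply: Rintegral_ge0 => t _; exact: bump_ge0.
have str : G s < G (s + d).
  apply: (@gtr0_derive1_lt_cc R G s (s + d)) => //.
  - by move=> t; rewrite in_itv/= => /andP[h _]; have [] := dG t (ltW (lt_trans as_ h)).
  - move=> t; rewrite in_itv/= => h; rewrite derive1E; have /andP[h1 _] := h.
    by have [_ ->] := dG t (ltW (lt_trans as_ h1)); exact: bump_gt0.
  - by apply: (@within_derive R G (bump s d)) => t /andP[h _]; apply: dG; lra.
  - by rewrite in_itv/= lexx ltW.
  - by rewrite in_itv/= lexx ltW.
rewrite I1//; last by lra.
have := mono a s (lexx _) as_; have := mono (s + d) b ltac:(lra) sb; lra.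
Qed.

Lemma integrable_within h a b : {within `[a, b], continuous h} -> mu.-integrable (`[a, b] : set R) (EFin \o h).
Proof. by move=> ch; apply: continuous_compact_integrable => //; exact: segment_compact. Qed.

Lemma within_mul h g a b : {within `[a, b], continuous h} -> {within `[a, b], continuous g} ->
  {within `[a, b], continuous (fun t => h t * g t)}.
Proof. by move=> ch cg t; exact: (@continuousM R (subspace `[a, b]) _ _ t (ch t) (cg t)). Qed.

Lemma within_sub h g a b : {within `[a, b], continuous h} -> {within `[a, b], continuous g} ->
  {within `[a, b], continuous (fun t => h t - g t)}.
Proof. by move=> ch cg t; exact: (@continuousB R R (subspace `[a, b]) _ _ t (ch t) (cg t)). Qed.

Lemma within_add h g a b : {within `[a, b], continuous h} -> {within `[a, b], continuous g} ->
  {within `[a, b], continuous (fun t => h t + g t)}.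
Proof. by move=> ch cg t; exact: (@continuousD R R (subspace `[a, b]) _ _ t (ch t) (cg t)). Qed.

Lemma within_cst c a b : {within `[a, b], continuous (fun _ : R => c)}.
Proof. by apply: within_of_continuous => t; exact: continuous_cst. Qed.

Lemma within_norm h a b : {within `[a, b], continuous h} -> {within `[a, b], continuous (fun t => `|h t|)}.
Proof.
move=> ch t; apply: (@continuous_comp (subspace `[a, b]) R R h (fun x : R => `|x|) t); first exact: ch.
exact: norm_continuous.
Qed.

(** The normalised integral is a mean of [G] with a weight supported where [G] is within [eps] of
    its value at [s]. *)
Lemma bump_concentrate s d a b (G : R -> R) (eps : R) : a < s -> 0 < d -> s + d < b ->
  {within `[a, b], continuous G} -> (forall t, s <= t <= s + d -> `|G t - G s| <= eps) ->
  `|(\int[mu]_(t in `[a, b]) bump s d t)^-1 * (\int[mu]_(t in `[a, b]) (bump s d t * G t)) - G s| <= eps.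
Proof.
move=> as_ d0 sb cG H; set m := \int[mu]_(t in `[a, b]) bump s d t.
have m0 : 0 < m by exact: bump_mass.
have cb : {within `[a, b], continuous (bump s d)} by apply: within_of_continuous; exact/sm_continuous/sm_bump.
have cbG := within_mul cb cG; have cbs := within_mul cb (@within_cst (G s) a b).
have cbe := within_mul cb (@within_cst eps a b).
rewrite (_ : _ - G s = m^-1 * (\int[mu]_(t in `[a, b]) (bump s d t * G t) - m * G s)); last by field; rewrite gt_eqF.
rewrite normrM normfV (gtr0_norm m0) ler_pdivrMl//.
rewrite /m -RintegralZr//; last exact: integrable_within.
rewrite -RintegralB//; [|exact: integrable_within|exact: integrable_within].
rewrite -RintegralZr//; last exact: integrable_within.
apply: le_trans (le_normr_Rintegral _ _) _ => //.
  exact: integrable_within (within_sub cbG cbs).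
apply: le_Rintegral => //.
- exact: integrable_within (within_norm (within_sub cbG cbs)).
- exact: integrable_within.
move=> t _; rewrite -mulrBr normrM ger0_norm ?bump_ge0//.
have [h|h] := boolP (s < t < s + d); last by rewrite bump_out// !mul0r.
apply: ler_wpM2l; first exact: bump_ge0.
by have /andP[h1 h2] := h; apply: H; rewrite !ltW.
Qed.

Lemma Rintegral_restrict h (D E : set R) : E `<=` D -> (forall t, D t -> ~ E t -> h t = 0) ->
  \int[mu]_(t in D) h t = \int[mu]_(t in E) h t.
Proof.
move=> ED h0; rewrite -[in RHS](setIidr ED) Rintegral_mkcondr; apply: eq_Rintegral => t; rewrite inE => Dt.
by rewrite patchE; case: ifPn => //; rewrite notin_setE => nE; rewrite h0.
Qed.

(** The test function is the primitive [chi] of the difference of two unit-mass bumps at s1 and s2;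
    zero total mass gives it compact support. With W a primitive of Q and G = P + W, the hypothesis
    says that the two means of G agree, and narrow bumps then give G (s1) = G (s2). *)
Lemma du_bois_reymond (P Q : R -> R) : continuous P -> continuous Q ->
  (forall (d : nat -> R -> R) a b, 0 < a -> (forall i t, is_derive t (1 : R) (d i) (d i.+1 t)) ->
     (forall t, d 0%N t != 0 -> a <= t <= b) ->
     \int[mu]_(t in `[0, +oo[) (d 1%N t * P t - d 0%N t * Q t) = 0) ->
  forall t, 0 < t -> is_derive t (1 : R) P (- Q t).
Proof.
move=> cP cQ H.
have key s1 s2 : 0 < s1 -> s1 < s2 -> P s2 - P s1 = - \int[mu]_(t in `[s1, s2]) Q t.
  move=> s10 s12.
  pose a := s1 / 2; have a0 : 0 < a by rewrite divr_gt0.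
  have as1 : a < s1 by rewrite /a; lra.
  pose b := s2 + 1; have ab : a < b by rewrite /b; lra.
  pose W t := \int[mu]_(x in `[a - 1, t]) Q x.
  have dW t : a <= t -> is_derive t (1 : R) W (Q t) by move=> h; apply: prim_derive => //; lra.
  have cW : {within `[a, b], continuous W}.
    by apply: (@within_derive R W Q) => t /andP[h _]; exact: dW.
  pose G t := P t + W t.
  have cG : {within `[a, b], continuous G} by apply: within_add => //; exact: within_of_continuous.
  suff E : G s1 = G s2.
    have -> : \int[mu]_(t in `[s1, s2]) Q t = W s2 - W s1.
      apply: ftc_on => //; first exact: within_of_continuous.
      by move=> t /andP[h _]; apply: dW; lra.
    by move: E; rewrite /G; lra.
  apply/eqP; rewrite -subr_eq0 -normr_le0; apply/ler_addgt0Pl => e e0; rewrite addr0.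
  have e2 : 0 < e / 2 by rewrite divr_gt0.
  have loc s : s1 <= s -> exists r, 0 < r /\ forall t, s <= t <= s + r -> `|G t - G s| <= e / 2.
    move=> hs; have as_ : a <= s by lra.
    have cGs : {for s, continuous G}.
      apply: continuous_add; first exact: cP.
      by have [d _] := dW s as_; apply: differentiable_continuous; exact/derivable1_diffP.
    have /cvgrPdist_le/(_ _ e2)[r /= r0 Hr] := cGs.
    exists (r / 2); split; first by rewrite divr_gt0.
    move=> t /andP[h1 h2]; rewrite distrC; apply: Hr => /=.
    by rewrite distrC ger0_norm ?subr_ge0//; lra.
  have [r1 [r10 H1]] := loc s1 (lexx _); have [r2 [r20 H2]] := loc s2 (ltW s12).
  (* The width makes both means accurate to e / 2, and 1/2 keeps the bumps inside [a, s2 + 1]. *)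
  pose d := Num.min (Num.min r1 r2) (1 / 2).
  have d0 : 0 < d by rewrite !lt_min r10 r20 divr_gt0.
  have dr1 : d <= r1 by rewrite !ge_min lexx.
  have dr2 : d <= r2 by rewrite !ge_min lexx orbT.
  have d1 : d <= 1 / 2 by rewrite ge_min lexx orbT.
  have sb1 : s1 + d < b by rewrite /b; lra.
  have sb2 : s2 + d < b by rewrite /b; lra.
  pose m1 := \int[mu]_(t in `[a, b]) bump s1 d t; pose m2 := \int[mu]_(t in `[a, b]) bump s2 d t.
  have as2 : a < s2 by lra.
  have m10 : 0 < m1 by exact: bump_mass.
  have m20 : 0 < m2 by exact: bump_mass.
  pose rho t := m1^-1 * bump s1 d t + (- m2^-1) * bump s2 d t.
  have smr : sm rho by apply: sm_add; apply: sm_mul; (exact: sm_cst || exact: sm_bump).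
  have cr := sm_continuous smr.
  have [D [D0 HD]] := sm_smooth smr.
  have r0 t : t <= s1 \/ b <= t -> rho t = 0.
    move=> ht; rewrite /rho !bump_out ?mulr0 ?addr0//; apply/negP => /andP[h1 h2]; case: ht => ht; lra.
  pose chi t := \int[mu]_(x in `[a, t]) rho x.
  have chi0 t : t <= s1 -> chi t = 0.
    move=> ts; transitivity (\int[mu]_(x in `[a, t]) (0 : R)); last by rewrite Rintegral_cst// mul0r.
    apply: eq_Rintegral => x; rewrite inE/= in_itv/= => /andP[_ h].
    by rewrite r0//; left; exact: le_trans h ts.
  have ib s : mu.-integrable (`[a, b] : set R) (EFin \o bump s d).
    exact/integrable_cont/sm_continuous/sm_bump.
  have chib : chi b = 0.
    have i1 c s : mu.-integrable (`[a, b] : set R) (EFin \o (fun t => c * bump s d t)).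
      by apply: integrable_cont; apply: sm_continuous; apply: sm_mul; [exact: sm_cst|exact: sm_bump].
    rewrite /chi /rho RintegralD//.
    by rewrite !RintegralZl// -/m1 -/m2 mulNr !mulVf ?gt_eqF// subrr.
  have chi1 t : b <= t -> chi t = 0.
    move=> bt; rewrite -chib /chi; apply: Rintegral_restrict => x /=; rewrite !in_itv/=.
      by move=> /andP[-> h]; rewrite (le_trans h).
    move=> /andP[h1 h2] h3; apply: r0; right; rewrite leNgt; apply/negP => h4; apply: h3.
    by rewrite h1 ltW.
  have dchi t : is_derive t (1 : R) chi (rho t).
    have [h|h] := ltP a t; first exact: prim_derive.
    rewrite r0; last by left; lra.
    have dc : is_derive t (1 : R) (cst (0 : R)) (0 : R) by exact: is_derive_cst.
    apply: (near_eq_is_derive _ dc).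
    have ts : t < s1 by lra.
    by apply: filterS (lt_nbhsl ts) => y hy /=; rewrite chi0// ltW.
  pose dd i := if i is i'.+1 then D i' else chi.
  have Hdd i t : is_derive t (1 : R) (dd i) (dd i.+1 t).
    by case: i => [|i] /=; [rewrite D0; exact: dchi|exact: HD].
  have supp t : dd 0%N t != 0 -> a <= t <= b.
    apply: contraNT; rewrite negb_and -!ltNge /= => /orP[h|h]; apply/eqP.
      by apply: chi0; lra.
    by apply: chi1; exact: ltW.
  have := H dd a b a0 Hdd supp; rewrite /= D0.
  have cchi : continuous chi by apply: is_derive_continuous dchi.
  have wc h : continuous h -> {within `[a, b], continuous h} by exact: within_of_continuous.
  have sub : `[a, b] `<=` (`[0, +oo[ : set R).
    by move=> t /=; rewrite !in_itv/= andbT => /andP[h _]; lra.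
  rewrite (Rintegral_restrict sub); last first.
    move=> t _ /= ; rewrite in_itv/= => /negP; rewrite negb_and -!ltNge => /orP[h|h].
      by rewrite r0 ?chi0 ?mul0r ?subrr//; [lra|left; lra].
    by rewrite r0 ?chi1 ?mul0r ?subrr//; [exact: ltW|right; exact: ltW].
  have iP := integrable_within (within_mul (wc _ cr) (wc _ cP)).
  have iQ := integrable_within (within_mul (wc _ cchi) (wc _ cQ)).
  have iW := integrable_within (within_mul (wc _ cr) cW).
  rewrite RintegralB// => eq1.
  (* The integral of the derivative of [chi] W vanishes because [chi] is zero at both ends; this
     trades Q for W. *)
  have eq2 : \int[mu]_(t in `[a, b]) (chi t * Q t + rho t * W t) = 0.
    have cQW : {within `[a, b], continuous (fun t => chi t * Q t + rho t * W t)}.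
      exact: within_add (within_mul (wc _ cchi) (wc _ cQ)) (within_mul (wc _ cr) cW).
    have := @ftc_on _ (fun t => chi t * W t) a b ab cQW.
    rewrite chib chi0 ?mul0r ?subrr//; last exact: ltW.
    apply=> t /andP[h _]; have := @is_deriveM R R chi W t 1 _ _ (dchi t) (dW t h).
    rewrite [X in is_derive _ _ _ X](_ : _ = chi t * Q t + rho t * W t)//.
    by rewrite /GRing.scale/= [X in _ + X]mulrC.
  rewrite RintegralD// in eq2.
  have iG s : mu.-integrable (`[a, b] : set R) (EFin \o (fun t => bump s d t * G t)).
    by apply: integrable_within; apply: within_mul => //; apply: wc; exact/sm_continuous/sm_bump.
  have eq3 : m1^-1 * (\int[mu]_(t in `[a, b]) (bump s1 d t * G t)) -
      m2^-1 * (\int[mu]_(t in `[a, b]) (bump s2 d t * G t)) = 0.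
    transitivity (\int[mu]_(t in `[a, b]) (rho t * P t) + \int[mu]_(t in `[a, b]) (rho t * W t)); last first.
      by move: eq1 eq2; lra.
    rewrite -RintegralD// -!RintegralZl// -RintegralB//.
    - by apply: eq_Rintegral => t _; rewrite /rho /G; ring.
    - have := @integrableZl _ _ R mu `[a, b] _ (m1^-1) _ (iG s1); exact.
    - have := @integrableZl _ _ R mu `[a, b] _ (m2^-1) _ (iG s2); exact.
  have b1 := @bump_concentrate s1 d a b G (e / 2) as1 d0 sb1 cG _.
  have b2 := @bump_concentrate s2 d a b G (e / 2) as2 d0 sb2 cG _.
  have {}b1 : `|m1^-1 * (\int[mu]_(t in `[a, b]) (bump s1 d t * G t)) - G s1| <= e / 2.
    apply: b1 => t /andP[h1 h2]; apply: H1; rewrite h1/=.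
    exact: le_trans h2 (lerD (lexx _) dr1).
  have {}b2 : `|m2^-1 * (\int[mu]_(t in `[a, b]) (bump s2 d t * G t)) - G s2| <= e / 2.
    apply: b2 => t /andP[h1 h2]; apply: H2; rewrite h1/=.
    exact: le_trans h2 (lerD (lexx _) dr2).
  move: b1 b2 eq3; move: (m1^-1 * _) (m2^-1 * _) => u v.
  rewrite !ler_norml => /andP[? ?] /andP[? ?] ?; apply/andP; split; lra.
move=> t t0; pose s := t / 2; have s0 : 0 < s by rewrite divr_gt0.
have st : s < t by rewrite /s; lra.
apply: (@near_eq_is_derive _ _ _ (fun x => P s - \int[mu]_(y in `[s, x]) Q y)).
  by apply: filterS (lt_nbhsr st) => x sx; have := key s x s0 sx; lra.
have := @is_deriveB R R R (cst (P s)) _ t 1 _ _ (is_derive_cst _ _ _) (@prim_derive R Q s t cQ st).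
by rewrite sub0r.
Qed.

End DuBoisReymond.

(** * The bilinear form on H^2 *)

Section BilinearH2.
Context {R : realType}.
Variable nu : R.
Hypothesis nu0 : 0 < nu.
Implicit Types (z : bool -> nat -> R) (X D : nat -> R) (n J : nat) (B al be : R).
Local Notation lam := (lam nu).
Local Notation ker := (ker nu).

Definition S4 z B := forall N, \sum_(n < N) n%:R ^+ 4 * (z true n ^+ 2 + z false n ^+ 2) <= B.
Definition az z n := `|z true n| + `|z false n|.

Lemma az_ge0 z n : 0 <= az z n. Proof. by rewrite addr_ge0. Qed.

Lemma norm_az z c n : `|z c n| <= az z n.
Proof. by case: c; rewrite /az ?lerDl ?lerDr. Qed.

Lemma S4_ge0 z B : S4 z B -> 0 <= B.
Proof. by move=> /(_ 0%N); rewrite big_ord0. Qed.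

Lemma S4_az z B : S4 z B -> forall N, \sum_(n < N) n%:R ^+ 4 * az z n ^+ 2 <= 2 * B.
Proof.
move=> H N; apply: (@le_trans _ _ (2 * \sum_(n < N) n%:R ^+ 4 * (z true n ^+ 2 + z false n ^+ 2))).
  rewrite mulr_sumr; apply: ler_sum => n _; rewrite [leRHS]mulrCA; apply: ler_wpM2l; first exact: exprn_ge0.
  rewrite /az -[z true n ^+ 2](real_normK (num_real _)) -[z false n ^+ 2](real_normK (num_real _)).
  by have := sqr_ge0 (`|z true n| - `|z false n|); lra.
by rewrite ler_pM2l.
Qed.

Lemma S4_az2 z z' B B' : S4 z B -> S4 z' B' ->
  forall N, \sum_(n < N) n%:R ^+ 4 * (az z n + az z' n) ^+ 2 <= 4 * (B + B').
Proof.
move=> H H' N; have h := S4_az H N; have h' := S4_az H' N.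
apply: (@le_trans _ _ (2 * (\sum_(n < N) n%:R ^+ 4 * az z n ^+ 2 + \sum_(n < N) n%:R ^+ 4 * az z' n ^+ 2))); last by lra.
rewrite -big_split/= mulr_sumr; apply: ler_sum => n _; rewrite -mulrDr [leRHS]mulrCA.
apply: ler_wpM2l; first exact: exprn_ge0.
by have := sqr_ge0 (az z n - az z' n); lra.
Qed.

Lemma S4_add z z' B B' : S4 z B -> S4 z' B' -> S4 (fun c n => z c n + z' c n) (2 * (B + B')).
Proof.
move=> H H' N; have h := H N; have h' := H' N.
apply: (@le_trans _ _ (2 * (\sum_(n < N) n%:R ^+ 4 * (z true n ^+ 2 + z false n ^+ 2) +
  \sum_(n < N) n%:R ^+ 4 * (z' true n ^+ 2 + z' false n ^+ 2)))); last by lra.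
rewrite -big_split/= mulr_sumr; apply: ler_sum => n _; rewrite -mulrDr [leRHS]mulrCA.
apply: ler_wpM2l; first exact: exprn_ge0.
by have := sqr_ge0 (z true n - z' true n); have := sqr_ge0 (z false n - z' false n); lra.
Qed.

(** This bound grows with [nu] and with n. It serves convergence of the series and continuity in
    time at a fixed frequency, whereas smallness comes from the uniform bounds on [ker]. *)
Lemma lam_prod n j : n%:R * lam j <= n%:R * ((nu + 1) * ((n + j)%:R ^+ 2 * j%:R ^+ 2)).
Proof.
case: n => [|n]; first by rewrite !mul0r.
apply: ler_wpM2l => //.
have h : lam j <= (nu + 1) * j%:R ^+ 3.
  rewrite /lam mulrDl mul1r lerD2l -natrX ler_nat.
  by case: j => [|j]//; rewrite -[X in (X <= _)%N]expn1 leq_pexp2l.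
apply: le_trans h _; apply: ler_wpM2l; first by rewrite addr_ge0// ltW.
rewrite exprS; apply: ler_wpM2r; first exact: sqr_ge0.
rewrite -natrX ler_nat; apply: (@leq_trans (n.+1 + j)); first exact: leq_addl.
by rewrite -[X in (X <= _)%N]expn1 leq_pexp2l.
Qed.

Lemma cs_shift X D al be n J : 0 <= al -> 0 <= be ->
  (forall N, \sum_(m < N) m%:R ^+ 4 * X m ^+ 2 <= al ^+ 2) ->
  (forall N, \sum_(m < N) m%:R ^+ 4 * D m ^+ 2 <= be ^+ 2) ->
  \sum_(j < J) ((n + j)%:R ^+ 2 * `|D (n + j)%N|) * (j%:R ^+ 2 * `|X j|) <= be * al.
Proof.
move=> al0 be0 HX HD; apply: le_sqr_le; first exact: mulr_ge0.
have n4 m (x : R) : 0 <= m%:R ^+ 4 * x ^+ 2 :> R by rewrite mulr_ge0 ?sqr_ge0// exprn_ge0.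
apply: le_trans (@cs_gen R (fun j => (n + j)%:R ^+ 4 * D (n + j)%N ^+ 2) (fun j => j%:R ^+ 4 * X j ^+ 2)
  (fun j => ((n + j)%:R ^+ 2 * `|D (n + j)%N|) * (j%:R ^+ 2 * `|X j|)) J (fun j => n4 _ _) (fun j => n4 _ _) _) _.
  move=> j; rewrite -[D _ ^+ 2](real_normK (num_real _)) -[X _ ^+ 2](real_normK (num_real _)).
  by rewrite le_eqVlt; apply/orP; left; apply/eqP; ring.
rewrite exprMn; apply: ler_pM => //; [by apply: sumr_ge0 => j _|by apply: sumr_ge0 => j _|].
have := @sum_shift_le R (fun m => m%:R ^+ 4 * D m ^+ 2) (be ^+ 2) n (fun m => n4 _ _) HD J.
by under eq_bigr do rewrite addnC.
Qed.

Lemma ker_H2 X D al be n J : 0 <= al -> 0 <= be ->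
  (forall N, \sum_(m < N) m%:R ^+ 4 * X m ^+ 2 <= al ^+ 2) ->
  (forall N, \sum_(m < N) m%:R ^+ 4 * D m ^+ 2 <= be ^+ 2) ->
  lam n * (\sum_(j < J) ker n j * (`|D (n + j)%N| * `|X j| + `|X (n + j)%N| * `|D j|)) <=
    n%:R * ((nu + 1) * (2 * (al * be))).
Proof.
move=> al0 be0 HX HD.
have h1 := cs_shift n J al0 be0 HX HD; have h2 := cs_shift n J be0 al0 HD HX.
have p0 : 0 <= n%:R * (nu + 1) by rewrite mulr_ge0// addr_ge0// ltW.
have := ler_wpM2l p0 (lerD h1 h2).
rewrite (_ : n%:R * (nu + 1) * (be * al + al * be) = n%:R * ((nu + 1) * (2 * (al * be)))); last by ring.
apply: le_trans; rewrite -big_split/= !mulr_sumr; apply: ler_sum => j _.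
rewrite mulrA lam_ker//.
set x := `|D (n + j)%N| * `|X j| + `|X (n + j)%N| * `|D j|.
have x0 : 0 <= x by rewrite addr_ge0// mulr_ge0.
apply: le_trans (ler_wpM2r x0 (lam_prod n j)) _.
by rewrite le_eqVlt; apply/orP; left; apply/eqP; rewrite /x; ring.
Qed.

Definition HBn z b n : R := limn (fun J => Bn nu z b J n).

Lemma HBn_cvg z B b n : S4 z B -> Bn nu z b J n @[J --> \oo] --> HBn z b n.
Proof.
move=> H; have B0 := S4_ge0 H.
have al0 : 0 <= Num.sqrt (2 * B) by exact: sqrtr_ge0.
have Hz N : \sum_(m < N) m%:R ^+ 4 * az z m ^+ 2 <= Num.sqrt (2 * B) ^+ 2.
  by rewrite sqr_sqrtr ?mulr_ge0//; exact: S4_az H N.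
pose e j := lam n * (ker n j * az z (n + j)%N * az z j).
have e0 j : 0 <= e j.
  apply: mulr_ge0; first exact: lam_ge0.
  by apply: mulr_ge0; [apply: mulr_ge0; [exact: ker_ge0|exact: az_ge0]|exact: az_ge0].
have eB N : \sum_(j < N) e j <= n%:R * ((nu + 1) * (2 * (Num.sqrt (2 * B) * Num.sqrt (2 * B)))).
  apply: le_trans (ker_H2 n N al0 al0 Hz Hz); rewrite -mulr_sumr; apply: ler_wpM2l; first exact: lam_ge0.
  apply: ler_sum => j _; rewrite -mulrA; apply: ler_wpM2l; first exact: ker_ge0.
  by rewrite !ger0_norm ?az_ge0// lerDl mulr_ge0// az_ge0.
apply: cauchy_tail_cvg => eps eps0.
have [N HN] := tail_small e0 eB eps0; exists N => k k' Nk kk'.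
apply: le_trans (HN k k' Nk kk').
have := @norm_BnT R nu nu0 z (az z) 1 b k k' n kk' ler01 (az_ge0 z) (norm_az z) _.
rewrite mulr1 => h; apply: le_trans (h _) _ => [c m _|]; first by rewrite mulr1; exact: norm_az.
rewrite mulr_sumr -(big_mkord xpredT e) -(big_mkord xpredT e) (big_cat_nat (leq0n k) kk')/=.
by rewrite addrAC subrr add0r.
Qed.

Lemma HBn_diff z z' B B' b n (K : R) : S4 z B -> S4 z' B' ->
  (forall J, `|Bn nu z b J n - Bn nu z' b J n| <= K) -> `|HBn z b n - HBn z' b n| <= K.
Proof.
move=> H H' HK; rewrite -(subr0 (HBn z b n - _)).
have cv : Bn nu z b J n - Bn nu z' b J n @[J --> \oo] --> HBn z b n - HBn z' b n.
  by apply: cvgB; [exact: HBn_cvg H|exact: HBn_cvg H'].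
by apply: (norm_lim_le cv); exists 0%N => k _; rewrite subr0.
Qed.

Lemma HBn_lip z z' B B' E b n : S4 z B -> S4 z' B' -> S4 (fun c m => z c m - z' c m) E ->
  `|HBn z b n - HBn z' b n| <= n%:R * ((nu + 1) * (2 * (Num.sqrt (4 * (B + B')) * Num.sqrt (2 * E)))).
Proof.
move=> H H' HE; apply: (HBn_diff H H') => J.
have B0 := S4_ge0 H; have B'0 := S4_ge0 H'; have E0 := S4_ge0 HE.
have X0 m : 0 <= az z m + az z' m by rewrite addr_ge0 ?az_ge0.
have := @norm_BnB R nu nu0 z z' (fun m => az z m + az z' m) (az (fun c m => z c m - z' c m)) 1 b J n ler01 X0 (az_ge0 _) _ _ _ _.
rewrite mulr1 => h; apply: le_trans (h _ _ _ _) _.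
- by move=> c m; apply: le_trans (norm_az z c m) _; rewrite lerDl az_ge0.
- by move=> c m _; rewrite mulr1; apply: le_trans (norm_az z' c m) _; rewrite lerDr az_ge0.
- by move=> c m; exact: (norm_az (fun c m => z c m - z' c m)).
- by move=> c m _; rewrite mulr1; exact: (norm_az (fun c m => z c m - z' c m)).
apply: (@ker_H2 (fun m => az z m + az z' m) (az (fun c m => z c m - z' c m))); [exact: sqrtr_ge0|exact: sqrtr_ge0| |].
- by move=> N; rewrite sqr_sqrtr ?mulr_ge0 ?addr_ge0//; exact: S4_az2.
- by move=> N; rewrite sqr_sqrtr ?mulr_ge0//; exact: S4_az.
Qed.

End BilinearH2.

(** * The coefficients of an arbitrary solution satisfy the system *)

Section SolutionCoefs.
Context {R : realType}.
Implicit Types (s t x : R) (c : bool) (n : nat).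
Local Notation mu := (@lebesgue_measure R).
Local Notation intc u := (mu.-integrable (@circle R) (EFin \o u)).
Local Notation J u := (\int[mu]_(x in @circle R) u x).

Lemma S4_ext (z z' : bool -> nat -> R) B : (forall c n, z c n = z' c n) -> S4 z B -> S4 z' B.
Proof. by move=> E H N; under eq_bigr do rewrite -!E; exact: H. Qed.

Lemma S4_le (z : bool -> nat -> R) B B' : B <= B' -> S4 z B -> S4 z B'.
Proof. by move=> BB H N; exact: le_trans (H N) BB. Qed.

Lemma S4_term (z : bool -> nat -> R) B c n : (0 < n)%N -> S4 z B -> z c n ^+ 2 <= B.
Proof.
move=> n0 H; apply: le_trans (H n.+1); rewrite big_ord_recr/=.
have n4 m : 0 <= m%:R ^+ 4 * (z true m ^+ 2 + z false m ^+ 2) :> R.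
  by rewrite mulr_ge0 ?exprn_ge0// addr_ge0 ?sqr_ge0.
apply: (@le_trans _ _ (n%:R ^+ 4 * (z true n ^+ 2 + z false n ^+ 2))); last first.
  by rewrite lerDr; apply: sumr_ge0 => i _.
apply: (@le_trans _ _ (z true n ^+ 2 + z false n ^+ 2)).
  by case: c; rewrite ?lerDl ?lerDr sqr_ge0.
by apply: ler_peMl; [rewrite addr_ge0 ?sqr_ge0|rewrite expr_ge1// ler1n].
Qed.

Lemma coefB u v c n : intc u -> intc v -> coef (fun x => u x - v x) c n = coef u c n - coef v c n.
Proof. by move=> iu iv; case: c; [exact: ccB|exact: ssB]. Qed.

Lemma sobolev_S4 (u : R -> R) (e : R) : intc u -> 0 <= e -> (sobolev_norm 2 u <= e%:E)%E ->
  S4 (coef u) (pi * e ^+ 2).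
Proof.
move=> iu e0 H N.
have H2 : (sobolev_norm 2 u ^+ 2 <= (e ^+ 2)%:E)%E.
  by rewrite EFin_expe lee_sqr ?sobolev_norm_ge0.
rewrite sobolev_norm_sqr// in H2.
have g0 k : 0 <= pi^-1 * k%:R `^ (2 * 2) * sq u k.
  by rewrite !mulr_ge0 ?powR_ge0 ?sq_ge0// invr_ge0 pi_ge0.
have := le_trans (nneseries_ge N g0) H2; rewrite lee_fin.
rewrite -(ler_pM2l (pi_gt0 R)); apply: le_trans; rewrite mulr_sumr; apply: ler_sum => n _.
by rewrite powR4 -mulrA mulVKf ?gt_eqF ?pi_gt0//; exact: lexx.
Qed.

Lemma sobolev_S4_ex (u : R -> R) : sobolev 2 u -> exists B, S4 (coef u) B.
Proof.
move=> [lu _ H]; have n0 := sobolev_norm_ge0 2 u.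
exists (pi * fine (sobolev_norm 2 u) ^+ 2); apply: sobolev_S4; [exact: L2T_int|exact: fine_ge0|].
by rewrite fineK// ge0_fin_numE.
Qed.

Lemma sobolev72_H3 (u : R -> R) : sobolev (7 / 2) u -> exists B, forall N, \sum_(n < N) n%:R ^+ 6 * sq u n <= B.
Proof.
move=> [lu _ H]; have iu := L2T_int lu.
have s0 : 7 / 2 != 0 :> R by rewrite gt_eqF.
rewrite sqre_lty ?sobolev_norm_ge0// sobolev_norm_sqr// in H.
have g0 k : 0 <= pi^-1 * k%:R `^ (2 * (7 / 2)) * sq u k.
  by rewrite !mulr_ge0 ?powR_ge0 ?sq_ge0// invr_ge0 pi_ge0.
have [S [S0 [_ HS]]] := nneseries_fin_bound g0 H.
exists (pi * S) => N; apply: le_trans (ler_wpM2l (pi_ge0 R) (HS N)).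
rewrite mulr_sumr; apply: ler_sum => n _; rewrite powR7 -mulrA mulVKf ?gt_eqF ?pi_gt0//.
apply: ler_wpM2r; first exact: sq_ge0.
by case: (nat_of_ord n) => [|m]; [rewrite !expr0n|apply: ler_weXn2l => //; rewrite ler1n].
Qed.

Variables (nu : R) (g : R -> R -> R).
Hypothesis nu0 : 0 < nu.
Hypothesis gC : C_sobolev 2 g.
Hypothesis gL : L2_sobolev (7 / 2) g.
Hypothesis gD : distributional_solution nu g.

Lemma g_L2T t : 0 <= t -> L2T (g t).
Proof. by move=> t0; have [] := gC.1 t t0. Qed.

Lemma g_int t : 0 <= t -> intc (g t).
Proof. by move=> t0; exact: L2T_int (g_L2T t0). Qed.

Lemma g_cc0 t : 0 <= t -> cc (g t) 0 = 0.
Proof. by move=> t0; have [_ h _] := gC.1 t t0; rewrite cc0. Qed.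

Lemma g_S4 t : 0 <= t -> exists B, S4 (coef (g t)) B.
Proof. by move=> t0; exact: sobolev_S4_ex (gC.1 t t0). Qed.

Lemma g_near t0 (eps : R) : 0 <= t0 -> 0 < eps -> exists r, 0 < r /\
  forall t, 0 <= t -> `|t - t0| < r -> S4 (fun c n => coef (g t) c n - coef (g t0) c n) eps.
Proof.
move=> t00 e0; pose e := Num.sqrt (eps / pi).
have p0 := pi_gt0 R.
have ee : 0 < e by rewrite sqrtr_gt0 divr_gt0.
have /fine_cvgP[_ /cvgrPdist_le/(_ _ ee)] := gC.2 t0 t00.
have /fine_cvgP[+ _] := gC.2 t0 t00.
rewrite !near_withinE => -[r1 /= r10 H1] [r2 /= r20 H2].
exists (Num.min r1 r2); split; first by rewrite lt_min r10.
move=> t tt0; rewrite lt_min => /andP[h1 h2].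
have tI : `[0, +oo[%classic t by rewrite /= in_itv/= andbT.
have b1 : `|t0 - t| < r1 by rewrite distrC.
have b2 : `|t0 - t| < r2 by rewrite distrC.
have f1 := H1 t b1 tI; have := H2 t b2 tI.
rewrite sub0r normrN /= => f2.
have it := g_int tt0; have it0 := g_int t00.
have : S4 (coef (fun x => g t x - g t0 x)) (pi * e ^+ 2).
  apply: sobolev_S4; [exact: intcB|exact: ltW|].
  rewrite -(fineK f1) lee_fin; apply: le_trans f2; exact: ler_norm.
rewrite /e sqr_sqrtr; last by rewrite divr_ge0// ltW.
rewrite mulrCA divff ?gt_eqF// mulr1; apply: S4_ext => c n.
by rewrite coefB.
Qed.

Lemma coef_g0 c t : 0 <= t -> coef (g t) c 0 = 0.
Proof. by move=> t0; case: c; [exact: g_cc0|exact: ss0]. Qed.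

(** The even extension in time yields functions continuous on the whole line, the form in which
    [du_bois_reymond] takes them. *)
Lemma coef_continuous c n : continuous (fun t => coef (g `|t|) c n).
Proof.
move=> t0; case: n => [|n].
  rewrite (_ : (fun _ => _) = (fun _ => 0)); first exact: continuous_cst.
  by apply/funext => t; exact: coef_g0.
apply/cvgrPdist_le => e e0; have e2 : 0 < e ^+ 2 by rewrite exprn_gt0.
have [r [r0 Hr]] := g_near (normr_ge0 t0) e2.
exists r => // t /= h; rewrite distrC.
have hr : `| `|t| - `|t0| | < r.
  by apply: le_lt_trans (ler_dist_dist _ _) _; rewrite distrC.
have := S4_term c (ltn0Sn n) (Hr _ (normr_ge0 t) hr).
by rewrite -(real_normK (num_real _)) ler_sqr ?nnegrE// ltW.
Qed.

Lemma HBn_continuous c n : continuous (fun t => HBn nu (coef (g `|t|)) c n).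
Proof.
move=> t0; have [B HB] := g_S4 (normr_ge0 t0); have B0 := S4_ge0 HB.
pose K := n%:R * ((nu + 1) * (2 * Num.sqrt (4 * (2 * (1 + B) + B)))).
have K0 : 0 <= K by rewrite !mulr_ge0 ?sqrtr_ge0// addr_ge0// ltW.
apply/cvgrPdist_le => eps eps0.
(* The bound e <= 1 keeps g near the reference time below 2 (1 + B), on which K rests. A
   perturbation of size e^2 / 2 then contributes sqrt (2 (e^2 / 2)) = e. *)
pose e := Num.min 1 (eps / (K + 1)).
have K1 : 0 < K + 1 by rewrite ltr_pwDr.
have e0 : 0 < e by rewrite lt_min ltr01 divr_gt0.
have e1 : e <= 1 by rewrite ge_min lexx.
have ek : K * e <= eps.
  apply: (@le_trans _ _ (K * (eps / (K + 1)))); first by apply: ler_wpM2l => //; rewrite ge_min lexx orbT.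
  exact: (scale_tail K0 eps0).2.
have E0 : 0 < e ^+ 2 / 2 by rewrite divr_gt0// exprn_gt0.
have [r [r0 Hr]] := g_near (normr_ge0 t0) E0.
exists r => // t /= h; rewrite distrC.
have hr : `| `|t| - `|t0| | < r by apply: le_lt_trans (ler_dist_dist _ _) _; rewrite distrC.
have HE := Hr _ (normr_ge0 t) hr.
have HE1 : S4 (fun c n => coef (g `|t|) c n - coef (g `|t0|) c n) 1.
  apply: S4_le HE; have : e ^+ 2 <= 1 by rewrite exprn_ile1// ltW.
  by lra.
have HBt : S4 (coef (g `|t|)) (2 * (1 + B)).
  by apply: S4_ext (S4_add HE1 HB) => d m; rewrite subrK.
apply: le_trans (HBn_lip nu0 c n HBt HB HE) _; apply: le_trans ek.
rewrite (_ : 2 * (e ^+ 2 / 2) = e ^+ 2); last by field.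
rewrite sqrtr_sqr ger0_norm; last exact: ltW.
by rewrite /K !mulrA; exact: lexx.
Qed.

Section Test.
Variables (c : bool) (n : nat) (d : nat -> R -> R) (a b : R).
Hypothesis n0 : (0 < n)%N.
Hypothesis a0 : 0 < a.
Hypothesis dd : forall i t, is_derive t (1 : R) (d i) (d i.+1 t).
Hypothesis supp : forall t, d 0%N t != 0 -> a <= t <= b.

(** The phase selects cosine or sine. Each derivative adds pi / 2 to it and a factor n, so one
    formula gives the derivatives of all orders. *)
Let be : R := if c then 0 else - (pi / 2).
Let tr (j : nat) x : R := n%:R ^+ j * cos (n%:R * x + (be + j%:R * (pi / 2))).

Let tr0 x : tr 0 x = if c then cos (n%:R * x) else sin (n%:R * x).
Proof. by rewrite /tr expr0 mul1r mul0r addr0 /be; case: c; rewrite -?cosl_cos -?sinl_cos. Qed.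

Let tr1 x : tr 1 x = n%:R * (if c then - sin (n%:R * x) else cos (n%:R * x)).
Proof.
rewrite /tr expr1 mul1r /be; case: c; first by rewrite add0r cosDpihalf.
by rewrite addNr addr0.
Qed.

Let is_derive_tr j x : is_derive x (1 : R) (tr j) (tr j.+1 x).
Proof.
have dl : is_derive x (1 : R) (fun y : R => n%:R * y + (be + j%:R * (pi / 2))) n%:R.
  have dc : is_derive x (1 : R) (fun s : R => n%:R * s) n%:R.
    by have := @is_deriveZ R R R id n%:R x 1 1 (is_derive_id _ _); rewrite /GRing.scale/= mulr1.
  by have := @is_deriveD R R R _ (cst (be + j%:R * (pi / 2))) x 1 _ _ dc (is_derive_cst _ _ _); rewrite addr0.
have h := @is_derive1_comp R cos (fun y => n%:R * y + (be + j%:R * (pi / 2))) x _ _ (is_derive_cos _) dl.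
have := @is_deriveZ R R R _ (n%:R ^+ j) x 1 _ h.
rewrite [X in is_derive _ _ _ X](_ : _ = tr j.+1 x)//.
have e : n%:R * x + (be + j.+1%:R * (pi / 2)) = (n%:R * x + (be + j%:R * (pi / 2))) + pi / 2.
  by rewrite -[j.+1%:R]natr1 [(j%:R + 1) * _]mulrDl mul1r !addrA.
rewrite /tr /GRing.scale/= exprSr e cosDpihalf.
by rewrite -mulrA [n%:R * - _]mulrC.
Qed.

Lemma trig_test : test_function (fun t x => d 0%N t * tr 0 x).
Proof.
split.
- exists (fun i j t x => d i t * tr j x); split => // i j; split.
    move=> p; apply: (@continuousM R (R * R)%type (fun p => d i p.1) (fun p => tr j p.2) p).
      apply: (@continuous_comp _ _ _ (fun p : R * R => p.1) (d i) p); first exact: cvg_fst.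
      by have [d1 _] := dd i p.1; apply: differentiable_continuous; exact/derivable1_diffP.
    apply: (@continuous_comp _ _ _ (fun p : R * R => p.2) (tr j) p); first exact: cvg_snd.
    by have [d1 _] := is_derive_tr j p.2; apply: differentiable_continuous; exact/derivable1_diffP.
  move=> t x; split.
    have := @is_deriveM R R (d i) (cst (tr j x)) t 1 _ _ (dd i t) (is_derive_cst _ _ _).
    by rewrite [X in is_derive _ _ _ X](_ : _ = d i.+1 t * tr j x)// /GRing.scale/= mulr0 add0r mulrC.
  exact: (@is_deriveZ R R R _ (d i t) x 1 _ (is_derive_tr j x)).
- move=> t x; rewrite !tr0 mulrDr.
  have e : n%:R * (pi *+ 2) = (pi *+ 2) *+ n :> R by rewrite mulr_natl.
  by rewrite e; case: c; rewrite ?(periodicn (@cosD2pi R)) ?(periodicn (@sinD2pi R)).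
- exists a, b; split => // t x; rewrite mulf_eq0 negb_or => /andP[h _]; exact: supp.
Qed.

Lemma trig_inner t : 0 <= t -> sobolev (7 / 2) (g t) ->
  J (fun x => let w := fun y => nu * Lambda 3 (g t) y + Lambda 1 (g t) y in
       g t x * derive1 (fun t' => d 0%N t' * tr 0 x) t - w x * (d 0%N t * tr 0 x)
       - hilbert_comm (g t) w x * derive1 (fun x => d 0%N t * tr 0 x) x) =
  d 1%N t * coef (g t) c n - d 0%N t * (lam nu n * coef (g t) c n - HBn nu (coef (g t)) c n).
Proof.
move=> t0 H72; have [B HB] := sobolev72_H3 H72.
have lg := g_L2T t0; have ig := L2T_int lg.
have [lw cw sw] := flux_w_spec nu lg HB.
have lN := flux_N_L2T nu lg HB.
have [h1 h2] := flux_N_spec nu lg (g_cc0 t0) HB n0.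
have [B4 HB4] := g_S4 t0.
have e1 x : derive1 (fun t' => d 0%N t' * tr 0 x) t = d 1%N t * tr 0 x.
  have := @is_deriveM R R (d 0%N) (cst (tr 0 x)) t 1 _ _ (dd 0 t) (is_derive_cst _ _ _).
  by rewrite derive1E => -[_ ->]; rewrite /GRing.scale/= mulr0 add0r mulrC.
have e2 x : derive1 (fun x => d 0%N t * tr 0 x) x = d 0%N t * tr 1 x.
  by rewrite derive1E; have [_ ->] := @is_deriveZ R R R _ (d 0%N t) x 1 _ (is_derive_tr 0 x).
pose e : R -> R := fun x => if c then cos (n%:R * x) else sin (n%:R * x).
pose e' : R -> R := fun x => if c then sin (n%:R * x) else cos (n%:R * x).
pose sg : R := if c then - n%:R else n%:R.
have Je u : intc u -> intc (fun x => u x * e x).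
  by move=> iu; rewrite /e; case: c; [exact: intc_cos|exact: intc_sin].
have Je' u : intc u -> intc (fun x => u x * e' x).
  by move=> iu; rewrite /e'; case: c; [exact: intc_sin|exact: intc_cos].
transitivity (J (fun x => (d 1%N t * (g t x * e x) - d 0%N t * (flux_w nu (g t) x * e x))
   - (d 0%N t * sg) * (flux_N nu (g t) x * e' x))).
  apply: eq_Rintegral => x _ /=; rewrite e1 e2 tr0 tr1 -/(flux_w nu (g t) x) -/(flux_N nu (g t) x) /e /e' /sg.
  by rewrite /flux_N /flux_w; case: c; ring.
have i1 := intcZ (d 1%N t) (Je _ ig); have i2 := intcZ (d 0%N t) (Je _ (L2T_int lw)).
have i3 := intcZ (d 0%N t * sg) (Je' _ (L2T_int lN)).
rewrite (@JB _ (fun x => d 1%N t * (g t x * e x) - d 0%N t * (flux_w nu (g t) x * e x)))//; last exact: intcB.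
rewrite (@JB _ (fun x => d 1%N t * (g t x * e x)))// !JZ ?Je ?Je' ?L2T_int//.
have -> : J (fun x => g t x * e x) = coef (g t) c n by rewrite /e /coef; case: c.
have -> : J (fun x => flux_w nu (g t) x * e x) = lam nu n * coef (g t) c n.
  by rewrite /e /coef; case: c; [exact: cw|exact: sw].
have hc := @HBn_cvg R nu nu0 (coef (g t)) B4 c n HB4.
have -> : HBn nu (coef (g t)) c n = - (sg * J (fun x => flux_N nu (g t) x * e' x)).
  move: hc; rewrite /sg /e'; case: c => hc.
    by rewrite mulNr opprK; exact: (cvg_unique _ hc h1).
  exact: (cvg_unique _ hc h2).
by ring.
Qed.

(** The inner integral is evaluated only when g t lies in H^(7/2), hence for almost every t; the
    values at the other times do not affect the outer integral. *)
Lemma trig_tested : \int[mu]_(t in `[0, +oo[) (d 1%N t * coef (g `|t|) c n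
   - d 0%N t * (lam nu n * coef (g `|t|) c n - HBn nu (coef (g `|t|)) c n)) = 0.
Proof.
rewrite -[RHS](gD trig_test); apply: ae_Rintegral_eq; have [_ H _] := gL.
apply: aeS H => t H; rewrite /= in_itv/= andbT => t0.
by rewrite ger0_norm// -trig_inner//; exact: H.
Qed.

End Test.

Lemma coef_ode c n t : (0 < n)%N -> 0 < t -> is_derive t (1 : R) (fun t => coef (g `|t|) c n)
  (- (lam nu n * coef (g `|t|) c n) + HBn nu (coef (g `|t|)) c n).
Proof.
move=> n0 t0.
pose P t := coef (g `|t|) c n.
pose Q t := lam nu n * coef (g `|t|) c n - HBn nu (coef (g `|t|)) c n.
have cQ : continuous Q.
  move=> s; have h1 := continuous_mul (@continuous_cst R (lam nu n) s) (@coef_continuous c n s).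
  exact: (@continuousB R R R _ _ s h1 (@HBn_continuous c n s)).
have := @du_bois_reymond R P Q (@coef_continuous c n) cQ _ t t0.
rewrite /Q opprB addrC; apply => d a b a0 dd supp.
exact: (@trig_tested c n d a b n0 a0 dd supp).
Qed.

End SolutionCoefs.

(** * Uniqueness *)

Section Uniqueness.
Context {R : realType}.
Implicit Types (s t x T : R) (c : bool) (n : nat).
Local Notation mu := (@lebesgue_measure R).
Variables (nu A : R) (z0 : bool -> nat -> R) (Y : nat -> R) (z F : bool -> nat -> R -> R) (g : R -> R -> R).
Hypothesis nu0 : 0 < nu.
Hypothesis A0 : 0 <= A.
Hypothesis A200 : A <= 200^-1.
Hypothesis z00 : forall b, z0 b 0%N = 0.
Hypothesis cs : coef_solution nu A z0 Y z F.
Hypothesis gC : C_sobolev 2 g.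
Hypothesis gL : L2_sobolev (7 / 2) g.
Hypothesis gD : distributional_solution nu g.
Hypothesis g0 : forall c n, coef (g 0) c n = z0 c n.

Lemma z_S4 t : 0 <= t -> S4 (fun c n => z c n t) (8 * A ^+ 2).
Proof.
move=> t0 N; apply: (@le_trans _ _ (2 * \sum_(n < N) n%:R ^+ 4 * Y n ^+ 2)).
  rewrite mulr_sumr; apply: ler_sum => n _; rewrite [leRHS]mulrCA; apply: ler_wpM2l; first exact: exprn_ge0.
  exact: (sqz_le nu0 cs).
by have := cs_Y_sum cs N; rewrite exprMn; lra.
Qed.

Lemma F_HBn c n t : 0 <= t -> F c n t = HBn nu (fun c n => z c n t) c n.
Proof.
move=> t0; have h1 := @cs_series _ _ _ _ _ _ _ cs c n t t0.
have h2 := @HBn_cvg R nu nu0 (fun c n => z c n t) _ c n (z_S4 t0).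
exact: (cvg_unique _ h1 h2).
Qed.

Definition dzg c n t := z c n t - coef (g t) c n.

Lemma dzg0 c t : 0 <= t -> dzg c 0 t = 0.
Proof. by move=> t0; rewrite /dzg (cs_z0 z00 cs)// (coef_g0 gC)// subrr. Qed.

(** [ker_diff] with A = 1/12 bounds the forcing of the difference by lam_n times 6 (1/12) = 1/2 of
    the old bound, and [const_bound] passes this on to the difference, which starts from zero. *)
Lemma halving T (B M : R) : 0 <= M -> 4 * (8 * A ^+ 2 + B) <= (12^-1) ^+ 2 ->
  (forall t, 0 <= t <= T -> S4 (coef (g t)) B) ->
  (forall t c n, 0 <= t <= T -> n%:R ^+ 2 * `|dzg c n t| <= M) ->
  forall t c n, 0 <= t <= T -> n%:R ^+ 2 * `|dzg c n t| <= M / 2.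
Proof.
move=> M0 HA HB HM t c n /andP[t0 tT].
case: n => [|n]; first by rewrite expr0n/= mul0r divr_ge0.
pose v : R := (n.+1%:R ^+ 2)^-1 * (M / 2).
have n2 : 0 < n.+1%:R ^+ 2 :> R by rewrite exprn_gt0// ltr0n.
suff : `|z c n.+1 t - coef (g `|t|) c n.+1| <= v.
  by rewrite (ger0_norm t0) => h; rewrite -ler_pdivlMl.
have := @const_bound R (lam nu n.+1) t (fun t => z c n.+1 t - coef (g `|t|) c n.+1)
  (fun t => F c n.+1 t - HBn nu (coef (g `|t|)) c n.+1) v t0; apply.
- apply: within_sub; first exact: (cs_within cs).
  by apply: within_of_continuous; exact: (coef_continuous gC).
- move=> s /andP[s0 _].
  have := @is_deriveB R R R _ _ s 1 _ _ (@cs_derive _ _ _ _ _ _ _ cs c n.+1 s (ltW s0))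
    (@coef_ode R nu g nu0 gC gL gD c n.+1 s isT s0).
  rewrite [X in is_derive _ _ _ X](_ : _ = - (lam nu n.+1 * (z c n.+1 s - coef (g `|s|) c n.+1)) +
    (F c n.+1 s - HBn nu (coef (g `|s|)) c n.+1))//; ring.
- move=> s /andP[s0 st]; have sT : 0 <= s <= T by rewrite (ltW s0) (le_trans (ltW st) tT).
  rewrite (@F_HBn c n.+1 s (ltW s0)) (gtr0_norm s0).
  have Hz := z_S4 (ltW s0); have Hg := HB s sT.
  apply: (HBn_diff nu0 Hz Hg) => J.
  pose X m := az (fun c n => z c n s) m + az (coef (g s)) m.
  pose D m : R := (m%:R ^+ 2)^-1 * M.
  have X0 m : 0 <= X m by rewrite addr_ge0 ?az_ge0.
  have D0 m : 0 <= D m by rewrite mulr_ge0// invr_ge0 sqr_ge0.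
  have dD d m : `|z d m s - coef (g s) d m| <= D m.
    case: m => [|m]; first by rewrite -/(dzg d 0 s) dzg0 ?normr0// ltW.
    by rewrite /D ler_pdivlMl ?exprn_gt0 ?ltr0n//; exact: HM.
  have := @norm_BnB R nu nu0 (fun c n => z c n s) (coef (g s)) X D 1 c J n.+1 ler01 X0 D0 _ _ _ _.
  rewrite mulr1 => h; apply: le_trans (h _ _ _ _) _.
  + by move=> d m; apply: le_trans (norm_az (fun c n => z c n s) d m) _; rewrite lerDl az_ge0.
  + by move=> d m _; rewrite mulr1; apply: le_trans (norm_az (coef (g s)) d m) _; rewrite lerDr az_ge0.
  + by move=> d m; exact: dD.
  + by move=> d m _; rewrite mulr1; exact: dD.
  apply: ler_wpM2l; first exact: lam_ge0.
  rewrite /v ler_pdivlMl//.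
  have a12 : 0 <= 12^-1 :> R by [].
  have HX N : \sum_(m < N) m%:R ^+ 4 * X m ^+ 2 <= (12^-1) ^+ 2.
    exact: le_trans (S4_az2 Hz Hg N) HA.
  have HD m : m%:R ^+ 2 * `|D m| <= M.
    rewrite ger0_norm// /D; case: m => [|m]; first by rewrite expr0n/= mul0r.
    by rewrite mulVKf// expf_neq0// pnatr_eq0.
  apply: le_trans (@ker_diff R nu nu0 X D J (12^-1) M n.+1 a12 M0 HX HD) _.
  by rewrite le_eqVlt; apply/orP; left; apply/eqP; field.
- by rewrite normr0 (cs_init cs) g0 subrr normr0 mulr_ge0 ?invr_ge0 ?sqr_ge0// divr_ge0.
Qed.

Lemma agree_small T (B : R) : 4 * (8 * A ^+ 2 + B) <= (12^-1) ^+ 2 ->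
  (forall t, 0 <= t <= T -> S4 (coef (g t)) B) ->
  forall t c n, 0 <= t <= T -> dzg c n t = 0.
Proof.
move=> HA HB t c n tT; have t0 : 0 <= t by case/andP: tT.
case: n => [|n]; first exact: dzg0.
have P k : forall t c n, 0 <= t <= T -> n%:R ^+ 2 * `|dzg c n t| <= (2^-1) ^+ k.
  (* The smallness hypothesis itself provides the starting bound 1, since (1/12)^2 <= 1. *)
  elim: k => [|k IH] s d m sT.
    have s0 : 0 <= s by case/andP: sT.
    have B0 := S4_ge0 (HB s sT).
    have h1 : `|dzg d m s| <= az (fun c n => z c n s) m + az (coef (g s)) m.
      apply: le_trans (ler_normB _ _) _; apply: lerD; first exact: (norm_az (fun c n => z c n s)).
      exact: norm_az.
    have := S4_az2 (z_S4 s0) (HB s sT) m.+1; rewrite big_ord_recr/= => h2.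
    have h3 : m%:R ^+ 4 * (az (fun c n => z c n s) m + az (coef (g s)) m) ^+ 2 <= 1.
      apply: (@le_trans _ _ ((12^-1) ^+ 2)).
        apply: le_trans HA; apply: le_trans h2; rewrite lerDr; apply: sumr_ge0 => i _.
        by rewrite mulr_ge0 ?sqr_ge0// exprn_ge0.
      by rewrite exprn_ile1// invf_le1// ler1n.
    rewrite expr0; apply: le_sqr_le => //; rewrite expr1n; apply: le_trans h3.
    rewrite exprMn -exprM; apply: ler_wpM2l; first exact: exprn_ge0.
    by rewrite lerXn2r ?nnegrE// addr_ge0 ?az_ge0.
  by rewrite [leRHS]exprSr; apply: (@halving T B ((2^-1) ^+ k) _ HA HB IH) => //; exact: exprn_ge0.
apply/eqP; rewrite -normr_le0; apply/contraT; rewrite -ltNge => d0.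
have n2 : 0 < n.+1%:R ^+ 2 :> R by rewrite exprn_gt0// ltr0n.
have e0 : 0 < n.+1%:R ^+ 2 * `|dzg c n.+1 t| by rewrite mulr_gt0.
have h12 : `|2^-1 : R| < 1 by rewrite ger0_norm//; lra.
have /cvgrPdist_lt/(_ _ e0)[N _ /(_ N (leqnn _))] := cvg_expr h12.
rewrite sub0r normrN ger0_norm ?exprn_ge0//.
by rewrite ltNge P.
Qed.

(** A continuity argument: while g equals the constructed solution it inherits the bound 8 A^2, and
    continuity in H^2 extends a slightly larger bound beyond the supremum of the agreement times. *)
Lemma agree t c n : 0 <= t -> coef (g t) c n = z c n t.
Proof.
pose E T := 0 <= T /\ forall t c n, 0 <= t <= T -> dzg c n t = 0.
have down T T' : E T -> 0 <= T' <= T -> E T'.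
  move=> [_ H] /andP[h1 h2]; split => // s d m /andP[s0 sT].
  by apply: H; rewrite s0 (le_trans sT).
have E0 : E 0.
  split => // s d m; rewrite -eq_le => /eqP <-.
  by rewrite /dzg (cs_init cs) g0 subrr.
suff all_E T : 0 <= T -> E T.
  move=> t0; have [_ H] := all_E t t0.
  have tt : 0 <= t <= t by rewrite t0 lexx.
  by have /eqP := H t c n tt; rewrite subr_eq0 => /eqP ->.
move=> T0; apply: contrapT => nE.
have ubT : ubound [set S | E S] T.
  move=> S ES; rewrite leNgt; apply/negP => TS; apply: nE; apply: (down S) => //.
  by rewrite T0 ltW.
have hS : has_sup [set S | E S] by split; [exists 0|exists T].
set tau := sup [set S | E S].
have tau0 : 0 <= tau by apply: ub_le_sup => //; exists T.
pose e : R := 100^-1 ^+ 2.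
have e0 : 0 < e by rewrite exprn_gt0// invr_gt0 ltr0n.
have [r [r0 Hr]] := g_near gC tau0 e0.
(* Agreement at the supremum itself is not yet known, so the bound is carried over from a time t1
   close to it. *)
have [t1 [t10 H1] ht1] := sup_adherent r0 hS.
have t1tau : t1 <= tau by apply: ub_le_sup; [exists T|split].
have eqt s : 0 <= s <= t1 -> S4 (coef (g s)) (8 * A ^+ 2).
  move=> s1; have s0 : 0 <= s by case/andP: s1.
  apply: S4_ext (z_S4 s0) => d m.
  by have /eqP := H1 s d m s1; rewrite subr_eq0 => /eqP ->.
(* Two uses of (x + y)^2 <= 2 (x^2 + y^2) along g s, g tau, g t1. With A^2 <= e / 4 this is at most
   14 e, and 4 (8 A^2 + B) <= 64 e = (8/100)^2 <= (1/12)^2. *)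
pose B : R := 2 * (e + 2 * (e + 8 * A ^+ 2)).
have A2 : A ^+ 2 <= e / 4.
  rewrite (_ : e / 4 = (100^-1 / 2) ^+ 2); last by rewrite /e; field.
  have h2 : A <= 100^-1 / 2 by apply: le_trans A200 _; rewrite le_eqVlt; apply/orP; left; apply/eqP; field.
  by apply: lerXn2r; rewrite ?nnegrE.
have A20 : 0 <= A ^+ 2 by exact: sqr_ge0.
have HB s : 0 <= s <= tau + r / 2 -> S4 (coef (g s)) B.
  move=> /andP[s0 sr]; have [st|st] := leP s t1.
    by apply: S4_le (eqt s _); [rewrite /B; lra|rewrite s0].
  have hs : `|s - tau| < r.
    by rewrite ltr_distl; apply/andP; split; [apply: lt_trans st|apply: le_lt_trans sr _; rewrite ltrD2l; lra].
  have h1 : `|t1 - tau| < r.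
    by rewrite ltr_distl ht1/=; apply: le_lt_trans t1tau _; rewrite ltrDl.
  have a1 := Hr s s0 hs.
  have a2 : S4 (fun c n => coef (g tau) c n - coef (g t1) c n) e.
    move=> N; apply: le_trans (Hr t1 t10 h1 N); apply: ler_sum => n' _.
    by rewrite le_eqVlt; apply/orP; left; apply/eqP; ring.
  have a3 : S4 (coef (g t1)) (8 * A ^+ 2) by apply: eqt; rewrite t10 lexx.
  apply: S4_ext (S4_add a1 (S4_add a2 a3)) => d m; ring.
have : E (tau + r / 2).
  split; first by rewrite addr_ge0// divr_ge0// ltW.
  apply: (agree_small _ HB); rewrite /B.
  have e12 : 64 * e <= (12^-1) ^+ 2.
    rewrite (_ : 64 * e = (8 * 100^-1) ^+ 2); last by rewrite /e; ring.
    have h2 : 8 * 100^-1 <= 12^-1 :> R by lra.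
    by apply: lerXn2r; rewrite ?nnegrE ?mulr_ge0.
  by move: e12 A2; move: (_ ^+ 2 : R) => q; lra.
move=> Er; have : tau + r / 2 <= tau by apply: ub_le_sup => //; exists T.
by rewrite gerDl leNgt divr_gt0.
Qed.

End Uniqueness.

Theorem theorem2p7 (R : realType) :
  exists C : R, 0 < C /\
  forall (nu : R) (f0 : R -> R),
    0 < nu -> sobolev 2 f0 ->
    (sobolev_norm 2 f0 <= (C^-1 * Num.min 1 (nu `^ (- 4^-1)))%:E)%E ->
    exists f : R -> R -> R,
      [/\ cauchy_solution nu f0 f,
          forall t : R, 0 < t ->
            (sobolev_norm 2 (f t) ^+ 2
             + \int[@lebesgue_measure R]_(s in `[0%R, t])
                 (nu%:E * sobolev_norm 2 (Lambda (3 / 2) (f s)) ^+ 2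
                  + sobolev_norm 2 (Lambda (2^-1) (f s)) ^+ 2)
             <= sobolev_norm 2 f0 ^+ 2)%E &
          forall g : R -> R -> R, cauchy_solution nu f0 g ->
            forall t : R, 0 <= t ->
              {ae @lebesgue_measure R, forall x, g t x = f t x}].
Proof.
(* A norm of at most 1/600 bounds the weighted sum of (|p| + |q|)^2 by 2 pi / 600^2 <= 9 / 600^2 =
   (1/200)^2, and A = 1/200 is small enough for both existence and uniqueness. *)
exists 600%:R; split; first by rewrite ltr0n.
move=> nu f0 nu0 sf0 small.
have [lf0 J0f _] := sf0; have if0 := L2T_int lf0.
pose A : R := 200^-1.
have A0 : 0 <= A by rewrite invr_ge0 ler0n.
have A64 : 64 * A <= 1 by rewrite /A; lra.
have A200 : A <= 200^-1 by exact: lexx.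
pose z0 := coef f0.
have z00 b : z0 b 0%N = 0 by case: b; [rewrite /z0 /coef cc0|exact: ss0].
have small' : (sobolev_norm 2 f0 <= (600^-1)%:E)%E.
  apply: le_trans small _; rewrite lee_fin; apply: ler_piMr; first by rewrite invr_ge0 ler0n.
  by rewrite ge_min lexx.
have c0 : 0 <= 600^-1 :> R by rewrite invr_ge0 ler0n.
have H4 := sobolev_S4 if0 c0 small'.
have Hal N : \sum_(n < N) n%:R ^+ 4 * (`|z0 true n| + `|z0 false n|) ^+ 2 <= A ^+ 2.
  apply: le_trans (S4_az H4 N) _.
  have p4 : pi <= 4 :> R by have := @pihalf_lt2 R; move: (pi : R) => P; lra.
  apply: (@le_trans _ _ (2 * (4 * 600^-1 ^+ 2))).
    by apply: ler_wpM2l; [exact: ler0n|apply: ler_wpM2r; [exact: sqr_ge0|exact: p4]].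
  rewrite /A (_ : 200^-1 = 3 * 600^-1 :> R); last by field.
  by rewrite exprMn; have := sqr_ge0 (600^-1 : R); lra.
have [Y [z [F cs]]] := coef_solution_exists nu0 A0 A64 z00 Hal.
have [f [f00 Hf]] := realize nu0 A0 z00 cs lf0 (fun n => erefl _) (fun n => erefl _).
have s20 : 2 != 0 :> R by [].
have := sf0 => -[_ _]; rewrite sqre_lty ?sobolev_norm_ge0// sobolev_norm_sqr// => fin.
have g0 k : 0 <= pi^-1 * k%:R `^ (2 * 2) * sq f0 k.
  by rewrite !mulr_ge0 ?powR_ge0 ?sq_ge0// invr_ge0 pi_ge0.
(* S is the exact squared norm of the datum, not its smallness bound, so the right-hand side of the
   energy inequality is precisely that of [f0]. *)
have [S [S0 [eS HS]]] := nneseries_fin_bound g0 fin.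
have HS4 N : \sum_(n < N) n%:R ^+ 4 * (z0 true n ^+ 2 + z0 false n ^+ 2) <= pi * S.
  apply: le_trans (ler_wpM2l (pi_ge0 R) (HS N)); rewrite mulr_sumr; apply: ler_sum => n _.
  by rewrite powR4 -mulrA mulVKf ?gt_eqF ?pi_gt0//; exact: lexx.
exists f; split.
- split.
  + exact: (f_continuous nu0 z00 cs Hf).
  + exact: (f_L2 nu0 z00 cs Hf HS4).
  + exact: (f_distributional nu0 A0 z00 cs Hf).
  + by rewrite f00; apply: aeW.
- move=> t t0; rewrite eS.
  have := f_energy nu0 z00 cs Hf HS4 t0.
  by rewrite mulKf// gt_eqF// pi_gt0.
- move=> g [gC gL gD gi] t t0.
  have g00 c n : coef (g 0) c n = z0 c n.
    have ig := g_int gC (lexx 0).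
    have gi' : {ae @lebesgue_measure R, forall x, circle x -> g 0 x = f0 x}.
      by apply: aeS gi => x ->.
    have [h1 h2] := coef_ae_eq ig if0 gi'.
    by case: c; [exact: h1|exact: h2].
  have ag c n : coef (g t) c n = z c n t by exact: (agree nu0 A0 A200 z00 cs gC gL gD g00 c n t0).
  have [lf hc hs] := Hf t t0; have lg := g_L2T gC t0.
  apply: ae_periodic; [by case: lg|by case: lf|].
  apply: coef_inj; [exact: L2T_int|exact: L2T_int| |].
  + by move=> n; rewrite hc -(ag true).
  + by move=> n; rewrite hs -(ag false).
Qed.
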